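(* Let $n,n'\ge1$ be integers and let $g=(x,u),\,g'=(x',u')\in\mathbb{R}^n\times\mathbb{R}^{n'}$ satisfy $x=-x'$, $r=|u-u'|>0$ and $2r\ge\pi|x|^2$. Then, as $h\to0^+$, $$p_h(g,g')=\frac{(2\pi)^{\frac{n'}2}}{h^{\frac{n'}2+n}}\,\mathbf C(n,n')\,\tilde{\mathbf V}_2(i\pi)\,e^{-\frac{d(g,g')^2}{4h}}\int_{\mathbb{R}^n}\frac{e^{-\frac1{2h}\widetilde{\mathbf E}_{g,g'}(\eta)}}{\sqrt{\det\widetilde{\mathbf A}_{g,g'}(\eta)}}\,d\eta\;\big(1+O(h^{1/8})\big),$$ where $$\mathbf C(n,n')=\frac1{(2\pi)^{\frac n2}(4\pi)^{n'+\frac n2}},\qquad \tilde{\mathbf V}_2(s)=\prod_{k\ge2}\Big(1+\frac{s^2}{k^2\pi^2}\Big)^{-\frac n2},\ \text{ so } \tilde{\mathbf V}_2(i\pi)=2^{\frac n2},$$ $$\det\widetilde{\mathbf A}_{g,g'}(\eta)=\Big(\frac{|\eta|^2}{\pi^2}+\frac{R^2}8\Big)^{n'-1}\Big(\frac{|\eta|^2}{\pi^2}+\frac{R^2}4\Big),\qquad \widetilde{\mathbf E}_{g,g'}(\eta)=\frac{\big(|\eta|^2-\frac\pi4(2r-\pi|x|^2)\big)^2}{|\eta|^2+\frac{\pi^2R^2}4},$$ and $R^2=|x|^2+|x'|^2$.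
   Context: On $\mathbb{R}^n_x\times\mathbb{R}^{n'}_u$ with Lebesgue measure, put $X_j=\partial_{x_j}$, $U_{jk}=x_j\,\partial_{u_k}$ ($1\le j\le n$, $1\le k\le n'$). The Grushin operator is $\Delta_G=\Delta_x+|x|^2\Delta_u=\sum_j\big(X_j^2+\sum_k U_{jk}^2\big)$. $d(g,g')$ is the Carnot–Carathéodory distance associated with these vector fields; it is known that $d(g,g')^2=2\pi r$ when $x=-x'$ and $2r\ge\pi|x|^2$. $p_h(g,g')$ ($h>0$) is the heat kernel, i.e. the fundamental solution of $\partial_h-\Delta_G$; explicitly $$p_h(g,g')=(4\pi h)^{-\frac n2-n'}\int_{\mathbb{R}^{n'}}\Big(\frac{|\lambda|}{\sinh|\lambda|}\Big)^{\frac n2}\exp\Big\{-\frac1{4h}\Big[(|x|^2+|x'|^2)\,|\lambda|\coth|\lambda|-2\,x\cdot x'\,\frac{|\lambda|}{\sinh|\lambda|}-2i\,(u-u')\cdot\lambda\Big]\Big\}\,d\lambda.$$ The expression $\det\widetilde{\mathbf A}_{g,g'}(\eta)$ is to be read simply as the displayed function of $\eta\in\mathbb{R}^n$. The points $g,g'$ are fixed in the asymptotics. *)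

(* Defs.v *)
From HB Require Import structures.
From mathcomp Require Import all_boot all_order all_algebra.
From mathcomp Require Import complex.
From mathcomp Require Import all_classical all_reals all_analysis.

Set Implicit Arguments.
Unset Strict Implicit.
Unset Printing Implicit Defensive.
Import Order.TTheory GRing.Theory Num.Theory.
Import numFieldNormedType.Exports.

Local Open Scope classical_set_scope.
Local Open Scope ring_scope.

(** Lebesgue measure on R^n, as the n-fold product of the measure on R *)

Section lebesgue_Rn_step.
Context (R : realType) (n : nat).
Local Notation T := (measurableTypeR R).
Variable mu : {sigma_finite_measure set (n.-tuple T) -> \bar R}.

Definition consT (p : T * n.-tuple T) : n.+1.-tuple T :=
  [the n.+1.-tuple T of p.1 :: p.2].

Lemma measurable_consT : measurable_fun [set: T * n.-tuple T] consT.
Proof. exact: measurable_cons. Qed.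

Definition lebesgue_Rn_step : set (n.+1.-tuple T) -> \bar R :=
  pushforward (lebesgue_measure \x mu)%E consT.

Let step0 : lebesgue_Rn_step set0 = 0%E.
Proof. by rewrite /lebesgue_Rn_step /pushforward preimage_set0 measure0. Qed.

Let step_ge0 A : (0 <= lebesgue_Rn_step A)%E.
Proof. by rewrite /lebesgue_Rn_step /pushforward measure_ge0. Qed.

Let step_sigma_additive : semi_sigma_additive lebesgue_Rn_step.
Proof.
move=> F mF tF mUF; rewrite /lebesgue_Rn_step /pushforward preimage_bigcup.
have mc A : measurable A -> measurable (consT @^-1` A).
  by move=> mA; rewrite -[X in measurable X]setTI; exact: measurable_consT.
apply: measure_semi_sigma_additive.
- by move=> k; exact: mc.
- apply/trivIsetP => /= i j _ _ ij; rewrite -preimage_setI.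
  by move/trivIsetP : tF => /(_ _ _ _ _ ij) ->//; rewrite preimage_set0.
- by rewrite -preimage_bigcup; exact: mc.
Qed.

HB.instance Definition _ := isMeasure.Build _ _ _ lebesgue_Rn_step
  step0 step_ge0 step_sigma_additive.

Let step_sigma_finite : sigma_finite setT lebesgue_Rn_step.
Proof.
have /sigma_finiteP[F [TF ndF Foo]] := sigma_finiteT (@lebesgue_measure R).
have /sigma_finiteP[G [TG ndG Goo]] := sigma_finiteT mu.
pose g (t : n.+1.-tuple T) : T * n.-tuple T := (thead t, [tuple of behead t]).
have gK p : g (consT p) = p.
  by case: p => a t; rewrite /g /consT/=; congr (_, _); exact/val_inj.
have mg : measurable_fun setT g.
  apply/measurable_fun_pair => //=; last exact: measurable_behead.
  exact: measurable_tnth.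
exists (fun k => g @^-1` (F k `*` G k)).
  apply/esym; rewrite -subTset => t _.
  have [i _ Fi] : (\bigcup_i F i) (g t).1 by rewrite -TF.
  have [j _ Gj] : (\bigcup_i G i) (g t).2 by rewrite -TG.
  exists (maxn i j) => //; split.
  - by move: Fi; exact/subsetPset/ndF/leq_maxl.
  - by move: Gj; exact/subsetPset/ndG/leq_maxr.
move=> k; have [mFk Fk] := Foo k; have [mGk Gk] := Goo k; split.
  by rewrite -[X in measurable X]setTI; apply: mg => //; exact: measurableX.
rewrite /lebesgue_Rn_step /pushforward -comp_preimage.
rewrite (_ : g \o consT = id); last exact/funext.
by rewrite preimage_id product_measure1E// lte_mul_pinfty// ge0_fin_numE.
Qed.

HB.instance Definition _ := Measure_isSigmaFinite.Build _ _ _ lebesgue_Rn_step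
  step_sigma_finite.

End lebesgue_Rn_step.

Fixpoint lebesgue_Rn (R : realType) (n : nat) :
    {sigma_finite_measure set (n.-tuple (measurableTypeR R)) -> \bar R} :=
  match n with
  | 0 => \d_([tuple] : 0.-tuple (measurableTypeR R))
  | k.+1 => lebesgue_Rn_step (lebesgue_Rn R k)
  end.

Section Rn.
Context (R : realType) (n : nat).
Local Notation C := R[i].
Implicit Types (x y : 'rV[R]_n).

(* The library's norm on ['rV[R]_n] is the sup norm. *)
Definition dotp x y : R := \sum_(i < n) x 0 i * y 0 i.
Definition enorm x : R := Num.sqrt (dotp x x).

Definition int_Rn (f : 'rV[R]_n -> R) : R :=
  (\int[lebesgue_Rn R n]_t f (\row_i tnth t i))%R.

Definition cint_Rn (f : 'rV[R]_n -> C) : C :=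
  Complex (int_Rn (fun x => complex.Re (f x)))
          (int_Rn (fun x => complex.Im (f x))).

End Rn.

Section elementary.
Context (R : realType).
Local Notation C := R[i].

Definition sinh (t : R) : R := (expR t - expR (- t)) / 2.
Definition cosh (t : R) : R := (expR t + expR (- t)) / 2.
Definition coth (t : R) : R := cosh t / sinh t.

Definition rC (t : R) : C := Complex t 0.
Definition iC : C := Complex 0 1.

Definition cexp (z : C) : C :=
  rC (expR (complex.Re z)) *
  Complex (cos (complex.Im z)) (sin (complex.Im z)).

Definition cmod (z : C) : R :=
  Num.sqrt (complex.Re z ^+ 2 + complex.Im z ^+ 2).

(* principal argument, in ]-pi, pi] for z != 0 *)
Definition carg (z : C) : R :=
  if 0 <= complex.Im z then acos (complex.Re z / cmod z)
  else - acos (complex.Re z / cmod z).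

(* principal branch of z ^ a, for z != 0 and a real exponent *)
Definition cpow (z : C) (a : R) : C :=
  rC (cmod z `^ a) * cexp (Complex 0 (a * carg z)).

Definition climn (v : nat -> C) : C :=
  Complex (limn (fun N => complex.Re (v N))) (limn (fun N => complex.Im (v N))).

End elementary.

(** Carnot-Caratheodory distance for X_j = d/dx_j, U_jk = x_j d/du_k *)

Section ccdist.
Context (R : realType) (n m : nat).
Local Notation mu := (@lebesgue_measure R).

(* (x, u) : [0, 1] -> R^n * R^m is absolutely continuous and, for almost
   every t, its velocity is  sum_j a_j(t) X_j + sum_jk b_jk(t) U_jk.
   Absolute continuity and the a.e. differential equation are written together
   in integral form: absolutely continuous functions on [0, 1] are exactly the
   primitives of integrable functions. *)
Definition horizontal (x : R -> 'rV[R]_n) (u : R -> 'rV[R]_m)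
    (a : R -> 'rV[R]_n) (b : R -> 'M[R]_(n, m)) : Prop :=
  [/\ forall j, mu.-integrable `[0, 1] (fun t => (a t 0 j)%:E),
      forall j k, mu.-integrable `[0, 1] (fun t => (b t j k)%:E),
      forall t, 0 <= t <= 1 -> forall j,
        x t 0 j = x 0 0 j + (\int[mu]_(s in `[0%R, t]) a s 0%R j)%R &
      forall t, 0 <= t <= 1 -> forall k,
        u t 0 k = u 0 0 k +
          (\int[mu]_(s in `[0%R, t]) (\sum_(j < n) x s 0%R j * b s j k))%R].

Definition cc_length (a : R -> 'rV[R]_n) (b : R -> 'M[R]_(n, m)) : R :=
  (\int[mu]_(t in `[0%R, 1%R])
     Num.sqrt (\sum_(j < n) (a t 0%R j ^+ 2 + \sum_(k < m) b t j k ^+ 2)))%R.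

Definition ccdist (g g' : 'rV[R]_n * 'rV[R]_m) : R :=
  inf [set L | exists x u a b, [/\ horizontal x u a b,
    (x 0, u 0) = g, (x 1, u 1) = g' & L = cc_length a b]].

End ccdist.

Section heat_kernel.
Context (R : realType) (n m : nat).

(* Explicit formula for the heat kernel of the Grushin operator.  At the single
   point lambda = 0 the quotients take junk values, which do not affect the
   integral since it is used for m >= 1. *)
Definition heat_kernel (h : R) (g g' : 'rV[R]_n * 'rV[R]_m) : R[i] :=
  rC ((4 * pi * h) `^ (- (n%:R / 2) - m%:R)) *
  cint_Rn (fun l : 'rV[R]_m =>
    let q := enorm l / sinh (enorm l) in
    rC (q `^ (n%:R / 2)) *
    cexp (rC (- (4 * h)^-1) *
      (rC ((enorm g.1 ^+ 2 + enorm g'.1 ^+ 2) * (enorm l * coth (enorm l)))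
       - rC (2 * dotp g.1 g'.1 * q)
       - 2 * iC R * rC (dotp (g.2 - g'.2) l)))).

End heat_kernel.

Section asymptotics.
Context (R : realType).

Definition Cnm (n m : nat) : R :=
  ((2 * pi) `^ (n%:R / 2) * (4 * pi) `^ (m%:R + n%:R / 2))^-1.

Definition V2 (n : nat) (s : R[i]) : R[i] :=
  climn (fun N => \prod_(2 <= k < N)
    cpow (1 + s ^+ 2 / rC (k%:R ^+ 2 * pi ^+ 2)) (- (n%:R / 2))).

Context (n m : nat).

Definition R2 (g g' : 'rV[R]_n * 'rV[R]_m) : R :=
  enorm g.1 ^+ 2 + enorm g'.1 ^+ 2.

Definition detA (g g' : 'rV[R]_n * 'rV[R]_m) (eta : 'rV[R]_n) : R :=
  (enorm eta ^+ 2 / pi ^+ 2 + R2 g g' / 8) ^+ (m - 1) *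
  (enorm eta ^+ 2 / pi ^+ 2 + R2 g g' / 4).

Definition Etilde (g g' : 'rV[R]_n * 'rV[R]_m) (eta : 'rV[R]_n) : R :=
  let r := enorm (g.2 - g'.2) in
  (enorm eta ^+ 2 - pi / 4 * (2 * r - pi * enorm g.1 ^+ 2)) ^+ 2 /
  (enorm eta ^+ 2 + pi ^+ 2 * R2 g g' / 4).

End asymptotics.

(* Main.v *)
(* The integrand of the heat kernel is an oscillating exponential times the modulus
   (s / sinh s)^(n/2) exp (- |x|^2 s coth (s/2) / (2h)), s = |lambda|, which is singular at the saddle
   s = i pi. Instead of shifting contours, Euler's product for sinh and the partial fractions of coth
   are used to write the modulus as a limit of Gaussian mixtures
   int int gamma(y) exp (- (s^2 + pi^2) T(eta, y) / h) dy d eta, where gamma is the standard Gaussian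
   density, y has n coordinates for each factor k >= 2 of the product, and
   2 pi^2 T = |eta|^2 + sum_i (al_i + sqrt h be_i y_i)^2. Tonelli's theorem then gives p_h(g, g') as
   exp (- pi r / (2h)) times an integral of the positive function
   gamma(y) T^(-n'/2) exp (- (r - 4 pi T)^2 / (16 h T)). Linearising T in y costs a factor
   1 + O(h^(1/8)) (in the proof h = k^16) and an exponentially small error, negligible because the main
   integral is at least c h^n; after the linearisation the integral over y is Gaussian and equals the
   integrand of the theorem exactly. Finally d(g, g')^2 = 2 pi r, the lower bound for the length being
   an isoperimetric inequality of Dido type. *)
Require Import Defs.
From mathcomp Require Import all_boot all_order all_algebra.
From mathcomp Require Import complex zify ring lra.
From mathcomp Require Import all_classical all_reals all_analysis.
From mathcomp Require Import measurable_realfun.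
Set Implicit Arguments.
Unset Strict Implicit.
Unset Printing Implicit Defensive.
Import Order.TTheory GRing.Theory Num.Theory.
Import numFieldNormedType.Exports.
Local Open Scope classical_set_scope.
Local Open Scope ring_scope.

(** The mixture exists because every factor is normalised at the saddle. Put
    [theta = (s^2 + pi^2) / (2 pi^2 h)]. The k-th Euler factor divided by its value at [s = i pi] is
    [1 + 2 theta h / (k^2 - 1)], the normalisation of a Gaussian integral with
    [be^2 = 1 / (k^2 - 1)]; the factor [k = 1] is proportional to [theta] and yields the integral
    over eta. Likewise [s coth (s / 2)] vanishes at [i pi], and each of its pole terms, shifted by
    its value there, contributes [theta al^2 / (1 + 2 theta h be^2)], the exponent of the same
    Gaussian integral with a shift [al]. Once lambda is integrated out nothing oscillates, so no
    cancellation has to be estimated. The product must be truncated to finitely many variables y;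
    the estimates therefore see y only through a linear form L and a quadratic form Q, which makes
    all constants independent of the truncation. The hypothesis [2 r >= pi |x|^2] says that the
    phase vanishes on a real sphere [|eta|^2 = pi / 4 (2 r - pi |x|^2)]: it yields the lower bound
    of order [h^n], and it makes the explicit minimising curve exist. *)

(** * Derivatives, measurability and continuity of explicit functions *)

Section der.
Context (R : realType).
Implicit Types (f g : R -> R) (x a b c : R).

Lemma is_derive_subst f x a b :
  is_derive x (1 : R) f a -> a = b -> is_derive x (1 : R) f b.
Proof. by move=> ? <-. Qed.

Lemma is_derive_addf f g x a b : is_derive x (1 : R) f a -> is_derive x (1 : R) g b ->
  is_derive x (1 : R) (fun z => f z + g z) (a + b).
Proof. by move=> ? ?; exact: is_deriveD. Qed.

Lemma is_derive_oppf f x a : is_derive x (1 : R) f a ->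
  is_derive x (1 : R) (fun z => - f z) (- a).
Proof. by move=> ?; exact: is_deriveN. Qed.

Lemma is_derive_mulf f g x a b : is_derive x (1 : R) f a -> is_derive x (1 : R) g b ->
  is_derive x (1 : R) (fun z => f z * g z) (a * g x + f x * b).
Proof.
move=> fa gb; have H := @is_deriveM _ _ f g x 1 a b fa gb.
have -> : (fun z => f z * g z) = f * g by apply/funext.
apply: (is_derive_subst H).
by rewrite /GRing.scale/= addrC (mulrC (g x)).
Qed.

Lemma is_derive_idf x : is_derive x (1 : R) (fun z : R => z) 1.
Proof. exact: is_derive_id. Qed.

Lemma is_derive_cstf c x : is_derive x (1 : R) (fun _ : R => c) 0.
Proof. exact: is_derive_cst. Qed.

Lemma is_derive_powf f n x a : is_derive x (1 : R) f a ->
  is_derive x (1 : R) (fun z => f z ^+ n) (n%:R * f x ^+ n.-1 * a).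
Proof.
move=> fa; elim: n => [|n IH].
  by rewrite mul0r mul0r; under eq_fun do rewrite expr0; exact: is_derive_cst.
under eq_fun do rewrite exprS.
apply: (is_derive_subst (is_derive_mulf fa IH)).
case: n {IH} => [|n] /=; first by rewrite expr0; ring.
by rewrite exprS -[n.+2]addn1 natrD; ring.
Qed.

Lemma is_derive_compf (h : R -> R) f x a b :
  is_derive (f x) (1 : R) h b -> is_derive x (1 : R) f a ->
  is_derive x (1 : R) (fun z => h (f z)) (b * a).
Proof. by move=> ? ?; exact: is_derive1_comp. Qed.

Lemma is_derive_invf f x a : f x != 0 -> is_derive x (1 : R) f a ->
  is_derive x (1 : R) (fun z => (f z)^-1) (- (f x) ^- 2 * a).
Proof.
move=> fx0 fa; have H := is_deriveV fx0 fa.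
apply: (is_derive_subst H).
by rewrite /GRing.scale/=.
Qed.

End der.

Lemma is_derive_sinh (R : realType) (x : R) : is_derive x (1 : R) (@sinh R) (cosh x).
Proof.
apply: (is_derive_subst (is_derive_mulf (is_derive_addf (is_derive_expR x)
  (is_derive_oppf (is_derive_compf (is_derive_expR (- x)) (is_derive_oppf (is_derive_idf x))))) (is_derive_cstf (2^-1) x))).
by rewrite /cosh; ring.
Qed.

Lemma is_derive_cosh (R : realType) (x : R) : is_derive x (1 : R) (@cosh R) (sinh x).
Proof.
apply: (is_derive_subst (is_derive_mulf (is_derive_addf (is_derive_expR x)
  (is_derive_compf (is_derive_expR (- x)) (is_derive_oppf (is_derive_idf x)))) (is_derive_cstf (2^-1) x))).
by rewrite /sinh; ring.
Qed.

Ltac der := lazymatch goal with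
 | |- is_derive _ _ (fun z => z) _ => apply is_derive_idf
 | |- is_derive _ _ (fun _ => ?c) _ => apply is_derive_cstf
 | |- is_derive _ _ (fun z => @?f z + @?g z) _ => eapply (@is_derive_addf _ f g); der
 | |- is_derive _ _ (fun z => @?f z * @?g z) _ => eapply (@is_derive_mulf _ f g); der
 | |- is_derive _ _ (fun z => - @?f z) _ => eapply (@is_derive_oppf _ f); der
 | |- is_derive _ _ (fun z => (@?f z) ^+ ?n) _ => eapply (@is_derive_powf _ f n); der
 | |- is_derive _ _ (fun z => (@?f z)^-1) _ => eapply (@is_derive_invf _ f); [|der]
 | |- is_derive _ _ (fun z => expR (@?f z)) _ =>
     eapply (@is_derive_compf _ expR f); [apply is_derive_expR|der]
 | |- is_derive _ _ (fun z => cos (@?f z)) _ =>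
     eapply (@is_derive_compf _ cos f); [apply is_derive_cos|der]
 | |- is_derive _ _ (fun z => sin (@?f z)) _ =>
     eapply (@is_derive_compf _ sin f); [apply is_derive_sin|der]
 | |- is_derive _ _ (fun z => sinh (@?f z)) _ =>
     eapply (@is_derive_compf _ (@sinh _) f); [apply is_derive_sinh|der]
 | |- is_derive _ _ (fun z => cosh (@?f z)) _ =>
     eapply (@is_derive_compf _ (@cosh _) f); [apply is_derive_cosh|der]
 | |- is_derive _ _ (fun z => ?h z) _ => solve [eauto]
 | |- is_derive _ _ (fun z => ?h (@?f z)) _ =>
     eapply (@is_derive_compf _ h f); [solve [eauto]|der]
 | |- _ => solve [eauto]
 end.

Section meas.
Context (R : realType) d (T : measurableType d).
Implicit Types (f g : T -> R).

Lemma measurable_fun_cos f : measurable_fun setT f -> measurable_fun setT (fun x => cos (f x)).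
Proof.
move=> mf; apply: (@measurableT_comp _ _ _ _ _ _ (@cos R)) => //.
by apply: continuous_measurable_fun; exact: continuous_cos.
Qed.

Lemma measurable_fun_sin f : measurable_fun setT f -> measurable_fun setT (fun x => sin (f x)).
Proof.
move=> mf; apply: (@measurableT_comp _ _ _ _ _ _ (@sin R)) => //.
by apply: continuous_measurable_fun; exact: continuous_sin.
Qed.

Lemma measurable_fun_expR f : measurable_fun setT f -> measurable_fun setT (fun x => expR (f x)).
Proof. by move=> mf; apply: (@measurableT_comp _ _ _ _ _ _ (@expR R)). Qed.

Lemma measurable_fun_oppr f : measurable_fun setT f -> measurable_fun setT (fun x => - f x).
Proof. by move=> mf; apply: (@measurableT_comp _ _ _ _ _ _ (@GRing.opp R)). Qed.

Lemma measurable_fun_sqrt f : measurable_fun setT f -> measurable_fun setT (fun x => Num.sqrt (f x)).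
Proof.
move=> mf; apply: (@measurableT_comp _ _ _ _ _ _ (@Num.sqrt R)) => //.
by apply: continuous_measurable_fun; exact: sqrt_continuous.
Qed.

Lemma measurable_fun_powRl f (a : R) : measurable_fun setT f -> measurable_fun setT (fun x => f x `^ a).
Proof.
by move=> mf; apply: (@measurableT_comp _ _ _ _ _ _ (@powR R ^~ a)) => //; exact: measurable_powR.
Qed.

Lemma measurable_fun_invr f : measurable_fun setT f -> measurable_fun setT (fun x => (f x)^-1).
Proof.
(* At zeros of [f] both sides are 0 by the convention for inverses, so the real power of a square
   covers every sign. *)
move=> mf; have -> : (fun x => (f x)^-1) = (fun x => f x * ((f x ^+ 2) `^ (-1))).
  apply/funext => x; rewrite powR_inv1 ?sqr_ge0//.
  have [->|f0] := eqVneq (f x) 0; first by rewrite invr0 mul0r.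
  by field.
by apply: measurable_funM => //; apply: measurable_fun_powRl; apply: measurable_funX.
Qed.

End meas.

Ltac meas_hook := fail.

Ltac meas := lazymatch goal with
 | |- measurable_fun _ (fun _ => ?c) => apply: measurable_cst
 | |- measurable_fun _ (fun z => (@?f z)%:E) => apply: (proj2 (measurable_EFinP _ f)); meas
 | |- measurable_fun _ (EFin \o _) => apply/measurable_EFinP; meas
 | |- measurable_fun _ (fun z => (@?f z + @?g z)%R) => apply: (@measurable_funD _ _ _ _ f g); meas
 | |- measurable_fun _ (fun z => (@?f z * @?g z)%R) => apply: (@measurable_funM _ _ _ _ f g); meas
 | |- measurable_fun _ (fun z => - @?f z) => apply: (@measurable_fun_oppr _ _ _ f); meas
 | |- measurable_fun _ (fun z => (@?f z) ^+ ?n) => apply: (@measurable_funX _ _ _ _ f n); meas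
 | |- measurable_fun _ (fun z => (@?f z)^-1) => apply: (@measurable_fun_invr _ _ _ f); meas
 | |- measurable_fun _ (fun z => (@?f z) `^ ?n) => apply: (@measurable_fun_powRl _ _ _ f n); meas
 | |- measurable_fun _ (fun z => expR (@?f z)) => apply: (@measurable_fun_expR _ _ _ f); meas
 | |- measurable_fun _ (fun z => cos (@?f z)) => apply: (@measurable_fun_cos _ _ _ f); meas
 | |- measurable_fun _ (fun z => sin (@?f z)) => apply: (@measurable_fun_sin _ _ _ f); meas
 | |- measurable_fun _ (fun z => Num.sqrt (@?f z)) => apply: (@measurable_fun_sqrt _ _ _ f); meas
 | |- measurable_fun _ (fun z => \sum_(i <- ?r) (@?f i z)) => apply: measurable_sum => ?; meas
 | |- measurable_fun _ (fun z => \prod_(i <- ?r) (@?f i z)) => apply: measurable_prod => ? ?; meas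
 | |- measurable_fun _ (fun z => tnth (@?f z) ?i) => apply: (measurableT_comp (measurable_tnth i)); meas
 | |- _ => first [solve [done | eauto | exact: measurable_id | exact: measurable_fst | exact: measurable_snd] | meas_hook]
 end.

Section integrable_EFin.
Context (R : realType) d (T : measurableType d) (mu : {measure set T -> \bar R}).
Context (D : set T) (mD : measurable D).

Lemma integrable_EFinZ (k : R) (f : T -> R) : mu.-integrable D (EFin \o f) ->
  mu.-integrable D (EFin \o (fun x => k * f x)).
Proof.
move=> intf; rewrite (_ : EFin \o _ = (fun x => k%:E * (EFin \o f) x)%E); last exact/funext.
exact: integrableZl.
Qed.

Lemma integrable_EFinD (f g : T -> R) : mu.-integrable D (EFin \o f) ->
  mu.-integrable D (EFin \o g) -> mu.-integrable D (EFin \o (fun x => f x + g x)).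
Proof.
move=> intf intg; rewrite (_ : EFin \o _ = ((EFin \o f) \+ (EFin \o g))%E); last exact/funext.
exact: integrableD.
Qed.

End integrable_EFin.
Lemma continuous_at_is_derive (R : realType) (f : R -> R) (x df : R) :
  is_derive x (1 : R) f df -> {for x, continuous f}.
Proof. by move=> df'; apply/differentiable_continuous/derivable1_diffP; have [] := df'. Qed.
Lemma integralZl_ge0_EFin (R : realType) d (T : measurableType d)
    (mu : {measure set T -> \bar R}) (k : R) (f : T -> R) :
  0 <= k -> measurable_fun setT f -> (forall x, 0 <= f x) ->
  (\int[mu]_x (k%:E * (f x)%:E) = k%:E * \int[mu]_x (f x)%:E)%E.
Proof.
move=> k0 mf f0; apply: ge0_integralZl => //.
- exact/measurable_EFinP.
- by move=> x _; rewrite lee_fin.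
Qed.
Section continuity.
Context (R : realType).
Implicit Types (f g h : R -> R) (x c : R).

Definition cts f x : Prop := {for x, continuous f}.

Lemma cts_continuous f : (forall x, cts f x) -> continuous f.
Proof. by []. Qed.

Lemma cts_id x : cts (fun z => z) x. Proof. exact: cvg_id. Qed.

Lemma cts_cst c x : cts (fun _ => c) x. Proof. exact: cvg_cst. Qed.

Lemma cts_add f g x : cts f x -> cts g x -> cts (fun z => f z + g z) x.
Proof. by move=> cf cg; exact: (@continuousD _ _ _ f g x cf cg). Qed.

Lemma cts_mul f g x : cts f x -> cts g x -> cts (fun z => f z * g z) x.
Proof. by move=> cf cg; exact: (@continuousM _ _ f g x cf cg). Qed.

Lemma cts_opp f x : cts f x -> cts (fun z => - f z) x.
Proof. by move=> cf; exact: (@continuousN _ _ _ f x cf). Qed.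

Lemma cts_comp h f x : cts h (f x) -> cts f x -> cts (fun z => h (f z)) x.
Proof. by move=> ch cf; exact: (@continuous_comp _ _ _ f h x cf ch). Qed.

Lemma cts_exprn f n x : cts f x -> cts (fun z => f z ^+ n) x.
Proof. by move=> cf; apply: (cts_comp (h := fun z => z ^+ n)) cf; exact: exprn_continuous. Qed.

Lemma cts_inv f x : f x != 0 -> cts f x -> cts (fun z => (f z)^-1) x.
Proof. by move=> f0 cf; exact: continuousV. Qed.

Lemma cts_sum (I : Type) (r : seq I) (F : I -> R -> R) x :
  (forall i, cts (F i) x) -> cts (fun z => \sum_(i <- r) F i z) x.
Proof.
move=> cF; elim: r => [|i r IH].
  rewrite (_ : (fun z => _) = (fun _ => 0)); first exact: cts_cst.
  by apply/funext => z; rewrite big_nil.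
rewrite (_ : (fun z => _) = (fun z => F i z + \sum_(j <- r) F j z)); first exact: cts_add.
by apply/funext => z; rewrite big_cons.
Qed.

End continuity.

Ltac ctsauto := lazymatch goal with
 | |- cts (fun z => z) _ => apply: cts_id
 | |- cts (fun _ => ?c) _ => apply: cts_cst
 | |- cts (fun z => @?f z + @?g z) _ => apply: (@cts_add _ f g); ctsauto
 | |- cts (fun z => @?f z * @?g z) _ => apply: (@cts_mul _ f g); ctsauto
 | |- cts (fun z => - @?f z) _ => apply: (@cts_opp _ f); ctsauto
 | |- cts (fun z => (@?f z) ^+ ?n) _ => apply: (@cts_exprn _ f n); ctsauto
 | |- cts (fun z => (@?f z)^-1) _ => apply: (@cts_inv _ f); [|ctsauto]
 | |- cts (fun z => expR (@?f z)) _ => apply: (@cts_comp _ (@expR _) f); [exact: continuous_expR|ctsauto]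
 | |- cts (fun z => cos (@?f z)) _ => apply: (@cts_comp _ (@cos _) f); [exact: continuous_cos|ctsauto]
 | |- cts (fun z => sin (@?f z)) _ => apply: (@cts_comp _ (@sin _) f); [exact: continuous_sin|ctsauto]
 | |- cts (fun z => Num.sqrt (@?f z)) _ => apply: (@cts_comp _ (@Num.sqrt _) f); [exact: sqrt_continuous|ctsauto]
 | |- cts (fun z => `|@?f z|) _ => apply: (@cts_comp _ (fun y => `|y|) f); [exact: norm_continuous|ctsauto]
 | |- cts (fun z => \sum_(i <- ?r) (@?f i z)) _ => apply: (@cts_sum _ _ r f) => ?; ctsauto
 | |- _ => solve [done | match goal with
     | H : continuous ?f |- cts ?g _ => unify f g; exact: H
     | H : forall j, continuous _ |- _ => exact: H
     | H : forall j, cts _ _ |- _ => exact: H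
     | H : cts _ _ |- _ => exact: H end]
 end.

Ltac cont := apply cts_continuous; intro; ctsauto.

(** Cauchy-Schwarz by the discriminant: with [U], [V], [S] the three sums,
    [\sum_i (U * w i - S * u i) ^+ 2] equals [U * (U * V - S ^+ 2)]. *)
Lemma sqr_sum_le_mul (R : realType) (I : finType) (u w : I -> R) :
  (\sum_i u i * w i) ^+ 2 <= (\sum_i u i ^+ 2) * (\sum_i w i ^+ 2).
Proof.
set S := \sum_i u i * w i; set U := \sum_i u i ^+ 2; set V := \sum_i w i ^+ 2.
have U0 : 0 <= U by apply: sumr_ge0 => i _; exact: sqr_ge0.
have : 0 <= \sum_i (U * w i - S * u i) ^+ 2 by apply: sumr_ge0 => i _; exact: sqr_ge0.
have gen (a b : R) : \sum_i (a * w i - b * u i) ^+ 2 = a ^+ 2 * V + - (2 * a * b * S) + b ^+ 2 * U.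
  by rewrite /V /S /U !mulr_sumr -sumrN -!big_split/=; apply: eq_bigr => k _; ring.
rewrite gen => H.
have [U1|U1] := eqVneq U 0; last first.
  have Up : 0 < U by rewrite lt_neqAle eq_sym U1.
  rewrite -(ler_pM2l Up); move: H; nra.
have u0 i : u i = 0.
  have /eqP : u i ^+ 2 = 0 := psumr_eq0P (fun j _ => sqr_ge0 (u j)) U1 isT.
  by rewrite sqrf_eq0 => /eqP.
by rewrite U1 mul0r /S big1 ?expr0n// => i _; rewrite u0 mul0r.
Qed.

(** * Gaussian integrals *)

Section gauss1.
Context (R : realType).
Local Notation mu := (@lebesgue_measure R).

Lemma integral_gauss_center (t m : R) : 0 < t ->
  (\int[mu]_x (expR (- (t * (x - m) ^+ 2)))%:E = (Num.sqrt (pi / t))%:E)%E.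
Proof.
(* The standard deviation for which the integrand is a multiple of a normal density, whose integral
   is 1. *)
move=> t0; pose s : R := (Num.sqrt (2 * t))^-1.
have s0 : s != 0 by rewrite invr_eq0 gt_eqF// sqrtr_gt0; lra.
have := integral_normal_pdf m s.
have s2 : s ^+ 2 = (2 * t)^-1 by rewrite /s exprVn sqr_sqrtr//; lra.
have pk : normal_peak s = (Num.sqrt (pi / t))^-1.
  by rewrite /normal_peak s2; congr (Num.sqrt _)^-1; field; lra.
have pk0 : 0 < Num.sqrt (pi / t) by rewrite sqrtr_gt0 divr_gt0// pi_gt0.
rewrite normal_pdfE//.
under eq_integral => x _.
  have -> : normal_peak s * normal_fun m s x =
     (Num.sqrt (pi / t))^-1 * expR (- (t * (x - m) ^+ 2)).
    by rewrite pk /normal_fun s2; congr (_ * expR _); field; lra.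
  rewrite EFinM; over.
rewrite ge0_integralZl//.
- move=> H; rewrite -[LHS]mul1e -(@divff _ (Num.sqrt (pi / t))) ?gt_eqF//.
  by rewrite EFinM -muleA H mule1.
- by apply/measurable_EFinP; apply: measurableT_comp => //; apply: measurableT_comp => //; apply: measurable_funM => //; apply: measurable_funX; apply: measurable_funB.
Qed.

Lemma integral_gauss_line (t : R) : 0 < t ->
  (\int[mu]_x (expR (- (t * x ^+ 2)))%:E = (Num.sqrt (pi / t))%:E)%E.
Proof.
move=> t0; rewrite -(integral_gauss_center 0 t0).
by apply: eq_integral => x _; rewrite subr0.
Qed.

Lemma integrable_gauss_line (t : R) : 0 < t ->
  mu.-integrable setT (EFin \o (fun x => expR (- (t * x ^+ 2)))).
Proof.
move=> t0; apply/integrableP; split.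
  by apply/measurable_EFinP; apply: measurableT_comp => //; apply: measurableT_comp => //; apply: measurable_funM => //; apply: measurable_funX.
under eq_integral => x _ do rewrite /= ger0_norm ?expR_ge0//.
by rewrite integral_gauss_line// ltry.
Qed.

(** Integration by parts without boundary terms: the integral over [[-n, n]] is [F n - F (- n)], and
    dominated convergence with bound [|f|] reaches the whole line. *)
Lemma integral_derive_eq0 (F f : R -> R) :
  (forall x : R, is_derive x (1 : R) F (f x)) -> continuous f ->
  mu.-integrable setT (EFin \o f) ->
  F x @[x --> +oo] --> 0 -> F x @[x --> -oo] --> 0 ->
  (\int[mu]_x f x = 0)%R.
Proof.
move=> dF cf intf Fy FNy.
pose D n : set R := `[- n%:R, n%:R]%classic.
have cF : continuous F.
  by move=> x; apply/differentiable_continuous/derivable1_diffP; have [] := dF x.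
have FTC n : (\int[mu]_(x in D n) f x = F n%:R - F (- n%:R))%R.
  case: n => [|n]; first by rewrite /D /= oppr0 set_itv1 Rintegral_set1 subrr.
  rewrite /Rintegral (@continuous_FTC2 _ f F)//.
  - by rewrite -subr_gt0 opprK -natrD ltr0n.
  - exact: continuous_subspaceT.
  - split.
    + by move=> x _; have [] := dF x.
    + by apply: cvg_at_right_filter; exact: cF.
    + by apply: cvg_at_left_filter; exact: cF.
  - by move=> x _; rewrite derive1E; have [_ ->] := dF x.
have mD n : measurable (D n) by exact: measurable_itv.
have intD n : mu.-integrable (D n) (EFin \o f).
  by apply: integrableS intf => //; exact: mD.
have mf : measurable_fun setT f by exact: continuous_measurable_fun.
pose fn n x : \bar R := ((f \_ (D n)) x)%:E.
have mfn n : measurable_fun setT (fn n).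
  by apply/measurable_EFinP; apply/(measurable_restrictT f (mD n)); exact: measurable_funTS.
have cvgfn : {ae mu, forall x, setT x -> fn n x @[n --> \oo] --> (f x)%:E}.
  apply: aeW => x _; apply: cvg_near_cst; near=> n.
  rewrite /fn patchE ifT// inE /D/= in_itv/= -ler_norml.
  by near: n; exact: nbhs_infty_ger.
have bnd : {ae mu, forall x n, setT x -> (`|fn n x| <= `|f x|%:E)%E}.
  apply: aeW => x n _; rewrite /fn patchE; case: ifPn => _ //=.
  by rewrite normr0 lee_fin.
have mf' : measurable_fun setT (EFin \o f) by exact/measurable_EFinP.
have [_ _] := @dominated_convergence _ _ _ mu setT measurableT fn _ _ mfn
  mf' cvgfn (integrable_norm intf) bnd.
have intE n : (\int[mu]_x fn n x = (\int[mu]_(x in D n) f x)%:E)%E.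
  rewrite /Rintegral fineK.
    by rewrite [RHS]integral_mkcond; apply: eq_integral => x _; rewrite /fn !patchE; case: ifP.
  by apply: integrable_fin_num; [exact: mD|exact: intD].
move=> cv.
have cv' : (\int[mu]_(x in D n) f x)%R @[n --> \oo] --> (\int[mu]_x f x)%R.
  rewrite /Rintegral; apply/fine_cvg; rewrite fineK; last exact: integrable_fin_num.
  rewrite [X in X @ _ --> _](_ : _ = fun n => (\int[mu]_x fn n x)%E)//.
  by apply/funext => n; rewrite intE /Rintegral fineK//; apply: integrable_fin_num; [exact: mD|exact: intD].
rewrite -[LHS](cvg_lim (@Rhausdorff R) cv'); apply: cvg_lim; first exact: Rhausdorff.
have -> : (0 : R) = 0 - 0 by rewrite subr0.
rewrite [X in X @ _ --> _](_ : _ = fun n : nat => F n%:R - F (- n%:R)); last first.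
  by apply/funext => n /=; rewrite FTC.
apply: cvgB; first exact: (cvg_comp (fun n : nat => n%:R) F (@cvgr_idn R) Fy).
apply: (cvg_comp (fun n : nat => - n%:R) F _ FNy).
by apply/cvgNrNy; exact: cvgr_idn.
Unshelve. all: by end_near. Qed.


Lemma continuous_is_derive (F f : R -> R) :
  (forall x : R, is_derive x (1 : R) F (f x)) -> continuous F.
Proof. by move=> dF x; exact: continuous_at_is_derive (dF x). Qed.

(** Half of the exponent absorbs [|y|], by [1 + z <= exp z]. *)
Lemma ler_norm_gauss (t y : R) : 0 < t ->
  `|y| * expR (- (t * y ^+ 2)) <= (1 + t^-1) * expR (- (t / 2 * y ^+ 2)).
Proof.
move=> t0; have -> : - (t * y ^+ 2) = - (t / 2 * y ^+ 2) + - (t / 2 * y ^+ 2) by field.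
rewrite expRD mulrA ler_wpM2r ?expR_ge0//.
rewrite expRN -ler_pdivlMr ?invr_gt0 ?expR_gt0// invrK.
have ti : 0 < t^-1 by rewrite invr_gt0.
apply: (@le_trans _ _ ((1 + t^-1) * (1 + t / 2 * y ^+ 2))); last first.
  by rewrite ler_pM2l ?expR_ge1Dx//; lra.
have -> : (1 + t^-1) * (1 + t / 2 * y ^+ 2) = 1 + t^-1 + (t + 1) / 2 * y ^+ 2 by field; lra.
rewrite -[y ^+ 2]real_normK ?num_real//.
have := sqr_ge0 (`|y| - 1); set z := `|y|; have : 0 <= t * z ^+ 2 by rewrite mulr_ge0 ?sqr_ge0 ?ltW.
move=> h1 h2; nra.
Qed.

Lemma cvg_gauss_bound (t C : R) (F : R -> R) (G : set_system R) {FG : ProperFilter G} :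
  0 < t -> `|x| @[x --> G] --> +oo ->
  (forall x, `|F x| <= C * expR (- (t * x ^+ 2))) ->
  F x @[x --> G] --> 0.
Proof.
move=> t0 Gy bF; apply/cvgr0Pnorm_le => e e0.
have C0 : 0 <= C.
  by have := le_trans (normr_ge0 _) (bF 0); rewrite expr0n/= mulr0 oppr0 expR0 mulr1.
have /cvgryPge/(_ (1 + C / (e * t))) := Gy.
apply: filterS => x Hx.
apply: (le_trans (bF x)).
have et : 0 < e * t by exact: mulr_gt0.
have Cet : 0 <= C / (e * t) by rewrite divr_ge0// ltW.
have x1 : 1 <= `|x| by lra.
have x2 : `|x| <= x ^+ 2.
  by rewrite -[x ^+ 2]real_normK ?num_real// expr2 ler_peMr.
rewrite expRN ler_pdivrMr ?expR_gt0//.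
apply: (@le_trans _ _ (e * (1 + t * x ^+ 2))); last by rewrite ler_pM2l ?expR_ge1Dx.
have : C <= e * t * x ^+ 2.
  by rewrite mulrC -ler_pdivrMr//; lra.
by rewrite mulrDr mulr1 mulrA; lra.
Qed.

Lemma cvgr_norm_pinfty : `|x| @[x --> +oo] --> (+oo : set_system R).
Proof.
apply/cvgryPge => A; near=> x; apply: le_trans (ler_norm _).
by near: x; apply: nbhs_pinfty_ge; rewrite num_real.
Unshelve. all: by end_near. Qed.

Lemma cvgr_norm_ninfty : `|x| @[x --> -oo] --> (+oo : set_system R).
Proof.
apply/cvgryPge => A; near=> x; rewrite -normrN; apply: le_trans (ler_norm _).
by rewrite lerNr; near: x; apply: nbhs_ninfty_le; rewrite num_real.
Unshelve. all: by end_near. Qed.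

(** As a function of [w] the integral satisfies [phi' = - w / (2 t) * phi], by differentiation under
    the integral and one integration by parts; hence [exp (w^2 / (4 t)) * phi] is constant. The
    phase [a] treats cosine and sine at once and is what the induction over coordinates needs. *)
Lemma gauss_fourier (t a w : R) : 0 < t ->
  (\int[mu]_x (expR (- (t * x ^+ 2)) * cos (a + w * x)) =
   Num.sqrt (pi / t) * expR (- (w ^+ 2 / (4 * t))) * cos a)%R.
Proof.
move=> t0.
pose f (w y : R) := expR (- (t * y ^+ 2)) * cos (a + w * y).
pose g (w y : R) := - (y * expR (- (t * y ^+ 2)) * sin (a + w * y)).
pose phi w := (\int[mu]_y f w y)%R.
have df w' y : is_derive w' (1 : R) (f ^~ y) (g w' y).
  rewrite /f; eapply is_derive_subst; [der|].
  rewrite /g; ring.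
have mE : measurable_fun setT (fun y : R => expR (- (t * y ^+ 2))).
  by apply: measurableT_comp => //; apply: measurableT_comp => //; apply: measurable_funM => //; apply: measurable_funX.
have mL w' : measurable_fun setT (fun y : R => a + w' * y).
  by apply: measurable_funD => //; apply: measurable_funM.
have intf w' : mu.-integrable setT (EFin \o f w').
  apply: (le_integrable measurableT _ _ (integrable_gauss_line t0)).
    by rewrite /f; meas.
  move=> y _ /=; rewrite lee_fin normrM ler_piMr// ler_norml cos_geN1 cos_le1//.
pose G y := (1 + t^-1) * expR (- (t / 2 * y ^+ 2)).
have t20 : 0 < t / 2 by lra.
have G0 y : 0 <= G y by rewrite mulr_ge0 ?expR_ge0// addr_ge0// invr_ge0 ltW.
have intG : mu.-integrable setT (EFin \o G).
  exact: (integrable_EFinZ measurableT _ (integrable_gauss_line t20)).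
have gG w' y : `|g w' y| <= G y.
  rewrite /g normrN normrM; apply: le_trans (ler_norm_gauss y t0).
  rewrite normrM (ger0_norm (expR_ge0 _)) ler_piMr ?mulr_ge0 ?expR_ge0//.
  by rewrite ler_norml sin_geN1 sin_le1.
have intg w' : mu.-integrable setT (EFin \o g w').
  apply: (le_integrable measurableT _ _ intG).
    by rewrite /g; meas.
  by move=> y _ /=; rewrite lee_fin (ger0_norm (G0 y)).
have dphi w' : is_derive w' (1 : R) phi (\int[mu]_y g w' y)%R.
  have Iw : `]w' - 1, w' + 1[%classic w' by rewrite /= in_itv/=; lra.
  have intf' x : `]w' - 1, w' + 1[%classic x -> mu.-integrable setT (EFin \o f x) by [].
  have df' x y : `]w' - 1, w' + 1[%classic x -> [set: R] y -> derivable (f ^~ y) x 1.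
    by move=> _ _; have [] := df x y.
  have d1 x y : partial1of2 f x y = g x y.
    by rewrite /partial1of2 derive1E; have [_ ->] := df x y.
  have G_ub x y : `]w' - 1, w' + 1[%classic x -> [set: R] y -> `|partial1of2 f x y| <= G y.
    by move=> _ _; rewrite d1.
  have der1 := @derivable_under_integral R _ _ mu f setT measurableT w' _ _ Iw intf' df' G G0 intG G_ub.
  have := @differentiation_under_integral R _ _ mu f setT measurableT w' _ _ Iw intf' df' G G0 intG G_ub.
  rewrite derive1E => der2.
  apply: DeriveDef; first exact: der1.
  rewrite der2; apply: eq_Rintegral => y _; exact: d1.
have gE w' : (\int[mu]_y g w' y = - (w' / (2 * t)) * phi w')%R.
  pose F y := (2 * t)^-1 * expR (- (t * y ^+ 2)) * sin (a + w' * y).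
  have dF y : is_derive y (1 : R) F (g w' y + w' / (2 * t) * f w' y).
    rewrite /F; eapply is_derive_subst; [der|].
    rewrite /g /f /=; field; lra.
  have cF : continuous (fun y => g w' y + w' / (2 * t) * f w' y).
    move=> y; rewrite /g /f; eapply continuous_at_is_derive; der.
  have intwf : mu.-integrable setT (EFin \o (fun y => w' / (2 * t) * f w' y)).
    exact: integrable_EFinZ.
  have intF : mu.-integrable setT (EFin \o (fun y => g w' y + w' / (2 * t) * f w' y)).
    exact: integrable_EFinD.
  have bF y : `|F y| <= (2 * t)^-1 * expR (- (t * y ^+ 2)).
    rewrite /F normrM ger0_norm ?mulr_ge0 ?expR_ge0 ?invr_ge0//; last lra.
    rewrite ler_piMr ?mulr_ge0 ?expR_ge0 ?invr_ge0//; first lra.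
    by rewrite ler_norml sin_geN1 sin_le1.
  have := integral_derive_eq0 dF cF intF (cvg_gauss_bound t0 cvgr_norm_pinfty bF) (cvg_gauss_bound t0 cvgr_norm_ninfty bF).
  rewrite RintegralD//= RintegralZl//.
  move=> H; have {}H := H ltac:(typeclasses eauto) ltac:(typeclasses eauto).
  by apply/eqP; rewrite mulNr -addr_eq0; apply/eqP.
pose psi u := expR (u ^+ 2 / (4 * t)) * phi u.
have dpsi z : is_derive z (1 : R) psi 0.
  rewrite /psi; eapply is_derive_subst; [der|].
  rewrite gE; field; lra.
have psi_cst u v : psi u = psi v := @is_derive_0_is_cst R psi u v dpsi.
have := psi_cst w 0; rewrite /psi expr0n mul0r expR0 mul1r.
have -> : phi 0 = Num.sqrt (pi / t) * cos a.
  rewrite /phi /f; under eq_Rintegral do rewrite mul0r addr0 mulrC.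
  rewrite RintegralZl//; last exact: integrable_gauss_line.
  by rewrite mulrC /Rintegral integral_gauss_line.
rewrite -/(phi w) => H; by rewrite expRN mulrAC -H mulrAC mulfV ?mul1r// gt_eqF// expR_gt0.
Qed.

End gauss1.

(** * Gaussian integrals over the n-fold product measure *)

Section lebesgue_Rn_integral.
Context (R : realType).
Local Notation mu := (@lebesgue_measure R).
Local Notation T := (measurableTypeR R).
Local Notation leb n := (lebesgue_Rn R n).

Lemma integral_lebesgue_Rn0 (f : 0.-tuple T -> \bar R) : measurable_fun setT f ->
  (\int[leb 0]_t f t = f [tuple])%E.
Proof. by move=> mf; rewrite /= integral_dirac// diracT mul1e. Qed.

Lemma integral_lebesgue_RnS n (f : n.+1.-tuple T -> \bar R) :
  measurable_fun setT f -> (forall t, (0 <= f t)%E) ->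
  (\int[leb n.+1]_t f t = \int[mu]_x \int[leb n]_t f (consT (x, t)))%E.
Proof.
move=> mf f0.
have mc := @measurable_consT R n.
rewrite /= (ge0_integral_pushforward mc)//.
rewrite preimage_setT fubini_tonelli1//.
- exact: measurableT_comp mf mc.
- by move=> x; exact: f0.
Qed.

Lemma tnth_consT0 n (x : T) (t : n.-tuple T) : tnth (consT (x, t)) ord0 = x.
Proof. by []. Qed.

Lemma tnth_consTS n (x : T) (t : n.-tuple T) (i : 'I_n) :
  tnth (consT (x, t)) (lift ord0 i) = tnth t i.
Proof. by rewrite /consT tnthS. Qed.

Lemma integral_Rn_prod n (f : 'I_n -> R -> R) (c : 'I_n -> R) :
  (forall i, measurable_fun setT (f i)) -> (forall i x, 0 <= f i x) ->
  (forall i, (\int[mu]_x (f i x)%:E = (c i)%:E)%E) ->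
  (\int[leb n]_t (\prod_(i < n) f i (tnth t i))%:E = (\prod_(i < n) c i)%:E)%E.
Proof.
have mprod k (h : 'I_k -> R -> R) : (forall i, measurable_fun setT (h i)) ->
    measurable_fun setT (fun t : k.-tuple T => \prod_(i < k) h i (tnth t i)).
  move=> mh; apply: measurable_prod => i _.
  exact: (measurableT_comp (mh i) (measurable_tnth i)).
elim: n f c => [|n IH] f c mf f0 fc.
  rewrite integral_lebesgue_Rn0; first by rewrite !big_ord0.
  by apply/measurable_EFinP; exact: mprod.
rewrite integral_lebesgue_RnS; last 2 first.
- by apply/measurable_EFinP; exact: mprod.
- by move=> t; rewrite lee_fin prodr_ge0.
under eq_integral => x _.
  under eq_integral => t _.
    rewrite big_ord_recl tnth_consT0.
    under eq_bigr => i _ do rewrite tnth_consTS.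
    rewrite EFinM.
    over.
  rewrite ge0_integralZl//; last 3 first.
  - by apply/measurable_EFinP; exact: (mprod _ (fun i => f (lift ord0 i))).
  - by move=> t _; rewrite lee_fin prodr_ge0.
  - by rewrite lee_fin.
  rewrite (IH (fun i => f (lift ord0 i)) (fun i => c (lift ord0 i)))//.
  over.
rewrite ge0_integralZr//; last 3 first.
- by apply/measurable_EFinP; exact: mf.
- by move=> x _; rewrite lee_fin.
- rewrite lee_fin prodr_ge0// => i _; rewrite -lee_fin -fc.
  by apply: integral_ge0 => x _; rewrite lee_fin.
by rewrite fc -EFinM [in RHS]big_ord_recl.
Qed.

Lemma integral_gauss_cos (t a w b k : R) : 0 < t ->
  (\int[mu]_x (expR (- (t * x ^+ 2)) * (b + k * cos (a + w * x)))%:E =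
   (Num.sqrt (pi / t) * (b + k * (expR (- (w ^+ 2 / (4 * t))) * cos a)))%:E)%E.
Proof.
move=> t0.
have mf : measurable_fun setT (fun x : T => expR (- (t * x ^+ 2)) * cos (a + w * x)) by meas.
have intf : mu.-integrable setT (EFin \o (fun x => expR (- (t * x ^+ 2)) * cos (a + w * x))).
  apply: (le_integrable measurableT _ _ (integrable_gauss_line t0)).
    exact/measurable_EFinP.
  move=> y _ /=; rewrite lee_fin normrM ler_piMr// ler_norml cos_geN1 cos_le1//.
have int1 := integrable_EFinZ measurableT b (integrable_gauss_line t0).
have int2 := integrable_EFinZ measurableT k intf.
have int12 := integrable_EFinD measurableT int1 int2.
under eq_integral => x _.
  have -> : expR (- (t * x ^+ 2)) * (b + k * cos (a + w * x)) =
    b * expR (- (t * x ^+ 2)) + k * (expR (- (t * x ^+ 2)) * cos (a + w * x)) by ring.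
  over.
rewrite -[LHS]fineK; last exact: (integrable_fin_num _ int12).
congr EFin.
rewrite -/(Rintegral _ _ _).
have := RintegralD measurableT int1 int2; rewrite /= => ->.
rewrite RintegralZl//; last exact: integrable_gauss_line.
rewrite RintegralZl// gauss_fourier//.
rewrite /Rintegral integral_gauss_line//=; ring.
Qed.

(** [1 <= b] makes the integrand nonnegative, so the coordinates can be integrated one at a time by
    Tonelli; each step moves [w ord0 * x] into the phase [a]. *)
Lemma integral_Rn_gauss_cos n (t a b : R) (w : 'I_n -> R) : 0 < t -> 1 <= b ->
  (\int[leb n]_x (expR (- (t * \sum_(i < n) tnth x i ^+ 2)) *
      (b + cos (a + \sum_(i < n) w i * tnth x i)))%:E =
   (Num.sqrt (pi / t) ^+ n *
      (b + expR (- ((\sum_(i < n) w i ^+ 2) / (4 * t))) * cos a))%:E)%E.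
Proof.
move=> t0 b1; elim: n a w => [|n IH] a w.
  rewrite integral_lebesgue_Rn0; last by meas.
  by rewrite !big_ord0 mulr0 mul0r oppr0 expR0 expr0 !mul1r addr0.
have ge0 m (u : 'I_m -> R) a' x : (0 <= (expR (- (t * \sum_(i < m) tnth x i ^+ 2)) *
      (b + cos (a' + \sum_(i < m) u i * tnth x i)))%:E)%E.
  by rewrite lee_fin mulr_ge0 ?expR_ge0//; have := cos_geN1 (a' + \sum_(i < m) u i * tnth x i); lra.
rewrite integral_lebesgue_RnS//; last by meas.
pose C := Num.sqrt (pi / t) ^+ n.
pose E := expR (- ((\sum_(i < n) w (lift ord0 i) ^+ 2) / (4 * t))).
transitivity (\int[mu]_x (expR (- (t * x ^+ 2)) * (C * b + (C * E) * cos (a + w ord0 * x)))%:E)%E.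
  apply: eq_integral => x _.
  transitivity (\int[leb n]_y ((expR (- (t * x ^+ 2)))%:E *
    (expR (- (t * \sum_(i < n) tnth y i ^+ 2)) *
      (b + cos ((a + w ord0 * x) + \sum_(i < n) w (lift ord0 i) * tnth y i)))%:E))%E.
    apply: eq_integral => y _; rewrite -EFinM; congr EFin.
    rewrite !big_ord_recl tnth_consT0.
    under eq_bigr => i _ do rewrite tnth_consTS.
    under [in X in cos X]eq_bigr => i _ do rewrite tnth_consTS.
    by rewrite mulrA -expRD addrA; congr (expR _ * _); ring.
  rewrite ge0_integralZl//; last first.
    by meas.
  by rewrite IH -EFinM /C /E; congr EFin; ring.
rewrite integral_gauss_cos//; congr EFin; rewrite /C /E big_ord_recl [_ ^+ n.+1]exprS.
set S := \sum_(i < n) _; have -> : - ((w ord0 ^+ 2 + S) / (4 * t)) =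
  - (w ord0 ^+ 2 / (4 * t)) + - (S / (4 * t)) by ring.
by rewrite expRD; ring.
Qed.

(** Removes the origin, where the mixture variable T may vanish and the quotients of the modulus
    take default values. The indicator of the origin is a product of indicators of [{0}], each of
    integral 0. *)
Lemma ae_Rn_neq0 n : (0 < n)%N ->
  {ae leb n, forall t : n.-tuple T, 0 < \sum_(i < n) tnth t i ^+ 2}.
Proof.
move=> n0.
pose N : set (n.-tuple T) := [set t | forall i, tnth t i = 0].
have NE : (fun t : n.-tuple T => (\1_N t : R)) = (fun t => \prod_(i < n) (\1_[set (0 : R)] (tnth t i) : R)).
  apply/funext => t; rewrite indicE; case: (boolP (t \in N)) => tN.
    rewrite big1// => i _; rewrite indicE mem_set//=; move: tN; rewrite inE; exact.
  have /existsP[i ti] : [exists i, tnth t i != 0].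
    apply: contraNT tN => /existsPn H; rewrite inE => i; have := H i.
    by rewrite negbK => /eqP.
  rewrite (bigD1 i)//= indicE memNset ?mul0r//=.
  by apply/eqP.
have mN1 : measurable_fun setT (fun t : n.-tuple T => (\1_N t : R)).
  rewrite NE; apply: measurable_prod => i _.
  apply: (measurableT_comp _ (measurable_tnth i)).
  by apply: measurable_indic; exact: measurable_set1.
have mN : measurable N by apply: (proj2 (@measurable_indicP _ _ R N)).
exists N; split => //.
  rewrite -[X in leb n X]setIT -integral_indic//.
  under eq_integral => t _ do rewrite (congr1 (@^~ t) NE).
  rewrite (@integral_Rn_prod n (fun _ x => \1_[set (0 : R)] x) (fun=> 0)).
  - by rewrite prodr_const card_ord expr0n; case: n n0 {N NE mN1 mN}.
  - by move=> _; apply: measurable_indic; exact: measurable_set1.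
  - by move=> _ x; rewrite indicE.
  - move=> _; rewrite integral_indic//; first by rewrite setIT; exact: lebesgue_measure_set1.
move=> t /= /negP; rewrite -leNgt => H i.
have S0 : \sum_(i < n) tnth t i ^+ 2 = 0.
  by apply/eqP; rewrite eq_le H sumr_ge0// => j _; rewrite sqr_ge0.
have := psumr_eq0P (fun j _ => sqr_ge0 (tnth t j)) S0.
by move=> /(_ i isT) /eqP; rewrite sqrf_eq0 => /eqP.
Qed.

Definition gaussd (y : R) : R := (Num.sqrt (2 * pi))^-1 * expR (- (y ^+ 2 / 2)).

Lemma gaussd_ge0 y : 0 <= gaussd y.
Proof. by rewrite mulr_ge0 ?invr_ge0 ?expR_ge0. Qed.

Lemma measurable_gaussd : measurable_fun setT gaussd.
Proof. by rewrite /gaussd; meas. Qed.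

(** Completion of the square. [th] may be negative as long as the total quadratic form is positive:
    [th = - 1 / 2] later gives the exponential moment of Q. *)
Lemma integral_gaussd (th al be : R) : 0 < 1 + 2 * th * be ^+ 2 ->
  (\int[mu]_y (gaussd y * expR (- (th * (al + be * y) ^+ 2)))%:E =
   ((Num.sqrt (1 + 2 * th * be ^+ 2))^-1 *
     expR (- (th * al ^+ 2 / (1 + 2 * th * be ^+ 2))))%:E)%E.
Proof.
set D := 1 + 2 * th * be ^+ 2 => D0.
have pi0 := pi_gt0 R.
have s0 : 0 < Num.sqrt (2 * pi : R) by rewrite sqrtr_gt0; lra.
pose K := (Num.sqrt (2 * pi))^-1 * expR (- (th * al ^+ 2 / D)).
transitivity (\int[mu]_y (K%:E * (expR (- (D / 2 * (y - (- (2 * th * al * be) / D)) ^+ 2)))%:E))%E.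
  apply: eq_integral => y _; rewrite -EFinM; congr EFin.
  rewrite /gaussd /K -!mulrA -!expRD; congr (_ * expR _).
  by rewrite /D in D0 *; field; lra.
rewrite ge0_integralZl//; last 2 first.
- by meas.
- by rewrite lee_fin mulr_ge0 ?invr_ge0 ?expR_ge0.
rewrite integral_gauss_center; last by lra.
rewrite -EFinM; congr EFin; rewrite /K mulrAC; congr (_ * _).
have -> : pi / (D / 2) = 2 * pi * D^-1 by field; lra.
have -> : Num.sqrt (2 * pi / D) = Num.sqrt (2 * pi) / Num.sqrt D.
  by rewrite [LHS]sqrtrM ?sqrtrV//; lra.
by rewrite mulrA mulVf ?mul1r// gt_eqF.
Qed.

Definition gaussW d (y : d.-tuple T) : R := \prod_(i < d) gaussd (tnth y i).

Lemma gaussW_ge0 d (y : d.-tuple T) : 0 <= gaussW y.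
Proof. by apply: prodr_ge0 => i _; exact: gaussd_ge0. Qed.

Lemma measurable_gaussW d : measurable_fun setT (@gaussW d).
Proof.
by apply: measurable_prod => i _; exact: (measurableT_comp measurable_gaussd (measurable_tnth i)).
Qed.

Lemma integral_gaussW d (th : R) (al be : 'I_d -> R) :
  (forall i, 0 < 1 + 2 * th * be i ^+ 2) ->
  (\int[leb d]_y (gaussW y * expR (- \sum_(i < d) (th * (al i + be i * tnth y i) ^+ 2)))%:E =
   (\prod_(i < d) ((Num.sqrt (1 + 2 * th * be i ^+ 2))^-1 *
     expR (- (th * al i ^+ 2 / (1 + 2 * th * be i ^+ 2)))))%:E)%E.
Proof.
move=> D0.
rewrite -(@integral_Rn_prod d (fun i y => gaussd y * expR (- (th * (al i + be i * y) ^+ 2)))).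
- apply: eq_integral => y _; congr EFin.
  by rewrite -sumrN expR_sum -big_split.
- by move=> i; rewrite /gaussd; meas.
- by move=> i x; rewrite mulr_ge0 ?gaussd_ge0 ?expR_ge0.
- by move=> i; exact: integral_gaussd.
Qed.

(** Under [gaussW] the sum [\sum_i g i * y_i] is a centred Gaussian variable of variance
    [\sum_i g i ^+ 2]. In the induction, integrating out [d] variables replaces [ka] by [ka / D],
    and one Gaussian variable remains. *)
Lemma integral_gaussW_line d (ka c : R) (g : 'I_d -> R) : 0 <= ka ->
  (\int[leb d]_y (gaussW y * expR (- (ka * (c - \sum_(i < d) g i * tnth y i) ^+ 2)))%:E =
   ((Num.sqrt (1 + 2 * ka * \sum_(i < d) g i ^+ 2))^-1 *
     expR (- (ka * c ^+ 2 / (1 + 2 * ka * \sum_(i < d) g i ^+ 2))))%:E)%E.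
Proof.
move=> ka0; elim: d c g => [|d IH] c g.
  have mm := measurable_gaussW (d := 0).
  rewrite integral_lebesgue_Rn0; last by meas.
  by rewrite /gaussW !big_ord0 mulr0 addr0 sqrtr1 invr1 subr0 mulr1.
have mm := measurable_gaussW (d := d).
have mm' := measurable_gaussW (d := d.+1).
rewrite integral_lebesgue_RnS//; last 2 first.
- by meas.
- by move=> t; rewrite lee_fin mulr_ge0 ?gaussW_ge0 ?expR_ge0.
pose S := \sum_(i < d) g (lift ord0 i) ^+ 2.
have S0 : 0 <= S by apply: sumr_ge0 => i _; exact: sqr_ge0.
pose D := 1 + 2 * ka * S.
have D1 : 1 <= D by rewrite lerDl mulr_ge0// mulr_ge0.
have kD : 0 <= ka / D by rewrite divr_ge0//; lra.
transitivity (\int[mu]_x ((Num.sqrt D)^-1%:E * (gaussd x * expR (- (ka / D * (c + - g ord0 * x) ^+ 2)))%:E)%E)%E.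
  apply: eq_integral => x _.
  transitivity (\int[leb d]_y ((gaussd x)%:E * (gaussW y * expR (- (ka * ((c - g ord0 * x) - \sum_(i < d) g (lift ord0 i) * tnth y i) ^+ 2)))%:E))%E.
    apply: eq_integral => y _; rewrite -EFinM; congr EFin.
    rewrite /gaussW !big_ord_recl tnth_consT0.
    under eq_bigr => i _ do rewrite tnth_consTS.
    under [in X in expR X]eq_bigr => i _ do rewrite tnth_consTS.
    by rewrite [RHS]mulrA; congr (_ * expR _); ring.
  rewrite ge0_integralZl//; last 3 first.
  - by meas.
  - by move=> y _; rewrite lee_fin mulr_ge0 ?gaussW_ge0 ?expR_ge0.
  - by rewrite lee_fin gaussd_ge0.
  rewrite IH -!EFinM -/S -/D; congr EFin.
  by rewrite mulrCA mulNr; congr (_ * (_ * expR (- _))); rewrite mulrAC.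
have mg := measurable_gaussd.
rewrite integralZl_ge0_EFin; last 3 first.
- by rewrite invr_ge0.
- by meas.
- by move=> y; rewrite mulr_ge0 ?gaussd_ge0 ?expR_ge0.
have D'0 : 0 < 1 + 2 * (ka / D) * (- g ord0) ^+ 2.
  by have := mulr_ge0 kD (sqr_ge0 (- g ord0)); lra.
rewrite integral_gaussd//.
rewrite big_ord_recl -/S -EFinM; congr EFin.
have E : 1 + 2 * ka * (g ord0 ^+ 2 + S) = D * (1 + 2 * (ka / D) * (- g ord0) ^+ 2).
  by rewrite /D; field; rewrite -/D; lra.
rewrite E sqrtrM; last by lra.
move: D'0; set q := 1 + 2 * (ka / D) * _ => q0.
rewrite (invfM (Num.sqrt D)) -[RHS]mulrA; congr (_ * (_ * expR (- _))).
by field; rewrite !gt_eqF//; lra.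
Qed.

End lebesgue_Rn_integral.

Section segment_integral.
Context (R : realType).
Local Notation mu := (@lebesgue_measure R).

Lemma integrable_within (f : R -> R) (a b : R) :
  (forall t, a <= t <= b -> {for t, continuous f}) -> mu.-integrable `[a, b] (EFin \o f).
Proof.
move=> cf; apply: continuous_compact_integrable; first exact: segment_compact.
apply: continuous_in_subspaceT => t; rewrite inE/= in_itv/= => tab; exact: cf.
Qed.

Lemma integrable_continuous (a b : R) (f : R -> R) : continuous f ->
  mu.-integrable `[a, b] (EFin \o f).
Proof. by move=> cf; apply: integrable_within => t _; exact: cf. Qed.

Lemma Rintegral_FTC_in (a b : R) (F f : R -> R) : a <= b ->
  (forall x : R, a <= x <= b -> is_derive x (1 : R) F (f x)) ->
  (forall x, a <= x <= b -> {for x, continuous f}) ->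
  (\int[mu]_(t in `[a, b]) f t)%R = F b - F a.
Proof.
rewrite le_eqVlt => /predU1P[<-|ab] dF cf.
  by rewrite set_itv1 Rintegral_set1 subrr.
have cF x : a <= x <= b -> {for x, continuous F}.
  by move=> xab; have := dF x xab; exact: continuous_at_is_derive.
rewrite /Rintegral (@continuous_FTC2 _ f F)//.
- apply: continuous_in_subspaceT => t; rewrite inE/= in_itv/= => tab; exact: cf.
- split.
  + by move=> x; rewrite in_itv/= => /andP[ax xb]; have [] := dF x (introT andP (conj (ltW ax) (ltW xb))).
  + by apply: cvg_at_right_filter; apply: cF; rewrite lexx ltW.
  + by apply: cvg_at_left_filter; apply: cF; rewrite lexx ltW.
- move=> x; rewrite in_itv/= => /andP[ax xb]; rewrite derive1E.
  by have [_ ->] := dF x (introT andP (conj (ltW ax) (ltW xb))).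
Qed.

Lemma Rintegral_FTC (a b : R) (F f : R -> R) : a <= b ->
  (forall x : R, is_derive x (1 : R) F (f x)) -> continuous f ->
  (\int[mu]_(t in `[a, b]) f t)%R = F b - F a.
Proof. by move=> ab dF cf; apply: Rintegral_FTC_in => // x _; exact: cf. Qed.

End segment_integral.

(** * Euler's product and partial fractions *)

Section wallis.
Context (R : realType).
Local Notation mu := (@lebesgue_measure R).
Local Notation Int f := (\int[mu]_(t in `[0%R, (pi / 2)%R]) (f t))%R.

Let hpi0 : 0 <= pi / 2 :> R. Proof. by rewrite divr_ge0// pi_ge0. Qed.

Let W (g : R -> R) n : R := Int (fun t => cos t ^+ n * g t).

Let cW (g : R -> R) n : continuous g -> continuous (fun t => cos t ^+ n * g t).
Proof. by move=> cg; cont. Qed.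

Let WD (f g : R -> R) n : continuous f -> continuous g -> W (fun t => f t + g t) n = W f n + W g n.
Proof.
move=> cf cg; rewrite /W -RintegralD//; last 2 first.
- by apply: integrable_continuous; exact: cW.
- by apply: integrable_continuous; exact: cW.
by apply: eq_Rintegral => t _; rewrite mulrDr.
Qed.

Let WZ (k : R) (f : R -> R) n : continuous f -> W (fun t => k * f t) n = k * W f n.
Proof.
move=> cf; rewrite /W -RintegralZl//; last by apply: integrable_continuous; exact: cW.
by apply: eq_Rintegral => t _; rewrite mulrCA.
Qed.

(* For [g = cosh (a t)] this becomes a two-term recurrence whose iteration produces Euler's product
   of [sinh]: the quotients [W g n / W (fun=> 1) n] tend to [g 0]. *)
Lemma wallis_rec (g g' g'' : R -> R) n :
  (forall x : R, is_derive x (1 : R) g (g' x)) ->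
  (forall x : R, is_derive x (1 : R) g' (g'' x)) -> continuous g'' -> g' 0 = 0 ->
  W g'' n.+2 = (n.+2 * n.+1)%:R * W g n - n.+2%:R ^+ 2 * W g n.+2.
Proof.
move=> dg dg' cg'' g'0.
have cg := continuous_is_derive dg.
pose F t := cos t ^+ n.+2 * g' t + n.+2%:R * (cos t ^+ n.+1 * sin t * g t).
pose f t := cos t ^+ n.+2 * g'' t + n.+2%:R ^+ 2 * (cos t ^+ n.+2 * g t)
   + - (n.+2 * n.+1)%:R * (cos t ^+ n * g t).
have dF x : is_derive x (1 : R) F (f x).
  rewrite /F; eapply is_derive_subst; [der|].
  rewrite /f /=.
  have s2 : sin x ^+ 2 = 1 - cos x ^+ 2 by rewrite -(cos2Dsin2 x) addrC addKr.
  transitivity (cos x ^+ n.+2 * g'' x + n.+2%:R * (cos x ^+ n.+2 * g x)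
     - n.+2%:R * n.+1%:R * (cos x ^+ n * (sin x ^+ 2) * g x)).
    by rewrite !exprS; ring.
  by rewrite s2 natrM !exprS -[n.+2]addn1 natrD; ring.
have cf : continuous f.
  by rewrite /f; cont.
have := Rintegral_FTC hpi0 dF cf.
have i1 := integrable_continuous 0 (pi / 2) (@cW g'' n.+2 cg'').
have i2 := integrable_continuous 0 (pi / 2) (@cW g n.+2 cg).
have i3 := integrable_continuous 0 (pi / 2) (@cW g n cg).
have mI : measurable (`[0%R, (pi / 2)%R] : set (measurableTypeR R)) by exact: measurable_itv.
rewrite /f RintegralD//; last 2 first.
- by apply: integrable_EFinD => //; exact: integrable_EFinZ.
- exact: integrable_EFinZ.
rewrite RintegralD//; last exact: integrable_EFinZ.
rewrite RintegralZl// RintegralZl// -!/(W _ _) /F cos_pihalf sin0 cos0 g'0.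
rewrite !expr0n /= => H.
by move: H; rewrite !mulr0 !mul0r !mulr0; lra.
Qed.

Let I n := W (fun=> 1) n.

Let IS n : n.+2%:R * I n.+2 = n.+1%:R * I n.
Proof.
have d1 (x : R) : is_derive x (1 : R) (fun=> 1 : R) 0 by der.
have d0 (x : R) : is_derive x (1 : R) (fun=> 0 : R) 0 by der.
have c0 : continuous (fun _ : R => 0 : R) by cont.
have := wallis_rec n d1 d0 c0 erefl.
have -> : W (fun=> 0) n.+2 = 0.
  rewrite /W; under eq_Rintegral do rewrite mulr0.
  by rewrite Rintegral_cst// mul0r.
have n0 : n.+2%:R != 0 :> R by rewrite pnatr_eq0.
rewrite -!/(I _) natrM => /eqP; rewrite eq_sym subr_eq0 -mulrA expr2 -mulrA => /eqP /(mulfI n0) ->.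
by [].
Qed.

Let I0 : I 0 = pi / 2.
Proof.
rewrite /I /W; under eq_Rintegral do rewrite expr0 mul1r.
by rewrite (@Rintegral_FTC _ _ _ id)// ?subr0// => x; exact: cvg_cst.
Qed.

Let I1 : I 1 = 1.
Proof.
rewrite /I /W; under eq_Rintegral do rewrite expr1 mulr1.
by rewrite (@Rintegral_FTC _ _ _ sin)// ?sin_pihalf ?sin0 ?subr0//; exact: continuous_cos.
Qed.

Let I_gt0 n : 0 < I n.
Proof.
suff : 0 < I n /\ 0 < I n.+1 by case.
elim: n => [|n [IH1 IH2]]; first by rewrite I0 I1 divr_gt0// pi_gt0.
split=> //; have : 0 < n.+2%:R * I n.+2 by rewrite IS mulr_gt0.
by rewrite pmulr_rgt0.
Qed.

Let tcos_le_sin (t : R) : 0 <= t <= pi / 2 -> t * cos t <= sin t.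
Proof.
move=> /andP[t0 tp].
have dF (x : R) : is_derive x (1 : R) (fun x => sin x - x * cos x) (x * sin x).
  by eapply is_derive_subst; [der|ring].
rewrite -subr_ge0.
have -> : 0 = sin 0 - 0 * cos 0 :> R by rewrite sin0 mul0r subr0.
apply: (@ger0_derive1_le_cc _ (fun x => sin x - x * cos x) 0 t) => //.
- move=> x; rewrite in_itv/= => /andP[x0 xt]; rewrite derive1E.
  have [_ ->] := dF x; rewrite mulr_ge0 ?ltW// sin_gt0_pi// x0/=.
  by have := pi_gt0 R; lra.
- exact/continuous_subspaceT/continuous_is_derive.
- by rewrite in_itv/= lexx t0.
- by rewrite in_itv/= lexx t0.
Qed.

(** The weights [cos t ^+ n] concentrate at 0. Since [t * cos t <= sin t], the second moment at
    [n + 2] is at most the integral of [cos t ^+ n * (1 - cos t ^+ 2)], that is [I n - I n.+2],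
    which the Wallis recurrence evaluates as [I n.+2 / n.+1%:R]. *)
Lemma wallis_dev (g : R -> R) (g0 C : R) n : continuous g ->
  (forall t, 0 <= t <= pi / 2 -> `|g t - g0| <= C * t ^+ 2) ->
  `|W g n.+2 / I n.+2 - g0| <= C / n.+1%:R.
Proof.
move=> cg gC.
have C0 : 0 <= C.
  have p2 : 0 < pi / 2 :> R by rewrite divr_gt0// pi_gt0.
  have := le_trans (normr_ge0 _) (gC (pi / 2) (introT andP (conj (ltW p2) (lexx _)))).
  by rewrite pmulr_lge0 ?exprn_gt0.
have ig := I_gt0 n.+2.
have -> : W g n.+2 / I n.+2 - g0 = (W g n.+2 - g0 * I n.+2) / I n.+2 by field; rewrite gt_eqF.
rewrite normrM normfV (gtr0_norm ig) ler_pdivrMr//.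
have cgg : continuous (fun t => g t + - g0).
  by cont.
have c1 : continuous (fun _ : R => 1 : R) by cont.
have -> : W g n.+2 - g0 * I n.+2 = W (fun t => g t + - g0) n.+2.
  rewrite WD//; last by move=> t; exact: cvg_cst.
  rewrite -mulNr /I -(WZ _ _ c1); congr (_ + _).
  by congr W; apply/funext => t; rewrite mulr1.
have mI : measurable (`[0%R, (pi / 2)%R] : set (measurableTypeR R)) by exact: measurable_itv.
apply: le_trans (le_normr_Rintegral _ _) _ => //.
  by apply: integrable_continuous; exact: cW.
have cs : continuous (fun t : R => C * (cos t ^+ n * (1 - cos t ^+ 2))).
  by cont.
apply: (@le_trans _ _ (Int (fun t => C * (cos t ^+ n * (1 - cos t ^+ 2))))).
  apply: le_Rintegral => //.
  - by apply: integrable_continuous; cont.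
  - exact: integrable_continuous.
  move=> t /=; rewrite in_itv/= => t01.
  have ct : 0 <= cos t.
    by apply: cos_ge0_pihalf; have := pi_gt0 R; case/andP: t01; lra.
  have -> : C * (cos t ^+ n * (1 - cos t ^+ 2)) = cos t ^+ n * (C * (1 - cos t ^+ 2)) by ring.
  rewrite normrM ger0_norm ?exprn_ge0// -[n.+2]addn2 exprD -mulrA ler_wpM2l ?exprn_ge0//.
  rewrite -(sin2cos2 t).
  have h1 := gC t t01.
  have /andP[t0 _] := t01.
  have h2 : (t * cos t) ^+ 2 <= sin t ^+ 2.
    have h3 := tcos_le_sin t01.
    by rewrite ler_sqr ?nnegrE ?mulr_ge0// (le_trans _ h3)// mulr_ge0.
  apply: (@le_trans _ _ (cos t ^+ 2 * (C * t ^+ 2))).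
    by rewrite ler_wpM2l ?sqr_ge0.
  by rewrite mulrCA ler_wpM2l// -exprMn mulrC.
have -> : Int (fun t => C * (cos t ^+ n * (1 - cos t ^+ 2))) = C * (I n - I n.+2).
  rewrite /I -mulN1r -(WZ _ _ c1) /W -RintegralD//; last 2 first.
  - by apply: integrable_continuous; exact: cW.
  - by apply: integrable_continuous; apply: cW; cont.
  rewrite -RintegralZl//; last first.
    by apply: integrable_EFinD => //; apply: integrable_continuous; apply: cW; cont.
  by apply: eq_Rintegral => t _; rewrite -[n.+2]addn2 exprD; ring.
rewrite -mulrA ler_wpM2l// mulrC ler_pdivlMr// mulrBl.
have := IS n; rewrite -[n.+2%:R]natr1 => H.
by rewrite (mulrC (I n)) -H mulrDl mul1r addrC mulrC addKr.
Qed.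

Lemma cvg_wallis (g : R -> R) (g0 C : R) m : continuous g ->
  (forall t, 0 <= t <= pi / 2 -> `|g t - g0| <= C * t ^+ 2) ->
  W g (m + 2 * N)%N / I (m + 2 * N)%N @[N --> \oo] --> g0.
Proof.
move=> cg gC; apply/cvgrPdist_le => e e0.
have Ce : \forall N \near \oo, C / e <= N%:R by exact: nbhs_infty_ger.
near=> N; have N0 : (0 < N)%N by near: N; exact: nbhs_infty_gt.
have -> : (m + 2 * N = (m + 2 * N).-2.+2)%N by lia.
rewrite distrC; apply: le_trans (wallis_dev _ cg gC) _.
rewrite ler_pdivrMr// -ler_pdivrMl// mulrC.
have : C / e <= N%:R by near: N.
by move=> /le_trans; apply; rewrite ler_nat; lia.
Unshelve. all: by end_near. Qed.


Let ratio (g : R -> R) n := W g n / I n.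

Let coshd (a x : R) : is_derive x (1 : R) (fun t => cosh (a * t)) (a * sinh (a * x)).
Proof. by eapply is_derive_subst; [der|ring]. Qed.

Let sinhd (a x : R) : is_derive x (1 : R) (fun t => sinh (a * t)) (a * cosh (a * x)).
Proof. by eapply is_derive_subst; [der|ring]. Qed.

Lemma sinh_le_exp (y : R) : 0 <= y -> 0 <= expR y - expR (- y) <= 2 * y * expR y.
Proof.
move=> y0; rewrite subr_ge0 ler_expR; apply/andP; split; first lra.
rewrite lerBlDr -lerBlDl -{1}[expR y]mul1r -mulrBl.
have := expR_ge1Dx (- (2 * y)) => h.
have -> : expR (- y) = expR (- (2 * y)) * expR y by rewrite -expRD; congr expR; ring.
by rewrite ler_wpM2r ?expR_ge0//.
Qed.

Let cosh_bound (a t : R) : 0 <= a -> 0 <= t <= pi / 2 ->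
  `|cosh (a * t) - 1| <= (a ^+ 2 * expR (a * pi / 2)) * t ^+ 2.
Proof.
move=> a0 /andP[t0 tp]; have at0 : 0 <= a * t / 2 by rewrite !mulr_ge0.
have /andP[h1 h2] := sinh_le_exp at0.
set e1 := expR (a * t / 2) in h1 h2; set e2 := expR _ in h1 h2.
have e12 : e1 * e2 = 1 by rewrite /e1 /e2 -expRD subrr expR0.
have E1 : expR (a * t) = e1 ^+ 2 by rewrite /e1 expr2 -expRD; congr expR; field.
have E2 : expR (- (a * t)) = e2 ^+ 2 by rewrite /e2 expr2 -expRD; congr expR; field.
have -> : cosh (a * t) - 1 = (e1 - e2) ^+ 2 / 2.
  rewrite /cosh E1 E2; have -> : (e1 - e2) ^+ 2 = e1 ^+ 2 + e2 ^+ 2 - 2 * (e1 * e2) by ring.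
  by rewrite e12; field.
rewrite ger0_norm ?divr_ge0 ?sqr_ge0//.
have e1b : e1 ^+ 2 <= expR (a * pi / 2).
  by rewrite -E1 ler_expR -mulrA ler_wpM2l.
apply: (@le_trans _ _ ((2 * (a * t / 2) * e1) ^+ 2)).
  rewrite ler_pdivrMr//; apply: (@le_trans _ _ ((2 * (a * t / 2) * e1) ^+ 2)).
    by rewrite ler_sqr ?nnegrE// (le_trans h1).
  by rewrite ler_peMr ?sqr_ge0// ler1n.
have -> : (2 * (a * t / 2) * e1) ^+ 2 = a ^+ 2 * t ^+ 2 * e1 ^+ 2 by field.
have -> : a ^+ 2 * expR (a * pi / 2) * t ^+ 2 = a ^+ 2 * t ^+ 2 * expR (a * pi / 2) by ring.
by rewrite ler_wpM2l// mulr_ge0 ?sqr_ge0.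
Qed.

Let tsinh_bound (a t : R) : 0 <= a -> 0 <= t <= pi / 2 ->
  `|t * sinh (a * t) - 0| <= (a * expR (a * pi / 2)) * t ^+ 2.
Proof.
move=> a0 /andP[t0 tp]; have at0 : 0 <= a * t by rewrite !mulr_ge0.
have /andP[h1 h2] := sinh_le_exp at0.
have sh : 0 <= sinh (a * t) by rewrite divr_ge0.
rewrite subr0 ger0_norm ?mulr_ge0//.
have -> : a * expR (a * pi / 2) * t ^+ 2 = t * (a * t * expR (a * pi / 2)) by ring.
rewrite ler_wpM2l// /sinh ler_pdivrMr//.
apply: le_trans h2 _; rewrite [leRHS]mulrC -!mulrA ler_wpM2l// ler_wpM2l// ler_wpM2l//.
by rewrite ler_expR ler_wpM2l.
Qed.

Let ccosh (a : R) : continuous (fun t => cosh (a * t)).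
Proof. exact: continuous_is_derive (coshd a). Qed.

Let csinh (a : R) : continuous (fun t => sinh (a * t)).
Proof. exact: continuous_is_derive (sinhd a). Qed.

Let Wcosh_rec (a : R) n : (n.+2 * n.+1)%:R * W (fun t => cosh (a * t)) n =
  (n.+2%:R ^+ 2 + a ^+ 2) * W (fun t => cosh (a * t)) n.+2.
Proof.
have d2 (x : R) : is_derive x (1 : R) (fun t => a * sinh (a * t)) (a ^+ 2 * cosh (a * x)).
  by eapply is_derive_subst; [der|ring].
have c2 : continuous (fun t => a ^+ 2 * cosh (a * t)) by have cc := @ccosh a; cont.
have := wallis_rec n (coshd a) d2 c2.
rewrite mulr0 {1}/sinh oppr0 subrr mul0r mulr0 => /(_ erefl).
by rewrite WZ; [lra|exact: ccosh].
Qed.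

Let ratio_cosh_rec (a : R) n : ratio (fun t => cosh (a * t)) n =
  ratio (fun t => cosh (a * t)) n.+2 * (1 + a ^+ 2 / n.+2%:R ^+ 2).
Proof.
rewrite /ratio; have := Wcosh_rec a n; have := IS n; rewrite natrM.
have := I_gt0 n; have := I_gt0 n.+2; have n2 : (0 : R) < n.+2%:R by rewrite ltr0n.
have n1 : (0 : R) < n.+1%:R by rewrite ltr0n.
set G := W _ n; set G2 := W _ n.+2; set x := n.+2%:R; set y := n.+1%:R => i2 i0 e1 e2.
have -> : I n = x * I n.+2 / y by rewrite e1; field; lra.
have -> : G = (x ^+ 2 + a ^+ 2) * G2 / (x * y) by rewrite -e2; field; rewrite !gt_eqF.
by field; rewrite !gt_eqF.
Qed.

Let W0cosh (a : R) : 0 < a -> W (fun t => cosh (a * t)) 0 = sinh (a * (pi / 2)) / a.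
Proof.
move=> a0; have dF (x : R) : is_derive x (1 : R) (fun t => sinh (a * t) / a) (cos x ^+ 0 * cosh (a * x)).
  by eapply is_derive_subst; [der|field; rewrite gt_eqF].
have cF : continuous (fun t : R => cos t ^+ 0 * cosh (a * t)) by have cc := @ccosh a; cont.
rewrite /W (Rintegral_FTC hpi0 dF cF) mulr0.
by rewrite {2}/sinh oppr0 subrr !mul0r subr0.
Qed.

Let W0tsinh (a : R) : 0 < a -> W (fun t => t * sinh (a * t)) 0 =
  pi / 2 * cosh (a * (pi / 2)) / a - sinh (a * (pi / 2)) / a ^+ 2.
Proof.
move=> a0; have dF (x : R) : is_derive x (1 : R)
    (fun t => t * cosh (a * t) / a - sinh (a * t) / a ^+ 2) (cos x ^+ 0 * (x * sinh (a * x))).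
  by eapply is_derive_subst; [der|field; rewrite gt_eqF].
have cF : continuous (fun t : R => cos t ^+ 0 * (t * sinh (a * t))) by have cc := @csinh a; cont.
rewrite /W (Rintegral_FTC hpi0 dF cF) mulr0 !mul0r.
by rewrite {2}/sinh oppr0 subrr !mul0r !subr0.
Qed.

Let Wcosh_gt0 (a : R) n : 0 < W (fun t => cosh (a * t)) n.
Proof.
apply: lt_le_trans (I_gt0 n) _; apply: le_Rintegral.
- exact: measurable_itv.
- by apply: integrable_continuous; apply: cW; cont.
- by apply: integrable_continuous; apply: cW; exact: ccosh.
move=> t; rewrite /= in_itv/= => /andP[t0 tp].
have ct : 0 <= cos t by apply: cos_ge0_pihalf; have := pi_gt0 R; lra.
rewrite ler_wpM2l ?exprn_ge0// /cosh ler_pdivlMr// mul1r.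
have := expR_gt0 (a * t); have := expR_gt0 (- (a * t)).
have : expR (a * t) * expR (- (a * t)) = 1 by rewrite -expRD subrr expR0.
set x := expR _; set y := expR _ => xy y0 x0.
have := sqr_ge0 (x - y); rewrite sqrrB; nra.
Qed.

Let alg1 (s p z : R) : 0 < p -> 0 < z -> (2 * s / p) ^+ 2 / (2 * z) ^+ 2 = s ^+ 2 / (z ^+ 2 * p ^+ 2).
Proof. by move=> p0 z0; field; rewrite !gt_eqF. Qed.

Let alg2 (s p z : R) : 0 < p -> 0 < z -> 0 < s ->
  2 * s / p * (2 * (s / p) / ((2 * z) ^+ 2 + (s / p) ^+ 2)) = 4 * s ^+ 2 / (s ^+ 2 + 4 * p ^+ 2 * z ^+ 2).
Proof.
move=> p0 z0 s0; have h1 : 0 < s ^+ 2 + 4 * p ^+ 2 * z ^+ 2.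
  by have := exprn_gt0 2 s0; have := sqr_ge0 (p * z); rewrite exprMn; lra.
have -> : (2 * z) ^+ 2 + (s / p) ^+ 2 = (s ^+ 2 + 4 * p ^+ 2 * z ^+ 2) / p ^+ 2.
  by field; rewrite gt_eqF.
by move: h1; set u := s ^+ 2 + _ => h1; field; rewrite !gt_eqF.
Qed.

Lemma cvg_prod_sinh (s : R) : 0 < s ->
  \prod_(1 <= k < N.+1) (1 + s ^+ 2 / (k%:R ^+ 2 * pi ^+ 2)) @[N --> \oo] --> sinh s / s.
Proof.
move=> s0; have p0 := pi_gt0 R.
(* With this frequency the recurrence factor [1 + a ^+ 2 / (2 * N.+1)%:R ^+ 2] is Euler's factor,
   and the ratio at 0 is [sinh s / s]. *)
pose a := 2 * s / pi; have a0 : 0 < a by rewrite divr_gt0// mulr_gt0.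
pose q := ratio (fun t => cosh (a * t)).
have qN N : q 0 = q (2 * N)%N * \prod_(1 <= k < N.+1) (1 + s ^+ 2 / (k%:R ^+ 2 * pi ^+ 2)).
  elim: N => [|N IH]; first by rewrite big_geq// mulr1.
  rewrite big_nat_recr//= IH.
  have -> : (2 * N.+1 = (2 * N).+2)%N by lia.
  have -> : q (2 * N)%N = q (2 * N).+2 * (1 + a ^+ 2 / (2 * N).+2%:R ^+ 2) := ratio_cosh_rec a (2 * N).
  have -> : a ^+ 2 / (2 * N).+2%:R ^+ 2 = s ^+ 2 / (N.+1%:R ^+ 2 * pi ^+ 2).
    have -> : (2 * N).+2 = (2 * N.+1)%N by lia.
    by rewrite natrM; apply: alg1; rewrite ?ltr0n.
  by ring.
have q0 : q 0 = sinh s / s.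
  rewrite /q /ratio I0.
  rewrite W0cosh//.
  have aE : a * (pi / 2) = s by rewrite /a; move: p0; generalize (@pi R) => p p0; field; rewrite gt_eqF.
  by rewrite aE /a; move: p0; generalize (@pi R) => p p0; field; rewrite !gt_eqF.
have qc : q (2 * N)%N @[N --> \oo] --> (1 : R).
  apply: (@cvg_wallis (fun t => cosh (a * t)) 1 _ 0) => [|t t01]; first exact: ccosh.
  by apply: cosh_bound => //; exact: ltW.
rewrite -q0 -[q 0]mulr1 -[X in _ * X]invr1.
have {}qc : (q 0 * (q (2 * N)%N)^-1) @[N --> \oo] --> (q 0 * 1^-1 : R).
  by apply: cvgM; [exact: cvg_cst|apply: cvgV => //; exact: oner_neq0].
apply: cvg_trans qc; apply: near_eq_cvg; near=> N => /=.
rewrite (qN N) mulrAC mulfV ?mul1r//.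
have := q0; rewrite (qN N) => /eqP; apply: contraTneq => ->; rewrite mul0r eq_sym gt_eqF//.
rewrite divr_gt0// divr_gt0// subr_gt0 ltr_expR; lra.
Unshelve. all: by end_near. Qed.

(** [t * sinh (a * t)] is the derivative of [cosh (a * t)] in [a], so the quotient is a logarithmic
    derivative: the factor [n.+2%:R ^+ 2 + a ^+ 2] of the recurrence for [cosh] becomes a
    summand. *)
Let ratio_tsinh_rec (a : R) n :
  W (fun t => t * sinh (a * t)) n / W (fun t => cosh (a * t)) n =
  W (fun t => t * sinh (a * t)) n.+2 / W (fun t => cosh (a * t)) n.+2
  + 2 * a / (n.+2%:R ^+ 2 + a ^+ 2).
Proof.
have d1 (x : R) : is_derive x (1 : R) (fun t => t * sinh (a * t)) (sinh (a * x) + a * (x * cosh (a * x))).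
  by eapply is_derive_subst; [der|ring].
have d2 (x : R) : is_derive x (1 : R) (fun t => sinh (a * t) + a * (t * cosh (a * t)))
    (2 * a * cosh (a * x) + a ^+ 2 * (x * sinh (a * x))).
  by eapply is_derive_subst; [der|ring].
have cc := @ccosh a; have cs := @csinh a.
have c2 : continuous (fun t => 2 * a * cosh (a * t) + a ^+ 2 * (t * sinh (a * t))) by cont.
have := wallis_rec n d1 d2 c2.
rewrite mulr0 mul0r mulr0 addr0 {1}/sinh oppr0 subrr mul0r => /(_ erefl).
rewrite WD; [|by cont|by cont]; rewrite WZ//; rewrite WZ; last by cont.
have := Wcosh_rec a n; have := Wcosh_gt0 a n; have := Wcosh_gt0 a n.+2.
have n2 : (0 : R) < n.+2%:R by rewrite ltr0n.
have n1 : (0 : R) < n.+1%:R by rewrite ltr0n.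
rewrite natrM.
set G := W _ n; set G2 := W _ n.+2; set D := W _ n; set D2 := W _ n.+2.
set x := n.+2%:R; set y := n.+1%:R => G20 G0 e1 e2.
have xa : 0 < x ^+ 2 + a ^+ 2 by rewrite ltr_pwDl ?sqr_ge0// exprn_gt0.
have alg (X Y A D0 Q P : R) : 0 < X -> 0 < Y -> 0 < P -> 0 < X ^+ 2 + A ^+ 2 ->
    X * Y * Q = (X ^+ 2 + A ^+ 2) * P -> X * Y * D0 = (X ^+ 2 + A ^+ 2) * D2 + 2 * A * P ->
    D0 / Q = D2 / P + 2 * A / (X ^+ 2 + A ^+ 2).
  move=> X0 Y0 P0 XA h1 h2.
  have -> : D0 = ((X ^+ 2 + A ^+ 2) * D2 + 2 * A * P) / (X * Y) by rewrite -h2; field; rewrite !gt_eqF.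
  have -> : Q = (X ^+ 2 + A ^+ 2) * P / (X * Y) by rewrite -h1; field; rewrite !gt_eqF.
  by field; rewrite !gt_eqF.
by apply: (alg x y) => //; lra.
Qed.

Lemma cvg_sum_coth (s : R) : 0 < s ->
  \sum_(1 <= k < N.+1) (4 * s ^+ 2 / (s ^+ 2 + 4 * pi ^+ 2 * k%:R ^+ 2)) @[N --> \oo]
    --> s * coth (s / 2) - 2.
Proof.
move=> s0; have p0 := pi_gt0 R.
(* Half the frequency used for the product, because [coth] is taken at [s / 2]. *)
pose a := s / pi; have a0 : 0 < a by rewrite divr_gt0.
have a0' := ltW a0.
pose q n := W (fun t => t * sinh (a * t)) n / W (fun t => cosh (a * t)) n.
have cc := @ccosh a; have cs := @csinh a.
pose S N := \sum_(1 <= k < N.+1) (4 * s ^+ 2 / (s ^+ 2 + 4 * pi ^+ 2 * k%:R ^+ 2)).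
have qN N : 2 * s / pi * q 0 = 2 * s / pi * q (2 * N)%N + S N.
  elim: N => [|N IH]; first by rewrite /S big_geq// addr0.
  rewrite /S big_nat_recr//= -/(S N) IH.
  have -> : (2 * N.+1 = (2 * N).+2)%N by lia.
  have -> : q (2 * N)%N = q (2 * N).+2 + 2 * a / ((2 * N).+2%:R ^+ 2 + a ^+ 2) := ratio_tsinh_rec a (2 * N).
  rewrite mulrDr -!addrA; congr (_ + _); rewrite addrC; congr (_ + _).
  have -> : (2 * N).+2 = (2 * N.+1)%N by lia.
  rewrite natrM; set z := N.+1%:R; have z0 : (0 : R) < z by rewrite ltr0n.
  exact: alg2.
have q0 : 2 * s / pi * q 0 = s * coth (s / 2) - 2.
  have aE : a * (pi / 2) = s / 2 by rewrite /a; move: p0; generalize (@pi R) => p p0; field; rewrite gt_eqF.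
  rewrite /q W0cosh// W0tsinh// aE /coth.
  have sh0 : 0 < sinh (s / 2) by rewrite /sinh divr_gt0// subr_gt0 ltr_expR; lra.
  by rewrite /a; move: p0; generalize (@pi R) => p p0; field; rewrite !gt_eqF.
have Wr n (g : R -> R) : W g n / W (fun t => cosh (a * t)) n = (W g n / I n) / (W (fun t => cosh (a * t)) n / I n).
  by field; rewrite !gt_eqF.
have qc1 : W (fun t => cosh (a * t)) (2 * N)%N / I (2 * N)%N @[N --> \oo] --> (1 : R).
  apply: (@cvg_wallis (fun t => cosh (a * t)) 1 _ 0) => [|t t01]; first exact: ccosh.
  exact: cosh_bound.
have qc2 : W (fun t => t * sinh (a * t)) (2 * N)%N / I (2 * N)%N @[N --> \oo] --> (0 : R).
  apply: (@cvg_wallis (fun t => t * sinh (a * t)) 0 _ 0) => [|t t01]; first by cont.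
  exact: tsinh_bound.
pose q' N := (W (fun t => t * sinh (a * t)) (2 * N)%N / I (2 * N)%N) *
  (W (fun t => cosh (a * t)) (2 * N)%N / I (2 * N)%N)^-1.
have qc : q' N @[N --> \oo] --> (0 * 1^-1 : R).
  by apply: cvgM => //; apply: cvgV => //; exact: oner_neq0.
have {}qc : (2 * s / pi * q 0 - 2 * s / pi * q' N) @[N --> \oo] --> (2 * s / pi * q 0 - 2 * s / pi * (0 * 1^-1) : R).
  by apply: cvgB; [exact: cvg_cst|apply: cvgM => //; exact: cvg_cst].
move: qc; rewrite mul0r mulr0 subr0 q0 => qc.
apply: cvg_trans qc; apply: near_eq_cvg; near=> N => /=.
by rewrite -q0 (qN N) -/(S N) /q Wr /q'; ring.
Unshelve. all: by end_near. Qed.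

(** The recurrence for [g = t ^+ 2] adds [2 / n.+2%:R ^+ 2] at each step of length 2; started from
    [n = 1] it runs through the odd squares from 9 on. *)
Lemma cvg_sum_odd :
  \sum_(1 <= k < N.+1) ((2 * k%:R + 1) ^- 2 : R) @[N --> \oo] --> pi ^+ 2 / 8 - 1.
Proof.
have d1 (x : R) : is_derive x (1 : R) (fun t => t ^+ 2) (2 * x) by eapply is_derive_subst; [der|rewrite /=; ring].
have d2 (x : R) : is_derive x (1 : R) (fun t => 2 * t) (2 : R) by eapply is_derive_subst; [der|ring].
have c2 : continuous (fun _ : R => 2 : R) by cont.
pose q := ratio (fun t => t ^+ 2).
have qrec n : q n = q n.+2 + 2 / n.+2%:R ^+ 2.
  rewrite /q /ratio; have := wallis_rec n d1 d2 c2 (mulr0 _); have := IS n; rewrite natrM.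
  have -> : W (fun=> 2) n.+2 = 2 * I n.+2.
    by rewrite /I -WZ; [congr W; apply/funext => t; rewrite mulr1|cont].
  have := I_gt0 n; have := I_gt0 n.+2; have n2 : (0 : R) < n.+2%:R by rewrite ltr0n.
  have n1 : (0 : R) < n.+1%:R by rewrite ltr0n.
  set G := W _ n; set G2 := W _ n.+2; set x := n.+2%:R; set y := n.+1%:R => i2 i0 e1 e2.
  have -> : I n = x * I n.+2 / y by rewrite e1; field; lra.
  have -> : G = (x ^+ 2 * G2 + 2 * I n.+2) / (x * y) by rewrite e2; field; rewrite !gt_eqF.
  by field; rewrite !gt_eqF.
have qN N : q 1 = q (1 + 2 * N)%N + 2 * \sum_(1 <= k < N.+1) (2 * k%:R + 1) ^- 2.
  elim: N => [|N IH]; first by rewrite big_geq// mulr0 addr0.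
  rewrite big_nat_recr//= IH.
  have -> : (1 + 2 * N.+1 = (1 + 2 * N).+2)%N by lia.
  rewrite (qrec (1 + 2 * N)%N) mulrDr -!addrA; congr (_ + _); rewrite addrC; congr (_ + _ * _).
  by congr (_ ^- 2); rewrite -natrM natr1; congr (_%:R); lia.
have q1 : q 1 = pi ^+ 2 / 4 - 2.
  have dF (x : R) : is_derive x (1 : R) (fun t => t ^+ 2 * sin t + 2 * (t * cos t) - 2 * sin t) (cos x ^+ 1 * x ^+ 2).
    by eapply is_derive_subst; [der|rewrite /=; ring].
  have cF : continuous (fun t : R => cos t ^+ 1 * t ^+ 2) by cont.
  rewrite /q /ratio I1 divr1 /W (Rintegral_FTC hpi0 dF cF).
  by rewrite sin_pihalf cos_pihalf sin0; field.
have qc : q (1 + 2 * N)%N @[N --> \oo] --> (0 : R).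
  apply: (@cvg_wallis (fun t => t ^+ 2) 0 1 1) => [|t _]; first by cont.
  by rewrite subr0 mul1r ger0_norm ?sqr_ge0.
have -> : pi ^+ 2 / 8 - 1 = 2^-1 * (q 1 - 0) :> R by rewrite q1; field.
have {}qc : (2^-1 * (q 1 - q (1 + 2 * N)%N)) @[N --> \oo] --> (2^-1 * (q 1 - 0) : R).
  by apply: cvgM; [exact: cvg_cst|apply: cvgB; [exact: cvg_cst|exact: qc]].
apply: cvg_trans qc; apply: near_eq_cvg; near=> N => /=.
by rewrite (qN N); field.
Unshelve. all: by end_near. Qed.

End wallis.

(** * The constant of the theorem at the saddle *)

Section complex_real.
Context (R : realType).
Local Notation C := R[i].

Lemma rCE (x : R) : rC x = x%:C%C. Proof. by []. Qed.

Lemma rCM (x y : R) : rC (x * y) = rC x * rC y.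
Proof. by rewrite !rCE rmorphM. Qed.

Lemma cpow_rC (a b : R) : 0 < a -> cpow (rC a) b = rC (a `^ b).
Proof.
move=> a0; rewrite /cpow.
have -> : cmod (rC a) = a.
  by rewrite /cmod /= expr0n addr0 sqrtr_sqr gtr0_norm.
have -> : carg (rC a) = 0.
  rewrite /carg /= lexx /cmod /= expr0n addr0 sqrtr_sqr gtr0_norm// divff ?gt_eqF//.
  exact: acos1.
by rewrite mulr0 /cexp /= expR0 cos0 sin0 mul1r mulr1.
Qed.

Lemma sqr_iC_pi : (iC R * rC pi) ^+ 2 = rC (- pi ^+ 2).
Proof.
have i2 : iC R ^+ 2 = -1 by exact: sqr_i.
by rewrite exprMn i2 mulN1r !rCE rmorphN rmorphXn.
Qed.


Lemma prod_one_sub_sqr (N : nat) :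
  \prod_(2 <= k < N.+2) (1 - k%:R ^- 2) = (N%:R + 2) / (2 * (N%:R + 1)) :> R.
Proof.
elim: N => [|N IH]; first by rewrite big_geq//=; field.
rewrite big_nat_recr//= IH -[N.+2]addn2 -[N.+1]addn1 !natrD.
have : (0 : R) <= N%:R by rewrite ler0n.
by move: (N%:R : R) => z z0; field; rewrite !gt_eqF//; lra.
Qed.

Lemma powR_prod (I : eqType) (r : seq I) (F : I -> R) (b : R) : (forall i, i \in r -> 0 <= F i) ->
  (\prod_(i <- r) F i) `^ b = \prod_(i <- r) (F i `^ b).
Proof.
elim: r => [|i r IH] F0; first by rewrite !big_nil powR1.
rewrite !big_cons powRM ?IH//.
- by move=> j jr; apply: F0; rewrite inE jr orbT.
- by apply: F0; rewrite inE eqxx.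
- by rewrite big_seq; apply: prodr_ge0 => j jr; apply: F0; rewrite inE jr orbT.
Qed.

Lemma continuous_powRl (a x : R) : 0 < x -> {for x, continuous (fun y => y `^ a)}.
Proof.
move=> x0; have [d _] := is_derive1_powR a x0.
by apply/differentiable_continuous/derivable1_diffP.
Qed.

Lemma cvg_half : (N%:R + 2) / (2 * (N%:R + 1)) @[N --> \oo] --> (2^-1 : R).
Proof.
have -> : (fun N : nat => (N%:R + 2) / (2 * (N%:R + 1)) : R) = (fun N => 2^-1 + 2^-1 * (N.+1%:R)^-1).
  apply/funext => N; rewrite -[N.+1]addn1 natrD.
  have : (0 : R) <= N%:R by rewrite ler0n.
  by move: (N%:R : R) => z z0; field; rewrite !gt_eqF//; lra.
rewrite -[X in _ --> X]addr0 -[X in _ --> _ + X](mulr0 (2^-1)).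
apply: cvgD; first exact: cvg_cst.
by apply: cvgM; [exact: cvg_cst|exact: cvg_harmonic].
Qed.

(** At [i * pi] the bases are [1 - k^-2] with [k >= 2], positive reals, so the principal power is
    the real one; the product of the bases telescopes and tends to [1 / 2]. *)
Lemma V2_ipi (n : nat) : V2 n (iC R * rC pi) = rC (2 `^ (n%:R / 2)).
Proof.
rewrite /V2 sqr_iC_pi.
pose b : R := - (n%:R / 2).
have E N : \prod_(2 <= k < N) cpow (1 + rC (- pi ^+ 2) / rC (k%:R ^+ 2 * pi ^+ 2)) b =
    rC (\prod_(2 <= k < N) (1 - k%:R ^- 2) `^ b).
  rewrite (rCE (\prod_(_ <= _ < _) _)) rmorph_prod; apply: eq_big_nat => k /andP[k2 _].
  have k0 : (0 : R) < k%:R by rewrite ltr0n (leq_trans _ k2).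
  rewrite -[RHS]/(rC _) -cpow_rC; last first.
    by rewrite subr_gt0 invf_lt1 ?exprn_gt0// exprn_egt1// ltr1n.
  congr (cpow _ b).
  rewrite !rCE -fmorphV -rmorphM -[1 in LHS](rmorph1 (real_complex R)) -rmorphD; congr (_%:C%C).
  have alg (z p : R) : 0 < z -> 0 < p -> 1 + - p ^+ 2 / (z ^+ 2 * p ^+ 2) = 1 - z ^- 2.
    by move=> z0 p0; field; rewrite !gt_eqF.
  exact: alg (pi_gt0 R).
have L : \prod_(2 <= k < N) (1 - k%:R ^- 2) `^ b @[N --> \oo] --> (2 `^ (n%:R / 2) : R).
  rewrite -(cvg_shiftn 2).
  rewrite (_ : (fun N => _) = (fun N : nat => ((N%:R + 2) / (2 * (N%:R + 1))) `^ b)); last first.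
    apply/funext => N; rewrite addn2 -powR_prod ?prod_one_sub_sqr// => k.
    rewrite mem_index_iota => /andP[k2 _].
    have k0 : (0 : R) < k%:R by rewrite ltr0n (leq_trans _ k2).
    by rewrite subr_ge0 invf_le1 ?exprn_gt0// exprn_ege1// ler1n (leq_trans _ k2).
  have -> : 2 `^ (n%:R / 2) = (2^-1) `^ b :> R.
    by rewrite /b -powR_inv1// -powRrM mulN1r opprK.
  apply: (@continuous_cvg _ _ _ _ _ _ (fun y => y `^ b)); last exact: cvg_half.
  by apply: continuous_powRl; lra.
rewrite /climn; congr Complex.
  rewrite (_ : (fun N => _) = (fun N => \prod_(2 <= k < N) (1 - k%:R ^- 2) `^ b)).
    exact/cvg_lim.
  by apply/funext => N; rewrite E.
rewrite (_ : (fun N => _) = (fun=> 0)); first exact: lim_cst.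
by apply/funext => N; rewrite E.
Qed.

End complex_real.

(** * The isoperimetric inequality and the distance *)

Section dido.
Context (R : realType).
Local Notation mu := (@lebesgue_measure R).

(** Integrating from some [d < 0] provides a two-sided derivative at 0, the left end of the
    parameter interval. *)
Lemma primitive_exists (c d : R) (f : R -> R) : c < d -> d < 0 ->
  (forall t, c < t -> {for t, continuous f}) ->
  {F : R -> R | F 0 = 0 /\ forall t : R, d < t -> is_derive t (1 : R) F (f t)}.
Proof.
move=> cd d0 cf.
exists (fun t => (\int[mu]_(s in `[d, t]) f s)%R - (\int[mu]_(s in `[d, 0%R]) f s)%R).
split; first by rewrite subrr.
move=> t dt.
have tt : t < t + 1 by rewrite ltrDl.
have int : mu.-integrable `[d, t + 1] (EFin \o f).
  by apply: integrable_within => s /andP[ds _]; apply: cf; exact: lt_le_trans ds.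
have [d1 d2] := continuous_FTC1_closed tt int dt (cf t (lt_trans cd dt)).
have H : is_derive t (1 : R) (fun t => (\int[mu]_(s in `[d, t]) f s)%R) (f t).
  by apply: DeriveDef; [exact: d1|rewrite -derive1E; exact: d2].
apply: (is_derive_subst (is_derive_addf H (is_derive_cstf _ _))).
by rewrite addr0.
Qed.

(* The function differentiated here solves the Hamilton-Jacobi equation of length minus [ka] times
   area; [dido_pointwise] is the resulting calibration inequality. *)
Lemma dido_action_derive (ka x0 : R) (th x : R -> R) (t s a : R) :
  sin (th t) != 0 -> is_derive t (1 : R) th (ka * s) -> is_derive t (1 : R) x a ->
  is_derive t (1 : R)
   (fun t => ka * (cos (th t) * (x t ^+ 2 + x0 ^+ 2) - 2 * (x t * x0)) * (sin (th t))^-1)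
   (let w := (cos (th t) * x t - x0) / sin (th t) in
    2 * ka * w * a - ka ^+ 2 * s * (w ^+ 2 + x t ^+ 2)).
Proof.
move=> s0 dth dx; eapply is_derive_subst; first by der.
rewrite /=.
have c2 : cos (th t) ^+ 2 = 1 - sin (th t) ^+ 2 by rewrite -(cos2Dsin2 (th t)) addrK.
move: s0 c2; move: (sin _) (cos _) (x t) => S C X S0 C2.
apply/eqP; rewrite -subr_eq0; apply/eqP.
transitivity ((C ^+ 2 - (1 - S ^+ 2)) * (- (X ^+ 2 + x0 ^+ 2) * ka * (ka * s) / S ^+ 2 + X ^+ 2 * ka ^+ 2 * s / S ^+ 2)).
  by field.
by rewrite C2 subrr mul0r.
Qed.

Lemma dido_pointwise n (ka s : R) (a b x w : 'I_n -> R) : 0 < s ->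
  s ^+ 2 >= \sum_(j < n) (a j ^+ 2 + b j ^+ 2) ->
  0 <= s - 2 * ka * (\sum_(j < n) x j * b j)
     - \sum_(j < n) (2 * ka * w j * a j - ka ^+ 2 * s * (w j ^+ 2 + x j ^+ 2)).
Proof.
move=> s0 hs.
have H : \sum_(j < n) (2 * ka * (x j * b j) + (2 * ka * w j * a j - ka ^+ 2 * s * (w j ^+ 2 + x j ^+ 2)))
    <= \sum_(j < n) ((a j ^+ 2 + b j ^+ 2) / s).
  apply: ler_sum => j _; rewrite ler_pdivlMr// -subr_ge0.
  have -> : a j ^+ 2 + b j ^+ 2 - (2 * ka * (x j * b j) + (2 * ka * w j * a j - ka ^+ 2 * s * (w j ^+ 2 + x j ^+ 2))) * s
    = (a j - ka * s * w j) ^+ 2 + (b j - ka * s * x j) ^+ 2 by ring.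
  by rewrite addr_ge0 ?sqr_ge0.
move: H; rewrite big_split/= -mulr_sumr -mulr_suml => H.
have : (\sum_(j < n) (a j ^+ 2 + b j ^+ 2)) / s <= s by rewrite ler_pdivrMr// -expr2.
by lra.
Qed.

(** Calibration: with arc length [Sf], area [P] and the function [E], the combination
    [Sf - 2 ka P - \sum_j E j] is nondecreasing. [ka * L < pi] keeps the angle [th] inside []0,
    pi[], where [sin] does not vanish, and [de] keeps the speed positive. Subtracting half of the
    full integral of [a j] normalises the path so that [x j 1 = - x j 0]. *)
Lemma dido_continuous n (a b : 'I_n -> R -> R) (de ka : R) : 0 < de -> 0 < ka ->
  (forall j, continuous (a j)) -> (forall j, continuous (b j)) ->
  let L := (\int[mu]_(t in `[0%R, 1%R]) Num.sqrt (\sum_(j < n) (a j t ^+ 2 + b j t ^+ 2) + de ^+ 2))%R in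
  ka * L < pi ->
  2 * ka * (\int[mu]_(t in `[0%R, 1%R]) (\sum_(j < n)
    ((\int[mu]_(s in `[0%R, t]) a j s) - 2^-1 * (\int[mu]_(s in `[0%R, 1%R]) a j s)) * b j t))%R <= L.
Proof.
move=> de0 ka0 ca cb.
set sg := fun t => Num.sqrt (\sum_(j < n) (a j t ^+ 2 + b j t ^+ 2) + de ^+ 2).
move=> L kaL.
have S0 t : 0 <= \sum_(j < n) (a j t ^+ 2 + b j t ^+ 2).
  by apply: sumr_ge0 => j _; rewrite addr_ge0 ?sqr_ge0.
have sg0 t : 0 < sg t.
  by rewrite sqrtr_gt0 ltr_wpDl// exprn_gt0.
have csg : continuous sg by rewrite /sg; cont.
(* Nested left endpoints: [P] is a primitive of an expression in [A], which is itself known to be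
   differentiable only to the right of -1. *)
have n21 : -2 < -1 :> R by lra.
have n10 : -1 < 0 :> R by lra.
have n1h : -1 < - 2^-1 :> R by lra.
have nh0 : - 2^-1 < 0 :> R by lra.
have [Sf [Sf0 dSf]] := primitive_exists n21 n10 (fun t _ => csg t).
have A_ j : {F : R -> R | F 0 = 0 /\ forall t : R, -1 < t -> is_derive t (1 : R) F (a j t)}.
  exact: (primitive_exists n21 n10 (fun t _ => ca j t)).
pose A j := sval (A_ j).
have A0 j : A j 0 = 0 by have [] := svalP (A_ j).
have dA j (t : R) : -1 < t -> is_derive t (1 : R) (A j) (a j t) by have [_] := svalP (A_ j); exact.
pose x j t := A j t - 2^-1 * A j 1.
have cA j (t : R) : -1 < t -> {for t, continuous (A j)}.
  by move=> t1; exact: (continuous_at_is_derive (dA j t t1)).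
have cxb (t : R) : -1 < t -> {for t, continuous (fun t => \sum_(j < n) x j t * b j t)}.
  move=> t1; have cAt : forall j, cts (A j) t by move=> j; exact: cA.
  suff : cts (fun t => \sum_(j < n) x j t * b j t) t by [].
  by rewrite /x; ctsauto; exact: cb.
have [P [P0 dP]] := primitive_exists n1h nh0 cxb.
have AE j (t : R) : 0 <= t -> (\int[mu]_(s in `[0%R, t]) a j s)%R = A j t.
  move=> t0; have dd (y : R) : 0 <= y <= t -> is_derive y (1 : R) (A j) (a j y).
    by move=> /andP[y0 _]; apply: dA; lra.
  by rewrite (Rintegral_FTC_in t0 dd (fun y _ => ca j y)) A0 subr0.
have LE : L = Sf 1.
  have dd (y : R) : 0 <= y <= 1 -> is_derive y (1 : R) Sf (sg y).
    by move=> /andP[y0 _]; apply: dSf; lra.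
  by rewrite /L (Rintegral_FTC_in ler01 dd (fun y _ => csg y)) Sf0 subr0.
have -> : (\int[mu]_(t in `[0%R, 1%R]) (\sum_(j < n)
    ((\int[mu]_(s in `[0%R, t]) a j s) - 2^-1 * (\int[mu]_(s in `[0%R, 1%R]) a j s)) * b j t))%R = P 1.
  transitivity (\int[mu]_(t in `[0%R, 1%R]) (\sum_(j < n) x j t * b j t))%R.
    apply: eq_Rintegral => t; rewrite inE/= in_itv/= => /andP[t0 _].
    by apply: eq_bigr => j _; rewrite !AE.
  have dd (y : R) : 0 <= y <= 1 -> is_derive y (1 : R) P (\sum_(j < n) x j y * b j y).
    by move=> /andP[y0 _]; apply: dP; lra.
  have cc (y : R) : 0 <= y <= 1 -> {for y, continuous (fun t => \sum_(j < n) x j t * b j t)}.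
    by move=> /andP[y0 _]; apply: cxb; lra.
  by rewrite (Rintegral_FTC_in ler01 dd cc) P0 subr0.
(* The angle runs from [th0] to [pi - th0]. Together with [x j 1 = - x j 0] this makes the boundary
   terms ordered: [E j 1 - E j 0 = 4 ka (x j 0)^2 (1 - cos th0) / sin th0]. *)
pose th0 := (pi - ka * L) / 2.
have th00 : 0 < th0 by rewrite /th0; lra.
pose th t := ka * Sf t + th0.
have cSf (t : R) : -1 < t -> {for t, continuous Sf}.
  by move=> t1; exact: (continuous_at_is_derive (dSf t t1)).
have sub_cc (F f : R -> R) (u v : R) : 0 <= u -> u <= v ->
    (forall t : R, 0 <= t <= v -> is_derive t (1 : R) F (f t)) -> (forall t, 0 <= t <= v -> 0 <= f t) -> F u <= F v.
  move=> u0 uv dF f0.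
  apply: (@ger0_derive1_le_cc _ F 0 v) => //.
  - by move=> y; rewrite in_itv/= => /andP[y0 yv]; have [] := dF y (introT andP (conj (ltW y0) (ltW yv))).
  - move=> y; rewrite in_itv/= => /andP[y0 yv]; rewrite derive1E.
    by have [_ ->] := dF y (introT andP (conj (ltW y0) (ltW yv))); apply: f0; rewrite !ltW.
  - apply: continuous_in_subspaceT => y; rewrite inE/= in_itv/= => yv.
    exact: (continuous_at_is_derive (dF y yv)).
  - by rewrite in_itv/= u0.
  - by rewrite in_itv/= lexx (le_trans u0 uv).
have Smon u v : 0 <= u -> u <= v -> Sf u <= Sf v.
  move=> u0 uv; apply: (sub_cc Sf sg) => // t /andP[t0 _]; first by apply: dSf; lra.
  exact: ltW.
have sth t : 0 <= t <= 1 -> 0 < sin (th t).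
  move=> /andP[t0 t1]; apply: sin_gt0_pi; rewrite /th.
  have := Smon _ _ (lexx 0) t0; have := Smon _ _ t0 t1; rewrite Sf0 -LE => h1 h2.
  have : 0 <= ka * Sf t by rewrite mulr_ge0// ltW.
  have : ka * Sf t <= ka * L by rewrite ler_pM2l.
  by rewrite /th0; lra.
pose E j t := ka * (cos (th t) * (x j t ^+ 2 + x j 0 ^+ 2) - 2 * (x j t * x j 0)) * (sin (th t))^-1.
pose w j t := (cos (th t) * x j t - x j 0) / sin (th t).
pose E' j t := 2 * ka * w j t * a j t - ka ^+ 2 * sg t * (w j t ^+ 2 + x j t ^+ 2).
have dE j (t : R) : 0 <= t <= 1 -> is_derive t (1 : R) (E j) (E' j t).
  move=> t01; apply: dido_action_derive.
  - by rewrite gt_eqF// sth.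
  - have H := dSf t; have {}H : is_derive t (1 : R) Sf (sg t) by apply: H; case/andP: t01; lra.
    by rewrite /th; eapply is_derive_subst; [der|ring].
  - have H := dA j t; have {}H : is_derive t (1 : R) (A j) (a j t) by apply: H; case/andP: t01; lra.
    by rewrite /x; eapply is_derive_subst; [der|ring].
have dsum (I : Type) (r : seq I) (F : I -> R -> R) (f : I -> R) (t : R) :
    (forall i, is_derive t (1 : R) (F i) (f i)) ->
    is_derive t (1 : R) (fun t => \sum_(i <- r) F i t) (\sum_(i <- r) f i).
  move=> dF; elim: r => [|i r IH].
    by rewrite big_nil; under eq_fun do rewrite big_nil; exact: is_derive_cstf.
  by rewrite big_cons; under eq_fun do rewrite big_cons; exact: is_derive_addf.
pose H t := Sf t + - (2 * ka * P t) + - (\sum_(j < n) E j t).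
have : H 0 <= H 1.
  apply: (sub_cc H (fun t => sg t - 2 * ka * (\sum_(j < n) x j t * b j t) - \sum_(j < n) E' j t)) => //.
  - move=> t t01; have h1 : is_derive t (1 : R) Sf (sg t) by apply: dSf; case/andP: t01; lra.
    have h2 : is_derive t (1 : R) P (\sum_(j < n) x j t * b j t) by apply: dP; case/andP: t01; lra.
    have h3 := dsum _ (index_enum 'I_n) E (fun j => E' j t) t (fun j => dE j t t01).
    apply: (is_derive_subst (is_derive_addf (is_derive_addf h1 (is_derive_oppf (is_derive_mulf (is_derive_cstf (2 * ka) t) h2))) (is_derive_oppf h3))).
    by ring.
  - move=> t t01; apply: dido_pointwise => //.
    by rewrite /sg sqr_sqrtr ?lerDl ?sqr_ge0// addr_ge0// sqr_ge0.
rewrite /H Sf0 P0 -LE => Hle.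
have E01 : \sum_(j < n) E j 0 <= \sum_(j < n) E j 1.
  apply: ler_sum => j _.
  have t0E : th 0 = th0 by rewrite /th Sf0 mulr0 add0r.
  have t1E : th 1 = pi - th0 by rewrite /th -LE /th0; lra.
  have x1 : x j 1 = - x j 0 by rewrite /x A0; lra.
  have s0 : 0 < sin th0 by rewrite -t0E sth// lexx ler01.
  rewrite /E t0E t1E x1 sinB cosB sinpi cospi.
  have := cos_le1 th0 => c1.
  rewrite -subr_ge0.
  have -> : forall C S X : R, ka * ((-1 * C + 0 * S) * ((- X) ^+ 2 + X ^+ 2) - 2 * (- X * X)) / (0 * C - -1 * S)
     - ka * (C * (X ^+ 2 + X ^+ 2) - 2 * (X * X)) / S = 4 * ka * X ^+ 2 * (1 - C) / S.
    move=> C S X; have -> : 0 * C - -1 * S = S by ring.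
    by ring.
  by rewrite divr_ge0 ?(ltW s0)// mulr_ge0 ?subr_ge0// mulr_ge0 ?sqr_ge0// mulr_ge0 ?(ltW ka0).
by lra.
Qed.

End dido.

(** If the isoperimetric inequality failed, a curvature strictly between [L / (2 * P)] and [pi / L]
    would contradict [dido_continuous]; the midpoint serves. *)
Lemma curvature_between (R : realType) (L P : R) : 0 < L -> 0 < P -> L ^+ 2 < 2 * pi * P ->
  exists ka, [/\ 0 < ka, ka * L < pi & L < ka * (2 * P)].
Proof.
move=> L0 P0 H; have P2 : 0 < 2 * P by rewrite mulr_gt0.
have h1 : L / (2 * P) < pi / L.
  by rewrite ltr_pdivrMr// mulrAC ltr_pdivlMr// -expr2 mulrCA mulrA.
exists ((L / (2 * P) + pi / L) / 2); rewrite -!ltr_pdivlMr// -(@ltr_pdivrMr _ (2 * P))//.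
have := divr_gt0 L0 P2; move: h1; clear.
move: (L / _) (_ / L) => x y xy x0; split; lra.
Qed.

Section dido_L1.
Context (R : realType).
Local Notation mu := (@lebesgue_measure R).
Local Notation I01 f := (\int[mu]_(t in `[0%R, 1%R]) (f t))%R.
Local Notation int01 f := (mu.-integrable `[0%R, 1%R] (EFin \o f)).

Let m01 : measurable (`[0%R, 1%R]%classic : set (measurableTypeR R)).
Proof. exact: measurable_itv. Qed.

Lemma L1_approx_continuous (f : R -> R) (e : R) : int01 f -> 0 < e ->
  exists g : R -> R, [/\ continuous g, int01 g & I01 (fun t => `|f t - g t|) <= e].
Proof.
move=> intf e0.
have fin01 : (mu `[0%R, 1%R]%classic < +oo)%E.
  by rewrite lebesgue_measure_itv/= lte_fin ltr01 -EFinB ltry.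
have [g [cg intg]] := approximation_continuous_integrable m01 fin01 intf.
move=> /fine_cvgP[fing /cvgr0Pnorm_le /(_ e e0) He].
near \oo => n; exists (g n); split => //.
have : `|fine (\int[mu]_(z in `[0%R, 1%R]) `|(f z - g n z)%:E|)%E| <= e by near: n.
apply: le_trans; rewrite /Rintegral; apply: ler_norm.
Unshelve. all: by end_near. Qed.

Lemma integrable_norm01 (f : R -> R) : int01 f -> int01 (fun t => `|f t|).
Proof.
move=> intf; have := integrable_norm intf.
by apply: eq_integrable => // t _ /=.
Qed.

Lemma integrable_sub01 (f g : R -> R) : int01 f -> int01 g -> int01 (fun t => f t - g t).
Proof.
move=> intf intg; have := integrableB m01 intf intg.
by apply: eq_integrable => // t _ /=.
Qed.

Lemma le_norm_Rintegral_sub (f : R -> R) (t : R) : int01 f -> 0 <= t <= 1 ->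
  `|\int[mu]_(s in `[0%R, t]) f s|%R <= I01 (fun s => `|f s|).
Proof.
move=> intf /andP[t0 t1].
have sub : (`[0%R, t]%classic : set R) `<=` `[0%R, 1%R]%classic by apply: subset_itvl; rewrite bnd_simp.
have mt : measurable (`[0%R, t]%classic : set (measurableTypeR R)) by exact: measurable_itv.
have intt : mu.-integrable `[0%R, t] (EFin \o f) by exact: integrableS intf.
apply: le_trans (le_normr_Rintegral mt intt) _.
rewrite /Rintegral fine_le//.
- by apply: integrable_fin_num => //; have := integrable_norm intt; apply: eq_integrable => // s _ /=.
- by apply: integrable_fin_num => //; exact: integrable_norm01.
apply: ge0_subset_integral => //.
have [/measurable_EFinP mf _] := integrableP _ _ _ intf.
by apply/measurable_EFinP; apply: measurableT_comp => //.
Qed.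

Let prim (f : R -> R) (t : R) := (\int[mu]_(s in `[0%R, t]) f s)%R - 2^-1 * I01 f.

Lemma norm_prim_le (f : R -> R) (t : R) : int01 f -> 0 <= t <= 1 ->
  `|prim f t| <= 2 * I01 (fun s => `|f s|).
Proof.
move=> intf t01; rewrite /prim.
have h1 := le_norm_Rintegral_sub intf t01.
have h2 := le_normr_Rintegral m01 intf.
rewrite (le_trans (ler_normB _ _))// normrM (ger0_norm (_ : 0 <= 2^-1))//.
have : 0 <= I01 (fun s => `|f s|) by exact: le_trans (normr_ge0 _) h1.
by lra.
Qed.

Lemma measurable_prim (f : R -> R) : int01 f -> measurable_fun (`[0%R, 1%R]%classic : set (measurableTypeR R)) (prim f).
Proof.
move=> intf; apply: measurable_funB => //.
apply: subspace_continuous_measurable_fun => //.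
exact: parameterized_integral_continuous.
Qed.

Lemma integrable_prim_mul (f g : R -> R) : int01 f -> int01 g -> int01 (fun t => prim f t * g t).
Proof.
move=> intf intg.
have [/measurable_EFinP mg _] := integrableP _ _ _ intg.
apply: (le_integrable m01 _ _ (integrable_EFinZ m01 (2 * I01 (fun s => `|f s|)) (integrable_norm01 intg))).
  by apply/measurable_EFinP; apply: measurable_funM => //; exact: measurable_prim.
move=> t /=; rewrite in_itv/= => t01; rewrite lee_fin normrM [leRHS]normrM normr_id ler_wpM2r//.
by apply: le_trans (ler_norm _); exact: norm_prim_le.
Qed.

Lemma primB (f g : R -> R) (t : R) : int01 f -> int01 g -> 0 <= t <= 1 ->
  prim f t - prim g t = prim (fun s => f s - g s) t.
Proof.
move=> intf intg /andP[t0 t1]; rewrite /prim.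
have sub : (`[0%R, t]%classic : set R) `<=` `[0%R, 1%R]%classic by apply: subset_itvl; rewrite bnd_simp.
have mt : measurable (`[0%R, t]%classic : set (measurableTypeR R)) by exact: measurable_itv.
have if_ : mu.-integrable `[0%R, t] (EFin \o f) by exact: integrableS intf.
have ig_ : mu.-integrable `[0%R, t] (EFin \o g) by exact: integrableS intg.
by rewrite RintegralB// RintegralB//; ring.
Qed.

Lemma Rintegral_sum01 (I : Type) (r : seq I) (F : I -> R -> R) : (forall i, int01 (F i)) ->
  int01 (fun t => \sum_(i <- r) F i t) /\ I01 (fun t => \sum_(i <- r) F i t) = \sum_(i <- r) I01 (F i).
Proof.
move=> intF; elim: r => [|i r [IH1 IH2]].
  rewrite (_ : (fun t => _) = (fun=> 0)); last by apply/funext => t; rewrite big_nil.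
  split; first by apply: integrable_continuous; cont.
  by rewrite big_nil Rintegral_cst// mul0r.
rewrite (_ : (fun t => _) = (fun t => F i t + \sum_(j <- r) F j t)); last by apply/funext => t; rewrite big_cons.
split; first exact: integrable_EFinD.
by rewrite RintegralD// big_cons IH2.
Qed.

Lemma sqrt_sum_perturb (I : finType) (u v : I -> R) (e : R) : 0 <= e ->
  Num.sqrt (\sum_i v i ^+ 2 + e ^+ 2) <= Num.sqrt (\sum_i u i ^+ 2) + \sum_i `|u i - v i| + e.
Proof.
move=> e0; set s := Num.sqrt (\sum_i u i ^+ 2); set D := \sum_i `|u i - v i|.
have s2 : s ^+ 2 = \sum_i u i ^+ 2 by rewrite sqr_sqrtr// sumr_ge0// => i _; exact: sqr_ge0.
have s0 : 0 <= s by exact: sqrtr_ge0.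
have D0 : 0 <= D by apply: sumr_ge0 => i _; exact: normr_ge0.
have us i : `|u i| <= s.
  rewrite -sqrtr_sqr ler_sqrt; last by apply: sumr_ge0 => j _; exact: sqr_ge0.
  by rewrite (bigD1 i)//= lerDl sumr_ge0// => j _; exact: sqr_ge0.
have dD i : `|u i - v i| <= D.
  by rewrite /D (bigD1 i)//= lerDl sumr_ge0// => j _; exact: normr_ge0.
have H : \sum_i v i ^+ 2 <= s ^+ 2 + 2 * s * D + D * D.
  rewrite s2 {1}/D mulr_sumr {2}/D mulr_sumr -!big_split/=; apply: ler_sum => i _.
  have h1 := us i; have h2 := dD i.
  have vE : v i = u i - (u i - v i) by ring.
  rewrite {1}vE; move: h1 h2; set d := u i - v i; set x := u i => h1 h2.
  have h3 : - (x * d) <= s * `|d|.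
    by rewrite (le_trans (ler_norm _))// normrN normrM ler_wpM2r.
  have h4 : d ^+ 2 <= D * `|d| by rewrite -real_normK ?num_real// expr2 ler_wpM2r.
  by rewrite sqrrB; lra.
rewrite -[leRHS]ger0_norm ?addr_ge0// -sqrtr_sqr ler_wsqrtr//.
rewrite (le_trans (lerD H (lexx _)))//.
have := mulr_ge0 s0 e0; have := mulr_ge0 D0 e0.
by rewrite !sqrrD; lra.
Qed.

Lemma integrable_sqrt_sum (I : finType) (f : I -> R -> R) : (forall i, int01 (f i)) ->
  int01 (fun t => Num.sqrt (\sum_i f i t ^+ 2)).
Proof.
move=> intf.
have [H _] := Rintegral_sum01 (index_enum I) (fun i => integrable_norm01 (intf i)).
apply: (le_integrable m01 _ _ H).
  apply/measurable_EFinP.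
  apply: measurableT_comp; first by apply: continuous_measurable_fun; exact: sqrt_continuous.
  apply: measurable_sum => i; apply: measurable_funX.
  by have [/measurable_EFinP] := integrableP _ _ _ (intf i).
move=> t _ /=; rewrite lee_fin ger0_norm ?sqrtr_ge0// (le_trans _ (ler_norm _))//.
have := @sqrt_sum_perturb _ (fun=> 0) (fun i : I => f i t) 0 (lexx _).
have z : \sum_(i : I) (0 : R) ^+ 2 = 0 by rewrite big1// => i _; rewrite expr0n.
rewrite z sqrtr0 add0r expr0n/= !addr0 => /le_trans; apply.
by apply: ler_sum => i _; rewrite !sub0r !normrN.
Qed.

Lemma Rintegral01_cst (c : R) : I01 (fun=> c) = c.
Proof.
have dF (x : R) : is_derive x (1 : R) (fun x => c * x) c by eapply is_derive_subst; [der|ring].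
have cF : continuous (fun _ : R => c) by cont.
by rewrite (Rintegral_FTC ler01 dF cF); ring.
Qed.

Lemma le_of_small_slope (x y M : R) : 0 <= M -> (forall e, 0 < e -> e <= 1 -> x <= y + e * M) -> x <= y.
Proof.
move=> M0 H; apply/ler_addgt0Pr => d d0.
pose e := Num.min 1 (d / (M + 1)).
have M1 : 0 < M + 1 by lra.
have e0 : 0 < e by rewrite /e lt_min ltr01 divr_gt0.
have e1 : e <= 1 by rewrite /e ge_min lexx.
apply: le_trans (H e e0 e1) _; rewrite lerD2l.
have : e <= d / (M + 1) by rewrite /e ge_min lexx orbT.
rewrite ler_pdivlMr//; lra.
Qed.

(** Reduction to continuous velocities: [prim] is controlled uniformly by the L1 norm, and the
    length by [sqrt_sum_perturb]. The same [e] measures the approximation and regularises the speed,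
    and is sent to 0 at the end. *)
Lemma dido_L1 n (a b : 'I_n -> R -> R) :
  (forall j, int01 (a j)) -> (forall j, int01 (b j)) ->
  2 * pi * I01 (fun t => \sum_(j < n) prim (a j) t * b j t) <=
  (I01 (fun t => Num.sqrt (\sum_(j < n) (a j t ^+ 2 + b j t ^+ 2)))) ^+ 2.
Proof.
move=> inta intb.
set P := I01 _; set L := I01 _.
have p0 := pi_gt0 R.
have nI0 (f : R -> R) : int01 f -> 0 <= I01 (fun t => `|f t|).
  by move=> _; apply: Rintegral_ge0.
have int_s : int01 (fun t => Num.sqrt (\sum_(j < n) (a j t ^+ 2 + b j t ^+ 2))).
  rewrite (_ : (fun t => _) = (fun t => Num.sqrt (\sum_(i : 'I_n + 'I_n) (match i with inl j => a j | inr j => b j end) t ^+ 2))).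
    by apply: integrable_sqrt_sum => -[j|j].
  by apply/funext => t; rewrite big_sumType/= -big_split.
have L0 : 0 <= L by apply: Rintegral_ge0 => t _; exact: sqrtr_ge0.
pose Ia j := I01 (fun t => `|a j t|); pose Ib j := I01 (fun t => `|b j t|).
have Ia0 j : 0 <= Ia j by exact: nI0.
have Ib0 j : 0 <= Ib j by exact: nI0.
pose C1 := \sum_(j < n) (2 * Ib j + 2 * (Ia j + 1)).
have C10 : 0 <= C1.
  by apply: sumr_ge0 => j _; have := Ia0 j; have := Ib0 j; lra.
pose K : R := 2 * n%:R + 1.
have K0 : 0 <= K by rewrite /K; have : (0 : R) <= n%:R by rewrite ler0n; lra.
suff main e : 0 < e -> e <= 1 -> 2 * pi * (P - e * C1) <= (L + K * e) ^+ 2.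
  apply: (@le_of_small_slope _ _ (2 * L * K + K ^+ 2 + 2 * pi * C1)).
    have := mulr_ge0 L0 K0; have := mulr_ge0 (ltW p0) C10; have := sqr_ge0 K; lra.
  move=> e e0 e1; have := main e e0 e1.
  have -> : (L + K * e) ^+ 2 = L ^+ 2 + e * (2 * L * K + e * K ^+ 2) by ring.
  have : e * (e * K ^+ 2) <= e * (1 * K ^+ 2) by rewrite ler_wpM2l ?(ltW e0)// ler_wpM2r ?sqr_ge0.
  by lra.
move=> e0 e1.
have [ga [cga iga aga]] : exists ga : 'I_n -> R -> R, [/\ forall j, continuous (ga j),
    forall j, int01 (ga j) & forall j, I01 (fun t => `|a j t - ga j t|) <= e].
  pose g_ j := cid (L1_approx_continuous (inta j) e0).
  by exists (fun j => sval (g_ j)); split=> j; have [] := svalP (g_ j).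
have [gb [cgb igb agb]] : exists gb : 'I_n -> R -> R, [/\ forall j, continuous (gb j),
    forall j, int01 (gb j) & forall j, I01 (fun t => `|b j t - gb j t|) <= e].
  pose g_ j := cid (L1_approx_continuous (intb j) e0).
  by exists (fun j => sval (g_ j)); split=> j; have [] := svalP (g_ j).
pose Ph := I01 (fun t => \sum_(j < n) prim (ga j) t * gb j t).
pose Lh := I01 (fun t => Num.sqrt (\sum_(j < n) (ga j t ^+ 2 + gb j t ^+ 2) + e ^+ 2)).
have PPh : P - e * C1 <= Ph.
  rewrite lerBlDr -lerBlDl.
  have iP j := integrable_prim_mul (inta j) (intb j).
  have iPh j := integrable_prim_mul (iga j) (igb j).
  have [_ PE] := Rintegral_sum01 (index_enum 'I_n) iP.
  have [_ PhE] := Rintegral_sum01 (index_enum 'I_n) iPh.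
  rewrite /P /Ph PE PhE -sumrB /C1 mulr_sumr; apply: ler_sum => j _.
  rewrite -RintegralB//.
  have ida := integrable_sub01 (inta j) (iga j).
  have idb := integrable_sub01 (intb j) (igb j).
  have i1 := integrable_EFinZ m01 (2 * e) (integrable_norm01 (intb j)).
  have i2 := integrable_EFinZ m01 (2 * (Ia j + 1)) (integrable_norm01 idb).
  apply: (@le_trans _ _ (I01 (fun t => 2 * e * `|b j t| + 2 * (Ia j + 1) * `|b j t - gb j t|))).
    apply: le_Rintegral => //.
    - exact: integrable_sub01.
    - exact: integrable_EFinD.
    move=> t /=; rewrite in_itv/= => t01.
    have -> : prim (a j) t * b j t - prim (ga j) t * gb j t =
       (prim (a j) t - prim (ga j) t) * b j t + prim (ga j) t * (b j t - gb j t) by ring.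
    apply: (le_trans (ler_norm _)); apply: (le_trans (ler_normD _ _)); rewrite !normrM; apply: lerD.
      rewrite ler_wpM2r// primB// (le_trans (norm_prim_le ida t01))// ler_wpM2l//; exact: aga.
    rewrite ler_wpM2r// (le_trans (norm_prim_le (iga j) t01))// ler_wpM2l//.
    have h := aga j.
    apply: (@le_trans _ _ (I01 (fun t => `|a j t|) + I01 (fun t => `|a j t - ga j t|))).
      rewrite -RintegralD//; [|exact: integrable_norm01|exact: integrable_norm01].
      apply: le_Rintegral => //; [exact: integrable_norm01|exact: integrable_EFinD (integrable_norm01 _) (integrable_norm01 _)|].
      by move=> s _; rewrite -[X in `|X|](subKr (a j s)) (le_trans (ler_normB _ _)).
    by rewrite lerD2l (le_trans h).
  rewrite RintegralD// RintegralZl//; last exact: integrable_norm01.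
  rewrite RintegralZl//; last exact: integrable_norm01.
  have h1 := agb j; have h2 := Ia0 j.
  rewrite -/(Ib j).
  have : 2 * (Ia j + 1) * I01 (fun t => `|b j t - gb j t|) <= 2 * (Ia j + 1) * e.
    by rewrite ler_wpM2l//; lra.
  move: (I01 (fun t => `|b j t - gb j t|)) => X hX.
  by move: hX h2; generalize (Ia j) (Ib j); clear; move=> u v; lra.
have csg : continuous (fun t => Num.sqrt (\sum_(j < n) (ga j t ^+ 2 + gb j t ^+ 2) + e ^+ 2)).
  by cont.
have isg := integrable_continuous 0 1 csg.
have LLh : Lh <= L + K * e.
  have ida j := integrable_norm01 (integrable_sub01 (inta j) (iga j)).
  have idb j := integrable_norm01 (integrable_sub01 (intb j) (igb j)).
  have [i1 E1] := Rintegral_sum01 (index_enum 'I_n) (fun j => integrable_EFinD m01 (ida j) (idb j)).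
  have i2 : int01 (fun _ => e) by apply: integrable_continuous; cont.
  have i3 := integrable_EFinD m01 int_s i1.
  have i4 := integrable_EFinD m01 i3 i2.
  apply: (@le_trans _ _ (I01 (fun t => Num.sqrt (\sum_(j < n) (a j t ^+ 2 + b j t ^+ 2))
     + \sum_(j < n) (`|a j t - ga j t| + `|b j t - gb j t|) + e))).
    apply: le_Rintegral => // t _.
    have := @sqrt_sum_perturb _ (fun i : 'I_n + 'I_n => match i with inl j => a j t | inr j => b j t end)
      (fun i : 'I_n + 'I_n => match i with inl j => ga j t | inr j => gb j t end) e (ltW e0).
    by rewrite !big_sumType/= -!big_split/=.
  rewrite RintegralD// RintegralD// E1 Rintegral01_cst -/L -addrA lerD2l.
  rewrite /K mulrDl mul1r lerD2r.
  apply: (@le_trans _ _ (\sum_(j < n) (2 * e))); last by rewrite sumr_const card_ord -mulr_natl; lra.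
  apply: ler_sum => j _; rewrite RintegralD//.
  have -> : 2 * e = e + e by ring.
  by apply: lerD; [exact: aga|exact: agb].
have Lh0 : 0 < Lh.
  apply: (@lt_le_trans _ _ e) => //.
  rewrite -[leLHS]Rintegral01_cst.
  apply: le_Rintegral => //; first by apply: integrable_continuous; cont.
  move=> t _; rewrite -[leLHS]ger0_norm ?(ltW e0)// -sqrtr_sqr ler_wsqrtr// lerDr sumr_ge0// => j _.
  by rewrite addr_ge0 ?sqr_ge0.
have H : 2 * pi * Ph <= Lh ^+ 2.
  have [Ph0|Ph0] := leP Ph 0.
    by apply: (@le_trans _ _ 0); rewrite ?sqr_ge0// mulr_ge0_le0// mulr_ge0// ltW.
  rewrite leNgt; apply/negP => Hlt.
  have [ka [ka0 kaL kaP]] := curvature_between Lh0 Ph0 Hlt.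
  have := dido_continuous e0 ka0 cga cgb kaL; rewrite -/Lh -/(Ph).
  by rewrite leNgt -mulrA mulrCA kaP.
apply: (@le_trans _ _ (2 * pi * Ph)).
  by rewrite ler_wpM2l// mulr_ge0// ltW.
rewrite (le_trans H)// ler_sqr ?nnegrE ?(ltW Lh0)//.
by rewrite addr_ge0// mulr_ge0// ltW.
Qed.

End dido_L1.

(** * The distance when x' = - x *)

Section ccdist_antipodal.
Context (R : realType).
Local Notation mu := (@lebesgue_measure R).
Local Notation I01 f := (\int[mu]_(t in `[0%R, 1%R]) (f t))%R.
Local Notation int01 f := (mu.-integrable `[0%R, 1%R] (EFin \o f)).
Local Notation prim f t := ((\int[mu]_(s in `[0%R, t]) f s)%R - 2^-1 * I01 f).

Lemma enorm_sqr_dotp n (x : 'rV[R]_n) : enorm x ^+ 2 = dotp x x.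
Proof. by rewrite sqr_sqrtr//; apply: sumr_ge0 => i _; rewrite -expr2 sqr_ge0. Qed.

Lemma enorm_sqr n (x : 'rV[R]_n) : enorm x ^+ 2 = \sum_(i < n) x 0 i ^+ 2.
Proof. by rewrite enorm_sqr_dotp; apply: eq_bigr => i _; rewrite expr2. Qed.

(** Projecting [b] onto the unit vector [w] pointing from [u] to [u'] does not lengthen the curve
    and leaves a single vertical displacement [r], an area in the sense of [dido_L1]. The end
    conditions [x] and [- x] are exactly the normalisation of [prim]. *)
Lemma cc_length_ge n m (x : 'rV[R]_n) (u u' : 'rV[R]_m) X U a b :
  0 < enorm (u - u') -> horizontal X U a b ->
  (X 0, U 0) = (x, u) -> (X 1, U 1) = (- x, u') ->
  Num.sqrt (2 * pi * enorm (u - u')) <= cc_length a b.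
Proof.
set r := enorm (u - u') => r0 [inta intb HX HU] [X0 U0] [X1 U1].
have m01 : measurable (`[0%R, 1%R]%classic : set (measurableTypeR R)) by exact: measurable_itv.
have XE t j : 0 <= t <= 1 -> X t 0 j = prim (fun s => a s 0 j) t.
  move=> t01; have t1 := introT andP (conj (@ler01 R) (lexx (1 : R))).
  have := HX 1 t1 j; rewrite (HX t t01 j) X0 X1 mxE => h.
  have hI : I01 (fun s => a s 0 j) = - x 0 j - x 0 j by rewrite {1}h addrC addKr.
  rewrite hI; have -> : 2^-1 * (- x 0 j - x 0 j) = - x 0 j by field.
  by rewrite opprK addrC.
pose w k := (u' 0 k - u 0 k) / r.
have r2 : r ^+ 2 = \sum_(k < m) (u' 0 k - u 0 k) ^+ 2.
  by rewrite enorm_sqr; apply: eq_bigr => k _; rewrite !mxE -sqrrN opprB.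
have w1 : \sum_(k < m) w k ^+ 2 = 1.
  under eq_bigr => k _ do rewrite /w expr_div_n.
  by rewrite -mulr_suml -r2 divff// expf_neq0// gt_eqF.
have rw : r = \sum_(k < m) w k * (u' 0 k - u 0 k).
  under eq_bigr => k _ do rewrite /w mulrAC -expr2.
  by rewrite -mulr_suml -r2 expr2 mulfK// gt_eqF.
pose be j t := \sum_(k < m) w k * b t j k.
have intbe j : int01 (be j).
  have [H _] := Rintegral_sum01 (index_enum 'I_m) (fun k => integrable_EFinZ m01 (w k) (intb j k)).
  exact: H.
have rE : r = I01 (fun t => \sum_(j < n) prim (fun s => a s 0 j) t * be j t).
  have iP (j : 'I_n) (k : 'I_m) := integrable_prim_mul (inta j) (intb j k).
  have iPb (j : 'I_n) := integrable_prim_mul (inta j) (intbe j).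
  have [_ ->] := Rintegral_sum01 (index_enum 'I_n) iPb.
  transitivity (\sum_(j < n) \sum_(k < m) w k * I01 (fun t => prim (fun s => a s 0 j) t * b t j k)).
    rewrite [LHS]rw exchange_big/=; apply: eq_bigr => k _.
    have t1 := introT andP (conj (@ler01 R) (lexx (1 : R))).
    have := HU 1 t1 k; rewrite U0 U1 => ->.
    rewrite -mulr_sumr addrC addKr; congr (_ * _).
    have [_ <-] := Rintegral_sum01 (index_enum 'I_n) (fun j => iP j k).
    apply: eq_Rintegral => s; rewrite inE/= in_itv/= => s01.
    by apply: eq_bigr => j _; rewrite XE.
  apply: eq_bigr => j _.
  have [_ H] := Rintegral_sum01 (index_enum 'I_m) (fun k => integrable_EFinZ m01 (w k) (iP j k)).
  transitivity (I01 (fun t => \sum_(k < m) w k * (prim (fun s => a s 0 j) t * b t j k))).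
    by rewrite H; apply: eq_bigr => k _; rewrite RintegralZl//; exact: iP.
  by apply: eq_Rintegral => t _; rewrite /be mulr_sumr; apply: eq_bigr => k _; rewrite mulrCA.
have := dido_L1 inta intbe; rewrite -rE => H.
pose L1 := I01 (fun t => Num.sqrt (\sum_(j < n) (a t 0 j ^+ 2 + be j t ^+ 2))); rewrite -/L1 in H.
have LL : L1 <= cc_length a b.
  apply: le_Rintegral => //.
  - have -> : (fun t => Num.sqrt (\sum_(j < n) (a t 0 j ^+ 2 + be j t ^+ 2))) =
      (fun t => Num.sqrt (\sum_(i : 'I_n + 'I_n) (match i with inl j => fun t => a t 0 j | inr j => be j end) t ^+ 2)).
      by apply/funext => t; rewrite big_sumType/= -big_split.
    by apply: (@integrable_sqrt_sum _ _ (fun i => match i with inl j => fun t => a t 0 j | inr j => be j end)); case=> j; [exact: inta|exact: intbe].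
  - have -> : (fun t => Num.sqrt (\sum_(j < n) (a t 0 j ^+ 2 + \sum_(k < m) b t j k ^+ 2))) =
      (fun t => Num.sqrt (\sum_(i : 'I_n + 'I_n * 'I_m) (match i with inl j => fun t => a t 0 j | inr p => fun t => b t p.1 p.2 end) t ^+ 2)).
      by apply/funext => t; rewrite big_sumType/= big_split/= pair_bigA.
    by apply: (@integrable_sqrt_sum _ _ (fun i => match i with inl j => fun t => a t 0 j | inr p => fun t => b t p.1 p.2 end)); case=> j; [exact: inta|exact: intb].
  move=> t _; rewrite ler_wsqrtr//; apply: ler_sum => j _; rewrite lerD2l.
  by have := sqr_sum_le_mul w (b t j); rewrite w1 mul1r.
have L10 : 0 <= L1 by apply: Rintegral_ge0 => t _; exact: sqrtr_ge0.
by rewrite (le_trans _ LL)// -[leRHS]ger0_norm// -sqrtr_sqr ler_wsqrtr.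
Qed.

(** The half ellipse [x cos (pi t) + y sin (pi t)], lifted in the direction [w], has constant
    squared speed [pi^2 (|x|^2 + |y|^2)]. The vector [y] need not be orthogonal to [x], which could
    fail for [n = 1]: the cross term cancels in the speed, and in the height it is a multiple of
    [sin (pi t)^2], zero at both ends. *)
Lemma cc_length_attained n m (x : 'rV[R]_n) (u u' : 'rV[R]_m) : (0 < n)%N ->
  0 < enorm (u - u') -> pi * enorm x ^+ 2 <= 2 * enorm (u - u') ->
  exists X U a b, [/\ horizontal X U a b, (X 0, U 0) = (x, u), (X 1, U 1) = (- x, u') &
    Num.sqrt (2 * pi * enorm (u - u')) = cc_length a b].
Proof.
set r := enorm (u - u') => n0 r0 xr.
have p0 := pi_gt0 R.
(* The value of [|y|^2] for which the height gained, [pi (|x|^2 + q) / 2], equals [r]. *)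
pose q := (2 * r - pi * enorm x ^+ 2) / pi.
have q0 : 0 <= q by rewrite divr_ge0 ?subr_ge0// ltW.
pose i0 := Ordinal n0.
pose y j : R := if j == i0 then Num.sqrt q else 0.
have y2 : \sum_(j < n) y j ^+ 2 = q.
  rewrite (bigD1 i0)//= /y eqxx sqr_sqrtr// big1 ?addr0// => j ji.
  by rewrite (negbTE ji) expr0n.
pose w k := (u' 0 k - u 0 k) / r.
have r2 : r ^+ 2 = \sum_(k < m) (u' 0 k - u 0 k) ^+ 2.
  by rewrite enorm_sqr; apply: eq_bigr => k _; rewrite !mxE -sqrrN opprB.
have w1 : \sum_(k < m) w k ^+ 2 = 1.
  under eq_bigr => k _ do rewrite /w expr_div_n.
  by rewrite -mulr_suml -r2 divff// expf_neq0// gt_eqF.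
pose X j t : R := x 0 j * cos (pi * t) + y j * sin (pi * t).
pose A j t : R := pi * (- x 0 j * sin (pi * t) + y j * cos (pi * t)).
pose B j k t : R := pi * X j t * w k.
pose d := \sum_(j < n) x 0 j * y j.
have dX j (t : R) : is_derive t (1 : R) (X j) (A j t).
  by rewrite /X; eapply is_derive_subst; [der|rewrite /A; ring].
have cX j : continuous (X j) by exact: continuous_is_derive (dX j).
have cA j : continuous (A j) by rewrite /A; cont.
have cB j k : continuous (B j k) by rewrite /B; cont.
have X2 t : \sum_(j < n) X j t ^+ 2 = enorm x ^+ 2 * cos (pi * t) ^+ 2 + 2 * d * (sin (pi * t) * cos (pi * t)) + q * sin (pi * t) ^+ 2.
  rewrite enorm_sqr -y2 /d mulr_sumr !mulr_suml -!big_split/=.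
  by apply: eq_bigr => j _; rewrite /X; ring.
have A2 t : \sum_(j < n) A j t ^+ 2 = pi ^+ 2 * (enorm x ^+ 2 * sin (pi * t) ^+ 2 - 2 * d * (sin (pi * t) * cos (pi * t)) + q * cos (pi * t) ^+ 2).
  transitivity (pi ^+ 2 * ((\sum_(j < n) x 0 j ^+ 2) * sin (pi * t) ^+ 2 +
      (\sum_(j < n) - (2 * (x 0 j * y j))) * (sin (pi * t) * cos (pi * t)) + (\sum_(j < n) y j ^+ 2) * cos (pi * t) ^+ 2)).
    rewrite !mulr_suml -!big_split/= mulr_sumr.
    by apply: eq_bigr => j _; rewrite /A; ring.
  by rewrite enorm_sqr y2 sumrN -mulr_sumr -/d; ring.
pose U k t : R := u 0 k + (\int[mu]_(s in `[0%R, t]) (\sum_(j < n) X j s * B j k s))%R.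
exists (fun t => \row_j X j t), (fun t => \row_k U k t), (fun t => \row_j A j t),
  (fun t => \matrix_(j, k) B j k t).
have U0 : (\row_k U k 0) = u.
  by apply/rowP => k; rewrite mxE /U set_itv1 Rintegral_set1 addr0.
split.
- split.
  + move=> j; have := integrable_continuous 0 1 (cA j).
    by apply: eq_integrable => // t _ /=; rewrite mxE.
  + move=> j k; have := integrable_continuous 0 1 (cB j k).
    by apply: eq_integrable => // t _ /=; rewrite mxE.
  + move=> t /andP[t0 _] j; rewrite !mxE.
    rewrite (_ : (\int[mu]_(s in `[0%R, t]) _)%R = X j t - X j 0); first by ring.
    rewrite -(Rintegral_FTC t0 (dX j) (cA j)).
    by apply: eq_Rintegral => s _; rewrite mxE.
  + move=> t /andP[t0 _] k; rewrite U0 mxE /U; congr (_ + _).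
    by apply: eq_Rintegral => s _; apply: eq_bigr => j _; rewrite !mxE.
- rewrite U0; congr (_, _); apply/rowP => j; rewrite mxE /X mulr0 cos0 sin0; ring.
- congr (_, _).
    by apply/rowP => j; rewrite !mxE /X mulr1 cospi sinpi; ring.
  apply/rowP => k; rewrite mxE /U.
  pose F t : R := w k * (enorm x ^+ 2 / 2 * (pi * t + sin (pi * t) * cos (pi * t)) + d * sin (pi * t) ^+ 2
     + q / 2 * (pi * t - sin (pi * t) * cos (pi * t))).
  pose f s : R := pi * w k * \sum_(j < n) X j s ^+ 2.
  have dF (t : R) : is_derive t (1 : R) F (f t).
    rewrite /F; eapply is_derive_subst; first by der.
    rewrite /f X2 /=.
    have : cos (pi * t) ^+ 2 + sin (pi * t) ^+ 2 = 1 by exact: cos2Dsin2.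
    move: (cos (pi * t)) (sin (pi * t)) => c s cs; move: (pi : R) (enorm x) => p e.
    apply/eqP; rewrite -subr_eq0; apply/eqP.
    transitivity (w k * p * (e ^+ 2 / 2 + q / 2) * (1 - (c ^+ 2 + s ^+ 2))); first by field.
    by rewrite cs subrr mulr0.
  have cf : continuous f by rewrite /f; cont.
  rewrite (_ : (\int[mu]_(s in `[0%R, 1%R]) _)%R = F 1 - F 0); last first.
    rewrite -(Rintegral_FTC ler01 dF cf); apply: eq_Rintegral => s _.
    by rewrite /f mulr_sumr; apply: eq_bigr => j _; rewrite /B; ring.
  rewrite /F mulr1 mulr0 sinpi sin0 /q /w.
  have : r != 0 by rewrite gt_eqF.
  have : (pi : R) != 0 by rewrite gt_eqF.
  by generalize (@pi R) (enorm x) r (u' 0 k) (u 0 k) (cos (@pi R)) (cos (0 : R)) => p e z a b c1 c2 p1 z1; field; rewrite p1 z1.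
- rewrite /cc_length -[LHS]Rintegral01_cst; apply: eq_Rintegral => t _; congr Num.sqrt.
  rewrite (_ : \sum_(j < n) _ = \sum_(j < n) A j t ^+ 2 + \sum_(j < n) (pi ^+ 2 * X j t ^+ 2)); last first.
    rewrite -big_split/=; apply: eq_bigr => j _; rewrite !mxE; congr (_ + _).
    transitivity (\sum_(k < m) (pi * X j t) ^+ 2 * w k ^+ 2).
      by apply: eq_bigr => k _; rewrite !mxE /B exprMn.
    by rewrite -mulr_sumr w1 mulr1 exprMn.
  rewrite -mulr_sumr A2 X2.
  transitivity (pi ^+ 2 * (enorm x ^+ 2 + q) * (cos (pi * t) ^+ 2 + sin (pi * t) ^+ 2)); last by ring.
  rewrite cos2Dsin2 mulr1 /q.
  have : (pi : R) != 0 by rewrite gt_eqF.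
  by generalize (@pi R) (enorm x) r => p e z p1; field.
Qed.

Lemma ccdist_antipodal n m (x : 'rV[R]_n) (u u' : 'rV[R]_m) : (0 < n)%N ->
  0 < enorm (u - u') -> pi * enorm x ^+ 2 <= 2 * enorm (u - u') ->
  ccdist (x, u) (- x, u') ^+ 2 = 2 * pi * enorm (u - u').
Proof.
move=> n0 r0 xr.
have [X [U [a [b [H1 H2 H3 H4]]]]] := cc_length_attained n0 r0 xr.
rewrite -[RHS]sqr_sqrtr; last by rewrite mulr_ge0 ?ltW// mulr_gt0// pi_gt0.
congr (_ ^+ 2); apply/eqP; rewrite eq_le; apply/andP; split.
  apply: ge_inf; last by exists X, U, a, b.
  exists 0 => _ [X' [U' [a' [b' [h1 h2 h3 ->]]]]].
  by apply: Rintegral_ge0 => t _; exact: sqrtr_ge0.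
apply: lb_le_inf; first by exists (cc_length a b), X, U, a, b.
by move=> _ [X' [U' [a' [b' [h1 h2 h3 ->]]]]]; exact: cc_length_ge h1 h2 h3.
Qed.

End ccdist_antipodal.

(** * Comparison with the linearised kernel *)

Section saddle_kernel.
Context (R : realType).
Implicit Types (p r a h k T X Y L Q v : R).

(** [X] is an argument of its own because in the linearised kernel it is no longer
    [r - 4 * pi * T]. *)
Definition saddle_kernel (m : nat) h T X : R :=
  (Num.sqrt T)^-1 ^+ m * expR (- (X ^+ 2 / (16 * h * T))).

Lemma saddle_kernel_ge0 m h T X : 0 <= saddle_kernel m h T X.
Proof. by rewrite mulr_ge0 ?expR_ge0// exprn_ge0// invr_ge0 sqrtr_ge0. Qed.

Lemma exprn_le_exp (m : nat) (z : R) : 0 <= z -> z ^+ m <= m`!%:R * expR z.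
Proof.
move=> z0; have f0 : (0 : R) < m`!%:R by rewrite ltr0n fact_gt0.
rewrite -ler_pdivrMl// mulrC; case: m f0 => [|m] f0.
  by rewrite expr0 fact0 divr1 -expR0 ler_expR.
by apply: le_trans (expR_ge1Dxn m z0); rewrite lerDr.
Qed.

Lemma exprn_gauss_le (m : nat) (ka z : R) : 0 < ka -> 0 <= z ->
  z ^+ m * expR (- (ka * z ^+ 2)) <= m`!%:R * expR (ka^-1 / 4).
Proof.
move=> ka0 z0.
apply: (@le_trans _ _ (m`!%:R * expR z * expR (- (ka * z ^+ 2)))).
  by rewrite ler_wpM2r ?expR_ge0// exprn_le_exp.
rewrite -mulrA -expRD ler_wpM2l// ler_expR.
rewrite -subr_ge0 (_ : _ - _ = ka * (z - (2 * ka)^-1) ^+ 2); last by field; rewrite gt_eqF.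
by rewrite mulr_ge0 ?sqr_ge0 ?ltW.
Qed.

Lemma saddle_phase p r T : 0 < T ->
  (r - 4 * p * T) ^+ 2 / (16 * T) = r ^+ 2 / 16 * (Num.sqrt T)^-1 ^+ 2 - p * r / 2 + p ^+ 2 * T.
Proof.
by move=> T0; rewrite exprVn sqr_sqrtr ?ltW//; field; rewrite gt_eqF.
Qed.

Lemma saddle_phase_ge_lin p r T : 0 < T ->
  p ^+ 2 * T - p * r / 2 <= (r - 4 * p * T) ^+ 2 / (16 * T).
Proof.
move=> T0; rewrite saddle_phase//.
have : 0 <= r ^+ 2 / 16 * (Num.sqrt T)^-1 ^+ 2 by rewrite mulr_ge0 ?sqr_ge0// divr_ge0 ?sqr_ge0.
move: (_ * _ ^+ 2) (p * r) (p ^+ 2 * T) => x y z; lra.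
Qed.

(** The part [r^2 / (16 T)] of the phase beats the singularity of [T^(- m / 2)] at 0, which needs
    [0 < r]; the cross term of the square costs the constant [expR (p * r / 2)]. *)
Lemma saddle_prefactor_le m p r T : 0 < r -> 0 < T -> 0 <= p ->
  (Num.sqrt T)^-1 ^+ m * expR (- ((r - 4 * p * T) ^+ 2 / (16 * T))) <=
  m`!%:R * expR ((r ^+ 2 / 16)^-1 / 4) * expR (p * r / 2).
Proof.
move=> r0 T0 p0; rewrite saddle_phase//.
have z0 : 0 <= (Num.sqrt T)^-1 by rewrite invr_ge0 sqrtr_ge0.
have r16 : 0 < r ^+ 2 / 16 by rewrite divr_gt0// exprn_gt0.
apply: le_trans (ler_wpM2r (expR_ge0 _) (exprn_gauss_le m r16 z0)).
rewrite -[leRHS]mulrA -expRD ler_wpM2l ?exprn_ge0// ler_expR.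
have : 0 <= p ^+ 2 * T by rewrite mulr_ge0 ?sqr_ge0 ?ltW.
move: (_ * _ ^+ 2) (p * r) (p ^+ 2 * T) => x y z; lra.
Qed.

(** With [Y = 4 p T]: for [Y <= r + 1] the denominator is bounded, and beyond that [Y - r >= 1], so
    that the square [(Y - r)^2 (r + 1)] dominates [Y]. *)
Lemma saddle_phase_far p r T (d : R) : 1 <= p -> 0 < r -> 0 < T -> 0 < d <= 1 ->
  d <= `|r - 4 * p * T| -> d ^+ 2 / (4 * (r + 1)) <= (r - 4 * p * T) ^+ 2 / (16 * T).
Proof.
move=> p1 r0 T0 /andP[d0 d1] dX.
set Y := 4 * p * T in dX *.
have Y0 : 0 < Y by rewrite !mulr_gt0//; lra.
have d2 : d ^+ 2 <= (r - Y) ^+ 2 by rewrite -[leRHS]real_normK ?num_real// ler_pXn2r ?nnegrE ?normr_ge0// ltW.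
have -> : 16 * T = 4 * Y / p by rewrite /Y; field; rewrite gt_eqF//; lra.
rewrite ler_pdivrMr; last lra.
have -> : (r - Y) ^+ 2 / (4 * Y / p) * (4 * (r + 1)) = p * ((r - Y) ^+ 2 * (r + 1)) / Y.
  by field; rewrite ?gt_eqF//; lra.
rewrite ler_pdivlMr//.
apply: (@le_trans _ _ (1 * ((r - Y) ^+ 2 * (r + 1)))); last first.
  by rewrite ler_wpM2r// mulr_ge0 ?sqr_ge0//; lra.
rewrite mul1r; have [Yr|Yr] := leP Y (r + 1).
  by apply: ler_pM => //; [exact: sqr_ge0|exact: ltW].
have d21 : d ^+ 2 <= 1 by rewrite expr_le1// ltW.
apply: (@le_trans _ _ Y); first by rewrite ler_piMl// ltW.
have : 1 <= Y - r by lra.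
have [t tE] : exists t, Y - r = t by exists (Y - r).
rewrite tE => t1.
have -> : (r - Y) ^+ 2 = t ^+ 2 by rewrite -tE; ring.
have -> : Y = t + r by rewrite -tE; ring.
have t2 : t <= t ^+ 2 by nra.
have : r <= t ^+ 2 * r by nra.
lra.
Qed.

(** Up to constants, replacing [T0] by [T] changes the exponent by [X^2 |T0 - T| / h], of order
    [k^(12 + 7 - 16) = k^3], and shifting [X] by [q] changes it by order [k^(14 + 6 - 16) = k^4];
    both are below [k^2 = h^(1/8)]. *)
Lemma saddle_exponent_close (M tau k T T0 X q : R) : 1 <= M -> 0 < tau -> 0 < k <= 1 ->
  tau <= T -> tau <= T0 -> `|X| <= M * k ^+ 6 -> `|T - T0| <= M * k ^+ 7 -> 0 <= q <= k ^+ 14 ->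
  `|(X - q) ^+ 2 / (16 * k ^+ 16 * T) - X ^+ 2 / (16 * k ^+ 16 * T0)| <=
  (M ^+ 3 / tau ^+ 2 + 3 * M / tau) * k ^+ 2.
Proof.
move=> M1 tau0 /andP[k0 k1] tT tT0 XM TM /andP[q0 qk].
have T_0 : 0 < T by lra.
have T0_0 : 0 < T0 by lra.
have kn j : 0 < k ^+ j by exact: exprn_gt0.
have -> : (X - q) ^+ 2 / (16 * k ^+ 16 * T) - X ^+ 2 / (16 * k ^+ 16 * T0) =
  X ^+ 2 * (T0 - T) / (16 * k ^+ 16 * T * T0) + q * (q - 2 * X) / (16 * k ^+ 16 * T).
  by field; rewrite !gt_eqF.
have X2 : X ^+ 2 <= M ^+ 2 * k ^+ 12.
  rewrite -real_normK ?num_real// (_ : M ^+ 2 * k ^+ 12 = (M * k ^+ 6) ^+ 2); last by ring.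
  by rewrite ler_pXn2r ?nnegrE ?normr_ge0// mulr_ge0 ?ltW//; lra.
rewrite [leRHS]mulrDl; apply: (le_trans (ler_normD _ _)); apply: lerD.
  rewrite normrM normrV ?unitfE ?mulf_neq0 ?gt_eqF// normrM ger0_norm ?sqr_ge0// [`|T0 - T|]distrC.
  rewrite (gtr0_norm (_ : 0 < 16 * k ^+ 16 * T * T0)) ?mulr_gt0//.
  rewrite ler_pdivrMr ?mulr_gt0//.
  apply: (@le_trans _ _ (M ^+ 2 * k ^+ 12 * (M * k ^+ 7))); first by rewrite ler_pM ?sqr_ge0.
  apply: (@le_trans _ _ (M ^+ 3 / tau ^+ 2 * k ^+ 2 * (16 * k ^+ 16 * tau * tau))); last first.
    apply: ler_wpM2l; first by rewrite !mulr_ge0 ?invr_ge0 ?exprn_ge0 ?ltW//; lra.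
    have k16 := ltW (kn 16); have tau0' := ltW tau0.
    have kk : 0 <= 16 * k ^+ 16 by rewrite mulr_ge0.
    by apply: ler_pM => //; [exact: mulr_ge0|exact: ler_wpM2l].
  have -> : M ^+ 3 / tau ^+ 2 * k ^+ 2 * (16 * k ^+ 16 * tau * tau) = M ^+ 3 * (16 * k ^+ 18) by field; rewrite gt_eqF.
  have -> : M ^+ 2 * k ^+ 12 * (M * k ^+ 7) = M ^+ 3 * (k * k ^+ 18) by ring.
  by rewrite ler_wpM2l ?exprn_ge0 ?ler_wpM2r ?ltW//; lra.
rewrite normrM normrV ?unitfE ?mulf_neq0 ?gt_eqF// normrM ger0_norm//.
rewrite (gtr0_norm (_ : 0 < 16 * k ^+ 16 * T)) ?mulr_gt0//.
rewrite ler_pdivrMr ?mulr_gt0//.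
have k14 : k ^+ 14 <= k ^+ 6 by rewrite ler_wiXn2l// ltW.
have Q2 : `|q - 2 * X| <= 3 * M * k ^+ 6.
  rewrite (le_trans (ler_normB _ _))// normrM normr_nat (ger0_norm q0).
  have : k ^+ 6 <= M * k ^+ 6 by rewrite ler_peMl// ltW.
  move: XM qk k14; move: (M * k ^+ 6) (k ^+ 6) (k ^+ 14) (`|X|) => u1 u2 u3 u4 *; lra.
apply: (@le_trans _ _ (k ^+ 14 * (3 * M * k ^+ 6))); first by rewrite ler_pM.
apply: (@le_trans _ _ (3 * M / tau * k ^+ 2 * (16 * k ^+ 16 * tau))); last first.
  apply: ler_wpM2l; first by rewrite !mulr_ge0 ?invr_ge0 ?exprn_ge0 ?ltW//; lra.
  by apply: ler_wpM2l => //; rewrite mulr_ge0// ltW.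
have -> : 3 * M / tau * k ^+ 2 * (16 * k ^+ 16 * tau) = 3 * M * (16 * k ^+ 18) by field; rewrite gt_eqF.
have -> : k ^+ 14 * (3 * M * k ^+ 6) = 3 * M * (k ^+ 2 * k ^+ 18) by ring.
rewrite ler_wpM2l//; first by lra.
apply: ler_wpM2r; first exact: ltW.
by apply: (@le_trans _ _ 1); [rewrite exprn_ile1// ltW|rewrite ler1n].
Qed.

Lemma invsqrt_le_exp (T T0 e : R) m : 0 < T -> 0 < T0 -> 0 <= e -> T0 - T <= e * T ->
  (Num.sqrt T)^-1 ^+ m <= expR (m%:R * e) * (Num.sqrt T0)^-1 ^+ m.
Proof.
move=> T_0 T0_0 e0 H.
rewrite expRM_natl -exprMn; apply: lerXn2r; rewrite ?nnegrE ?invr_ge0 ?sqrtr_ge0//.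
rewrite -[leLHS]mul1r ler_pdivrMr ?sqrtr_gt0// mulrAC ler_pdivlMr ?sqrtr_gt0// mul1r.
have E : expR e = Num.sqrt (expR e ^+ 2) by rewrite sqrtr_sqr ger0_norm ?expR_ge0.
rewrite E -sqrtrM ?sqr_ge0// ler_wsqrtr//.
apply: (@le_trans _ _ ((1 + e) * T)); first lra.
apply: ler_wpM2r; first exact: ltW.
have := expR_ge1Dx e.
move: (expR e) => x xe; nra.
Qed.

Lemma saddle_kernel_close (M tau k T T0 X q : R) m : 1 <= M -> 0 < tau -> 0 < k <= 1 ->
  tau <= T -> tau <= T0 -> `|X| <= M * k ^+ 6 -> `|T - T0| <= M * k ^+ 7 -> 0 <= q <= k ^+ 14 ->
  let C := m%:R * (M / tau) + (M ^+ 3 / tau ^+ 2 + 3 * M / tau) in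
  saddle_kernel m (k ^+ 16) T (X - q) <= expR (C * k ^+ 2) * saddle_kernel m (k ^+ 16) T0 X /\
  saddle_kernel m (k ^+ 16) T0 X <= expR (C * k ^+ 2) * saddle_kernel m (k ^+ 16) T (X - q).
Proof.
move=> M1 tau0 k01 tT tT0 XM TM qk C.
have := saddle_exponent_close M1 tau0 k01 tT tT0 XM TM qk.
move/andP: k01 => [k0 k1]; rewrite ler_norml => /andP[E1 E2].
have k7 : k ^+ 7 <= k ^+ 2 by rewrite ler_wiXn2l// ltW.
have e0 : 0 <= M / tau * k ^+ 2 by rewrite mulr_ge0 ?divr_ge0 ?exprn_ge0 ?ltW//; lra.
have H t : tau <= t -> M * k ^+ 7 <= M / tau * k ^+ 2 * t.
  move=> tt; have -> : M / tau * k ^+ 2 * t = M * (k ^+ 2 * (t / tau)) by field; rewrite gt_eqF.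
  rewrite ler_wpM2l//; first lra.
  by rewrite (le_trans k7)// ler_peMr// ?exprn_ge0 ?(ltW k0)// ler_pdivlMr// mul1r.
move: TM; rewrite ler_norml => /andP[t1 t2].
have S1 : (Num.sqrt T)^-1 ^+ m <= expR (m%:R * (M / tau * k ^+ 2)) * (Num.sqrt T0)^-1 ^+ m.
  apply: invsqrt_le_exp => //; try lra.
  by have := H _ tT; lra.
have S2 : (Num.sqrt T0)^-1 ^+ m <= expR (m%:R * (M / tau * k ^+ 2)) * (Num.sqrt T)^-1 ^+ m.
  apply: invsqrt_le_exp => //; try lra.
  by have := H _ tT0; lra.
have CE : C * k ^+ 2 = m%:R * (M / tau * k ^+ 2) + (M ^+ 3 / tau ^+ 2 + 3 * M / tau) * k ^+ 2 by rewrite /C; ring.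
rewrite /saddle_kernel CE expRD; set a1 := expR (m%:R * _) in S1 S2 *.
split.
  apply: (@le_trans _ _ (a1 * (Num.sqrt T0)^-1 ^+ m * expR (- ((X - q) ^+ 2 / (16 * k ^+ 16 * T))))).
    by rewrite ler_wpM2r ?expR_ge0.
  rewrite [leRHS]mulrACA; apply: ler_wpM2l.
    by rewrite mulr_ge0 ?expR_ge0// exprn_ge0// invr_ge0 sqrtr_ge0.
  by rewrite -expRD ler_expR; lra.
apply: (@le_trans _ _ (a1 * (Num.sqrt T)^-1 ^+ m * expR (- (X ^+ 2 / (16 * k ^+ 16 * T0))))).
  by rewrite ler_wpM2r ?expR_ge0.
rewrite [leRHS]mulrACA; apply: ler_wpM2l.
  by rewrite mulr_ge0 ?expR_ge0// exprn_ge0// invr_ge0 sqrtr_ge0.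
by rewrite -expRD ler_expR; lra.
Qed.

(* The phase is used three times: part of it absorbs the singular prefactor, a second part gives
   the decay in [v], and the rest the factor [expR (- (be / (2 * h)))]. *)
Lemma saddle_kernel_decay m p r : 2 <= p -> 0 < r -> exists2 C, 0 < C &
  forall h v T X be, 0 < h -> h <= 1 / 4 -> 0 < T -> v / (2 * p ^+ 2) <= T -> X = r - 4 * p * T ->
    be <= (r - 4 * p * T) ^+ 2 / (16 * T) ->
    saddle_kernel m h T X <= C * expR (- (v / 2)) * expR (- (be / (2 * h))).
Proof.
move=> p2 r0; exists (m`!%:R * expR ((r ^+ 2 / 16)^-1 / 4) * expR (p * r / 2) * expR (p * r / 2)).
  by rewrite !mulr_gt0 ?expR_gt0// ltr0n fact_gt0.
move=> h v T X be h0 h1 T0 vT -> beT.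
have p0 : 0 < p by lra.
have lin := saddle_phase_ge_lin p r T0.
have pre := saddle_prefactor_le m r0 T0 (ltW p0).
rewrite /saddle_kernel.
have -> : (r - 4 * p * T) ^+ 2 / (16 * h * T) = (r - 4 * p * T) ^+ 2 / (16 * T) / h by field; rewrite !gt_eqF.
move: beT lin pre; set ps := _ / (16 * T) => beT lin pre.
have ps0 : 0 <= ps by rewrite divr_ge0 ?sqr_ge0// mulr_ge0// ltW.
have hi : 4 <= h^-1 by rewrite -[leLHS]invrK lef_pV2 ?posrE ?invr_gt0//; lra.
apply: (@le_trans _ _ ((Num.sqrt T)^-1 ^+ m * (expR (- ps) * (expR (- ps) * expR (- (be / (2 * h))))))).
  rewrite ler_wpM2l ?exprn_ge0 ?invr_ge0 ?sqrtr_ge0// -!expRD ler_expR.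
  have -> : be / (2 * h) = be * (h^-1 / 2) by field; rewrite gt_eqF.
  move: hi; move: (h^-1) => y hi; nra.
set K := m`!%:R * _ * _ in pre *; set E := expR (- (be / _)).
apply: (@le_trans _ _ (K * (expR (p * r / 2) * expR (- (v / 2)) * E))); last by rewrite !mulrA.
rewrite [leLHS]mulrA; apply: ler_pM => //; rewrite ?mulr_ge0 ?exprn_ge0 ?invr_ge0 ?sqrtr_ge0 ?expR_ge0//.
apply: ler_wpM2r; first exact: expR_ge0.
rewrite -expRD ler_expR.
have : v / 2 <= p ^+ 2 * T by rewrite -ler_pdivrMl ?exprn_gt0//; move: vT; congr (_ <= _); field; rewrite gt_eqF.
lra.
Qed.

(** From [(c - l)^2 >= c^2 / 8 - l^2 / 7]: the linear term in y is removed by widening the Gaussian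
    from [h] to [8 h]. The price [2 Q / 7] has to stay below the allowance [Q / 2] in
    [saddle_pointwise]. *)
Lemma saddle_kernel_square m h T (c l : R) Q : 0 < h -> 0 < T -> l ^+ 2 <= 32 * h * T * Q ->
  saddle_kernel m h T (c - l) <= expR (2 * Q / 7) * saddle_kernel m (8 * h) T c.
Proof.
move=> h0 T0 lQ; rewrite /saddle_kernel [leRHS]mulrCA.
rewrite ler_wpM2l ?exprn_ge0 ?invr_ge0 ?sqrtr_ge0// -expRD ler_expR.
rewrite -subr_ge0.
have -> : 2 * Q / 7 + - (c ^+ 2 / (16 * (8 * h) * T)) - - ((c - l) ^+ 2 / (16 * h * T)) =
  (7 * (c - 8 / 7 * l) ^+ 2 + 8 / 7 * (32 * h * T * Q - l ^+ 2)) / (128 * h * T).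
  by field; rewrite !gt_eqF.
apply: divr_ge0; last by rewrite !mulr_ge0// ltW.
by rewrite addr_ge0// mulr_ge0 ?sqr_ge0 ?subr_ge0// divr_ge0.
Qed.

(** [b] is adjusted so that at distance [k^6 / 2] from the zero of the phase the decay is [b / k^4]
    even with [8 h] in place of [h]. *)
Lemma far_exponent r k : 0 < r -> 0 < k -> k <= 1 ->
  let b := (256 * (r + 1))^-1 in let d := k ^+ 6 / 2 in
  [/\ 0 < d <= 1, d ^+ 2 / (4 * (r + 1)) / (2 * k ^+ 16) = 8 * (b / k ^+ 4),
    d ^+ 2 / (4 * (r + 1)) / (2 * (8 * k ^+ 16)) = b / k ^+ 4,
    b / k ^+ 2 <= b / k ^+ 4 & 0 < b / k ^+ 2].
Proof.
move=> r0 k0 k1 b d; have r1 : r + 1 != 0 by rewrite gt_eqF// addr_gt0.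
have kn j : 0 < k ^+ j by exact: exprn_gt0.
have b0 : 0 < b by rewrite invr_gt0; clear - r0; lra.
have k6 : k ^+ 6 <= 1 by rewrite exprn_ile1// ltW.
split.
- by rewrite divr_gt0//= ler_pdivrMr// mul1r (le_trans k6)// ler1n.
- by rewrite /d /b; field; rewrite r1 gt_eqF.
- by rewrite /d /b; field; rewrite r1 gt_eqF.
- apply: ler_wpM2l; first exact: ltW.
  by rewrite lef_pV2 ?posrE// ler_wiXn2l// ltW.
- exact: divr_gt0.
Qed.

(** Here [v] is [|eta|^2] and [p] is [pi]. There are three regimes: for [Q k^2 > 1] the vector y is
    atypical and [expR (Q / 2)] pays; for [|c| > k^6] the phase makes both kernels exponentially
    small; otherwise the shifts are bounded by powers of [k] and the kernels are close in ratio. The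
    factor [expR (- (v / 2))] keeps the additive error integrable in eta. *)
Lemma saddle_pointwise m p r a : 2 <= p -> 0 < r -> 0 <= a -> exists k0 C b, [/\ 0 < k0 <= 1, 0 < C, 0 < b &
  forall k v L Q, 0 < k <= k0 -> 0 < v -> 0 <= Q -> L ^+ 2 <= a ^+ 2 * Q ->
    let T0 := (v + a ^+ 2) / (2 * p ^+ 2) in
    let T := (v + (a ^+ 2 + 2 * k ^+ 8 * L + k ^+ 16 * Q)) / (2 * p ^+ 2) in
    let F := saddle_kernel m (k ^+ 16) T (r - 4 * p * T) in
    let F0 := saddle_kernel m (k ^+ 16) T0 (r - 4 * p * T0 - 4 * k ^+ 8 * L / p) in
    let B := C * expR (- (b / k ^+ 2)) * (expR (- (v / 2)) * expR (Q / 2)) in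
    F <= expR (C * k ^+ 2) * F0 + B /\ F0 <= expR (C * k ^+ 2) * F + B].
Proof.
move=> p2 r0 a0.
have [C1 C10 dec] := saddle_kernel_decay m p2 r0.
have p0 : 0 < p by lra.
(* [tau] is half of [r / (4 * p)], the value of [T] at which the phase vanishes. *)
pose M := 1 + 2 * a; pose tau := r / (8 * p).
have M1 : 1 <= M by rewrite /M; lra.
have tau0 : 0 < tau by rewrite divr_gt0// mulr_gt0.
pose C2 := m%:R * (M / tau) + (M ^+ 3 / tau ^+ 2 + 3 * M / tau).
have C20 : 0 <= C2.
  have M0 : 0 <= M by lra.
  have t0 := ltW tau0.
  by rewrite !addr_ge0 ?mulr_ge0 ?invr_ge0 ?exprn_ge0 ?ler0n.
pose b := (256 * (r + 1))^-1.
have b0 : 0 < b by rewrite invr_gt0; lra.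
have b1 : b <= 3 / 14.
  by rewrite /b -div1r ler_pdivrMr; lra.
(* [8 k <= r] keeps [T] and [T0] above [tau], [8 k a <= 1] keeps the linear shift below [k^6 / 4],
   and [k <= 1 / 8] makes [8 h <= 1 / 4], as the decay lemma requires. *)
exists (Num.min r 1 / (8 * (a + 1))), (C1 + C2), b; split => //.
- rewrite divr_gt0/=; [|by rewrite lt_min r0 ltr01|lra].
  rewrite ler_pdivrMr; last lra.
  by rewrite ge_min; apply/orP; right; lra.
- lra.
move=> k v L Q /andP[k0 kk0] v0 Q0 LQ T0 T F F0 B.
have : k * (8 * (a + 1)) <= Num.min r 1 by rewrite -ler_pdivlMr//; lra.
rewrite le_min => /andP[kr k1].
have ka : 0 <= k * a by rewrite mulr_ge0// ltW.
have kle1 : k <= 1 by lra.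
have kn j : 0 < k ^+ j by exact: exprn_gt0.
have kL j : k ^+ j.+1 <= k by rewrite exprS ler_piMr ?exprn_ile1 ?(ltW k0).
have h0 := kn 16%N.
have h1 : 32 * k ^+ 16 <= 1.
  have := kL 14%N => /(ler_wpM2r (ltW k0)); rewrite -exprSr => H.
  by apply: (@le_trans _ _ (32 * (k * k))); [rewrite ler_wpM2l|nra].
have p22 : 0 < 2 * p ^+ 2 by rewrite mulr_gt0// exprn_gt0.
have T00 : 0 < T0 by rewrite divr_gt0// ltr_wpDr// sqr_ge0.
(* [L ^+ 2 <= a ^+ 2 * Q] gives [|2 k^8 L| <= a^2 + k^16 Q], so the expanded sum of squares is
   nonnegative without its origin being known here. *)
have W0 : 0 <= a ^+ 2 + 2 * k ^+ 8 * L + k ^+ 16 * Q.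
  have [La|La] := leP 0 L.
    have k88 := ltW (kn 8%N); have k16 := ltW h0.
    apply: addr_ge0; last exact: mulr_ge0.
    by apply: addr_ge0; [exact: sqr_ge0|apply: mulr_ge0 => //; exact: mulr_ge0].
  have := ler_wpM2l (ltW h0) LQ; rewrite -subr_ge0 => H.
  have : 0 <= (a ^+ 2 + k ^+ 16 * Q) ^+ 2 - (2 * k ^+ 8 * L) ^+ 2.
    have -> : (a ^+ 2 + k ^+ 16 * Q) ^+ 2 - (2 * k ^+ 8 * L) ^+ 2 =
      (a ^+ 2 - k ^+ 16 * Q) ^+ 2 + 4 * (k ^+ 16 * (a ^+ 2 * Q) - k ^+ 16 * L ^+ 2) by ring.
    by rewrite addr_ge0 ?sqr_ge0// mulr_ge0.
  have S0 : 0 <= a ^+ 2 + k ^+ 16 * Q by rewrite addr_ge0 ?sqr_ge0// mulr_ge0// ltW.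
  rewrite subr_ge0 -ler_sqrt ?sqr_ge0// !sqrtr_sqr (ger0_norm S0).
  have := ler_norm (- (2 * k ^+ 8 * L)); rewrite normrN => H1 H2; clear - H1 H2; lra.
have T_0 : 0 < T by rewrite divr_gt0// ltr_wpDr.
have vT : v / (2 * p ^+ 2) <= T by rewrite ler_wpM2r ?invr_ge0 ?(ltW p22)// lerDl.
have vT0 : v / (2 * p ^+ 2) <= T0 by rewrite ler_wpM2r ?invr_ge0 ?(ltW p22)// lerDl sqr_ge0.
pose c := r - 4 * p * T0; pose l := 4 * k ^+ 8 * L / p; pose q := 2 * k ^+ 16 * Q / p.
have XE : r - 4 * p * T = c - l - q by rewrite /c /l /q /T0 /T; field; rewrite gt_eqF.
have q0 : 0 <= q.
  apply: divr_ge0; [apply: mulr_ge0 => //; apply: mulr_ge0; [exact: ler0n|exact: ltW]|exact: ltW].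
have C0 : 0 <= C1 + C2 by clear - C10 C20; lra.
have B0 : 0 <= B by apply: mulr_ge0; apply: mulr_ge0; rewrite ?expR_ge0.
have eC : 0 <= expR ((C1 + C2) * k ^+ 2) by exact: expR_ge0.
have FF0 : 0 <= F by exact: saddle_kernel_ge0.
have F00 : 0 <= F0 by exact: saddle_kernel_ge0.
have bad : F <= B -> F0 <= B ->
    F <= expR ((C1 + C2) * k ^+ 2) * F0 + B /\ F0 <= expR ((C1 + C2) * k ^+ 2) * F + B.
  by move=> FB F0B; split; rewrite (le_trans FB, le_trans F0B)// lerDr mulr_ge0.
have lQ : l ^+ 2 <= 32 * k ^+ 16 * T0 * Q.
  apply: (@le_trans _ _ (16 * k ^+ 16 / p ^+ 2 * (a ^+ 2 * Q))).
    have -> : l ^+ 2 = 16 * k ^+ 16 / p ^+ 2 * L ^+ 2 by rewrite /l; field; rewrite gt_eqF.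
    by apply: ler_wpM2l => //; rewrite !mulr_ge0 ?invr_ge0 ?exprn_ge0 ?ltW.
  have -> : 32 * k ^+ 16 * T0 * Q = 16 * k ^+ 16 / p ^+ 2 * ((v + a ^+ 2) * Q) by rewrite /T0; field; rewrite gt_eqF.
  apply: ler_wpM2l; first by rewrite !mulr_ge0 ?invr_ge0 ?exprn_ge0 ?ltW.
  by apply: ler_wpM2r => //; rewrite lerDr ltW.
have sq := saddle_kernel_square m c h0 T00 lQ.
have k8 : 8 * k ^+ 16 <= 1 / 4 by clear - h1; lra.
have k4 : k ^+ 16 <= 1 / 4 by clear - h0 h1; lra.
have h80 : 0 < 8 * k ^+ 16 by clear - h0; lra.
have k2 := kn 2%N.
have leB x : x <= - (b / k ^+ 2) + Q / 2 -> C1 * expR (- (v / 2)) * expR x <= B.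
  move=> H; rewrite /B -mulrA -[leRHS]mulrA; apply: ler_pM; rewrite ?mulr_ge0 ?expR_ge0 ?(ltW C10)//.
    by rewrite lerDl.
  rewrite [leRHS]mulrCA; apply: ler_wpM2l; first exact: expR_ge0.
  by rewrite -expRD ler_expR.
have z0 (T1 : R) : 0 < T1 -> 0 <= (r - 4 * p * T1) ^+ 2 / (16 * T1).
  by move=> ?; rewrite divr_ge0 ?sqr_ge0// mulr_ge0// ltW.
have FB be : be <= (r - 4 * p * T) ^+ 2 / (16 * T) ->
    - (be / (2 * k ^+ 16)) <= - (b / k ^+ 2) + Q / 2 -> F <= B.
  by move=> /(dec _ _ _ _ _ h0 k4 T_0 vT erefl) H1 H2; apply: (le_trans H1); exact: leB.
have F0B be : be <= (r - 4 * p * T0) ^+ 2 / (16 * T0) ->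
    2 * Q / 7 - be / (2 * (8 * k ^+ 16)) <= - (b / k ^+ 2) + Q / 2 -> F0 <= B.
  move=> /(dec _ _ _ _ _ h80 k8 T00 vT0 erefl) H1 H2; apply: (le_trans sq).
  apply: (le_trans (ler_wpM2l (expR_ge0 _) H1)); rewrite mulrCA -expRD; exact: leB.
(* Atypical y: [b <= 3 / 14 = 1 / 2 - 2 / 7], so [b / k^2] is covered by what [2 Q / 7] leaves of
   [Q / 2]. *)
have [Qk|Qk] := ltP 1 (Q * k ^+ 2).
  have Q2 : b / k ^+ 2 <= 3 / 14 * Q.
    by rewrite ler_pdivrMr//; apply: (le_trans b1); rewrite -[leRHS]mulrA ler_peMr// ltW.
  apply: bad; [apply: (FB 0)|apply: (F0B 0)]; rewrite ?z0// mul0r; clear - Q0 Q2; lra.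
have kLa : (k * L) ^+ 2 <= a ^+ 2.
  rewrite exprMn; apply: (le_trans (ler_wpM2l (ltW k2) LQ)).
  by rewrite mulrCA ler_piMr ?sqr_ge0// mulrC.
have kLa1 : `|k * L| <= a by rewrite -(ger0_norm a0) -ler_sqr ?nnegrE ?normr_ge0// !real_normK ?num_real.
have la : `|l| <= 2 * a * k ^+ 7.
  have -> : l = 4 / p * k ^+ 7 * (k * L) by rewrite /l; field; rewrite gt_eqF.
  have c0 : 0 <= 4 / p * k ^+ 7 by apply: mulr_ge0; [rewrite divr_ge0// ltW|exact: ltW].
  rewrite normrM (ger0_norm c0).
  have -> : 2 * a * k ^+ 7 = 2 * k ^+ 7 * a by ring.
  apply: ler_pM => //.
  apply: ler_wpM2r; first exact: ltW.
  by rewrite ler_pdivrMr//; clear - p2; lra.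
have qk : q <= k ^+ 14.
  have -> : q = 2 / p * (k ^+ 14 * (Q * k ^+ 2)) by rewrite /q; field; rewrite gt_eqF.
  have Y1 : k ^+ 14 * (Q * k ^+ 2) <= k ^+ 14 by rewrite ler_piMr// ltW.
  apply: le_trans Y1; rewrite ler_piMl//; last by rewrite ler_pdivrMr// mul1r.
  by apply: mulr_ge0; [exact: ltW|apply: mulr_ge0 => //; exact: ltW].
have k6 := kn 6%N.
have k76 : k ^+ 7 = k ^+ 6 * k by rewrite -exprSr.
have k146 : k ^+ 14 <= k ^+ 6 * k.
  by rewrite -exprSr ler_wiXn2l// ltW.
have a8 : k ^+ 6 * (k * (8 * (a + 1))) <= k ^+ 6 by rewrite ler_piMr// ltW.
have a8' : 0 <= k ^+ 6 * (k * a) by rewrite mulr_ge0// ltW.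
have k6k : 0 < k ^+ 6 * k by rewrite mulr_gt0.
have la6 : 2 * a * k ^+ 7 = 2 * (k ^+ 6 * (k * a)) by rewrite k76; ring.
have a86 : k ^+ 6 * (k * (8 * (a + 1))) = 8 * (k ^+ 6 * (k * a)) + 8 * (k ^+ 6 * k) by ring.
rewrite a86 in a8; rewrite la6 in la.
(* Away from the zero of the phase: the total shift [l + q] is less than [k^6 / 2], so [r - 4 p T]
   is still at least [k^6 / 2] in absolute value; for [F0] the shift has been removed by
   [saddle_kernel_square]. *)
have [ck|ck] := ltP (k ^+ 6) `|c|.
  have [d01 dE dE' bk bk2] := far_exponent r0 k0 kle1; set d := k ^+ 6 / 2 in d01 dE dE'.
  rewrite -/b in dE dE' bk bk2.
  apply: bad.
    apply: (FB (d ^+ 2 / (4 * (r + 1)))); last by rewrite dE; clear - bk bk2 Q0; lra.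
    apply: saddle_phase_far => //; first by clear - p2; lra.
    have H1 := lerB_dist c l; have H2 := lerB_dist (c - l) q.
    have qn : `|q| = q by rewrite ger0_norm.
    rewrite XE /d; clear - H1 H2 qn la qk k146 a8 ck a8' k6k; lra.
  apply: (F0B (d ^+ 2 / (4 * (r + 1)))); last by rewrite dE'; clear - bk bk2 Q0; lra.
  by apply: saddle_phase_far => //; [clear - p2; lra|rewrite -/c /d; clear - ck k6; lra].
have XM : `|c - l| <= M * k ^+ 6.
  have H1 := ler_normB c l; have kle : k ^+ 6 * (k * a) <= k ^+ 6 * a.
    by apply: ler_wpM2l; [exact: ltW|rewrite ler_piMl].
  rewrite /M mulrDl mul1r -mulrA [a * _]mulrC; clear - H1 kle la ck; lra.
have TE : T - T0 = (l + q) / (4 * p) by rewrite /T /T0 /l /q; field; rewrite gt_eqF.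
have TM : `|T - T0| <= M * k ^+ 7.
  have p4 : 1 <= 4 * p by clear - p2; lra.
  rewrite TE normrM [`|_^-1|]gtr0_norm ?invr_gt0 ?(lt_le_trans ltr01)//.
  rewrite ler_pdivrMr ?(lt_le_trans ltr01)//.
  apply: (@le_trans _ _ (M * k ^+ 7)); last first.
    by rewrite ler_peMr// mulr_ge0 ?(ltW (kn _))// (le_trans ler01).
  have H1 := ler_normD l q; rewrite (ger0_norm q0) in H1.
  rewrite /M mulrDl mul1r la6 k76; clear - H1 la qk k146; lra.
have kr6 : k ^+ 6 <= k by exact: kL.
have k146' : k ^+ 14 <= k ^+ 6 by rewrite ler_wiXn2l// ltW.
have kr8 : 8 * k <= r by clear - ka kr; lra.
have cn := ler_norm c.
have tT0 : tau <= T0.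
  have E : T0 * (8 * p) = 2 * (r - c) by rewrite /c; ring.
  rewrite /tau ler_pdivrMr ?mulr_gt0// E; clear - cn ck kr6 kr8 k0; lra.
have tT : tau <= T.
  have E : T * (8 * p) = 2 * (r - (c - l - q)) by rewrite -XE; ring.
  have H1 := ler_norm (- l); rewrite normrN in H1.
  rewrite /tau ler_pdivrMr ?mulr_gt0// E; clear - cn ck kr6 kr8 k0 H1 la q0 a8 k6k; lra.
have k01 : 0 < k <= 1 by rewrite k0.
have q01 : 0 <= q <= k ^+ 14 by rewrite q0.
have := saddle_kernel_close m M1 tau0 k01 tT tT0 XM TM q01.
rewrite -XE -/C2 => -[H1 H2].
have eC2 : expR (C2 * k ^+ 2) <= expR ((C1 + C2) * k ^+ 2).
  by rewrite ler_expR; apply: ler_wpM2r; [exact: ltW|rewrite lerDr ltW].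
split.
  by rewrite -[leLHS]addr0 lerD// (le_trans H1)// ler_wpM2r.
by rewrite -[leLHS]addr0 lerD// (le_trans H2)// ler_wpM2r.
Qed.

End saddle_kernel.

Section square_norm.
Context (R : realType).
Local Notation T := (measurableTypeR R).

Definition sqnorm n (t : n.-tuple T) : R := \sum_(i < n) tnth t i ^+ 2.

Lemma sqnorm_ge0 n (t : n.-tuple T) : 0 <= sqnorm t.
Proof. by apply: sumr_ge0 => i _; exact: sqr_ge0. Qed.

Lemma measurable_sqnorm n : measurable_fun setT (@sqnorm n).
Proof. by rewrite /sqnorm; meas. Qed.

End square_norm.

Ltac meas_hook ::= lazymatch goal with
 | |- measurable_fun _ (fun z => sqnorm (@?f z)) =>
   first [exact: measurable_sqnorm | apply: (measurableT_comp (f := @sqnorm _ _)); [exact: measurable_sqnorm | meas]]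
 | |- measurable_fun _ (fun z => gaussW (@?f z)) =>
   first [exact: measurable_gaussW | apply: (measurableT_comp (f := @gaussW _ _)); [exact: measurable_gaussW | meas]]
 | |- measurable_fun _ (fun z => (@?f z).1) => apply: (measurableT_comp (f := fst)); [exact: measurable_fst | meas]
 | |- measurable_fun _ (fun z => (@?f z).2) => apply: (measurableT_comp (f := snd)); [exact: measurable_snd | meas]
 end.

(** * Integrating the comparison over eta and y *)

Section gaussian_mixture.
Context (R : realType).
Local Notation mu := (@lebesgue_measure R).
Local Notation T := (measurableTypeR R).
Local Notation leb n := (lebesgue_Rn R n).

Definition mixtureT d (al be : 'I_d -> R) (s v : R) (y : d.-tuple T) : R :=
  (v + \sum_(i < d) (al i + s * be i * tnth y i) ^+ 2) / (2 * pi ^+ 2).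

Definition mixtureL d (al be : 'I_d -> R) (y : d.-tuple T) : R :=
  \sum_(i < d) al i * be i * tnth y i.

Definition mixtureQ d (be : 'I_d -> R) (y : d.-tuple T) : R :=
  \sum_(i < d) (be i * tnth y i) ^+ 2.

Lemma mixtureTE d (al be : 'I_d -> R) s v y : mixtureT al be s v y =
  (v + (\sum_(i < d) al i ^+ 2 + 2 * s * mixtureL al be y + s ^+ 2 * mixtureQ be y)) / (2 * pi ^+ 2).
Proof.
rewrite /mixtureT /mixtureL /mixtureQ !mulr_sumr -!big_split/=; congr ((_ + _) / _).
by apply: eq_bigr => i _; ring.
Qed.

Lemma mixtureL_sqr d (al be : 'I_d -> R) y :
  mixtureL al be y ^+ 2 <= (\sum_(i < d) al i ^+ 2) * mixtureQ be y.
Proof.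
by rewrite /mixtureL; under eq_bigr => i _ do rewrite -mulrA; exact: sqr_sum_le_mul.
Qed.

Lemma integral_gauss_sqnorm n (th : R) : 0 < th ->
  (\int[leb n]_t (expR (- (th * sqnorm t)))%:E = (Num.sqrt (pi / th) ^+ n)%:E)%E.
Proof.
move=> th0; transitivity (\prod_(i < n) Num.sqrt (pi / th))%:E; last by rewrite prodr_const card_ord.
rewrite -(@integral_Rn_prod _ n (fun _ x => expR (- (th * x ^+ 2)))).
- by apply: eq_integral => t _; rewrite /sqnorm mulr_sumr -sumrN expR_sum.
- by move=> i; meas.
- by move=> i x; exact: expR_ge0.
- by move=> i; exact: integral_gauss_line.
Qed.

Lemma integral_gaussW_expQ d (be : 'I_d -> R) : (forall i, be i ^+ 2 < 1) ->
  (\int[leb d]_y (gaussW y * expR (mixtureQ be y / 2))%:E =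
   (\prod_(i < d) (Num.sqrt (1 - be i ^+ 2))^-1)%:E)%E.
Proof.
move=> b1; have := @integral_gaussW _ d (- (1 / 2)) (fun=> 0) be.
have E i : 1 + 2 * - (1 / 2) * be i ^+ 2 = 1 - be i ^+ 2 by field.
move=> H; transitivity (\prod_(i < d) ((Num.sqrt (1 + 2 * - (1 / 2) * be i ^+ 2))^-1 *
     expR (- (- (1 / 2) * 0 ^+ 2 / (1 + 2 * - (1 / 2) * be i ^+ 2)))))%:E; last first.
  by congr EFin; apply: eq_bigr => i _; rewrite E expr0n mulr0 mul0r oppr0 expR0 mulr1.
rewrite -H; last by move=> i; rewrite E subr_gt0.
apply: eq_integral => y _; congr (_ * expR _)%:E.
by rewrite /mixtureQ mulr_suml -sumrN; apply: eq_bigr => i _; field.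
Qed.

Definition saddle_mix n d (m : nat) (al be : 'I_d -> R) (h s r : R) (p : n.-tuple T * d.-tuple T) : R :=
  let T1 := mixtureT al be s (sqnorm p.1) p.2 in
  gaussW p.2 * saddle_kernel m h T1 (r - 4 * pi * T1).

Definition saddle_mix0 n d (m : nat) (al be : 'I_d -> R) (A h s r : R) (p : n.-tuple T * d.-tuple T) : R :=
  let T0 := (sqnorm p.1 + A) / (2 * pi ^+ 2) in
  gaussW p.2 * saddle_kernel m h T0 (r - 4 * pi * T0 - 4 * s * mixtureL al be p.2 / pi).

Lemma measurable_saddle_mix n d m al be h s r :
  measurable_fun setT (@saddle_mix n d m al be h s r).
Proof.
by rewrite /saddle_mix /saddle_kernel /mixtureT; meas.
Qed.

Lemma measurable_saddle_mix0 n d m al be A h s r :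
  measurable_fun setT (@saddle_mix0 n d m al be A h s r).
Proof.
by rewrite /saddle_mix0 /saddle_kernel /mixtureL; meas.
Qed.

Lemma saddle_mix_ge0 n d m al be h s r p : 0 <= @saddle_mix n d m al be h s r p.
Proof. by rewrite mulr_ge0 ?gaussW_ge0 ?saddle_kernel_ge0. Qed.

Lemma saddle_mix0_ge0 n d m al be A h s r p : 0 <= @saddle_mix0 n d m al be A h s r p.
Proof. by rewrite mulr_ge0 ?gaussW_ge0 ?saddle_kernel_ge0. Qed.

(** The pointwise bound is available only for nonzero eta; through Tonelli it is enough to discard a
    null set of the first variable. *)
Lemma integral_ae_le_affine n d (f g e : n.-tuple T * d.-tuple T -> R) (c B : R) : (0 < n)%N ->
  measurable_fun setT f -> measurable_fun setT g -> measurable_fun setT e ->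
  (forall p, 0 <= f p) -> (forall p, 0 <= g p) -> (forall p, 0 <= e p) -> 0 <= c ->
  (\int[(leb n \x leb d)%E]_p (e p)%:E <= B%:E)%E ->
  (forall p, 0 < sqnorm p.1 -> f p <= c * g p + e p) ->
  (\int[(leb n \x leb d)%E]_p (f p)%:E <= c%:E * \int[(leb n \x leb d)%E]_p (g p)%:E + B%:E)%E.
Proof.
move=> n0 mf mg me f0 g0 e0 c0 eB H.
have cg0 p : 0 <= c * g p by rewrite mulr_ge0.
rewrite (le_trans _ (leeD (le_refl _) eB))// -integralZl_ge0_EFin//.
rewrite -ge0_integralD//; last 4 first.
- by move=> p _; rewrite -EFinM lee_fin.
- by apply/measurable_EFinP; apply: measurable_funM.
- by move=> p _; rewrite lee_fin.
- exact/measurable_EFinP.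
have mf' : measurable_fun setT (fun p => (f p)%:E) by exact/measurable_EFinP.
have mge : measurable_fun setT (fun p => (c%:E * (g p)%:E + (e p)%:E)%E).
  by apply: (proj2 (measurable_EFinP _ (fun p => c * g p + e p))); apply: measurable_funD => //; apply: measurable_funM.
have f0' p : (0 <= (f p)%:E)%E by rewrite lee_fin.
have ge0' p : (0 <= c%:E * (g p)%:E + (e p)%:E)%E by rewrite -EFinM -EFinD lee_fin addr_ge0.
rewrite (fubini_tonelli1 _ mf' f0') (fubini_tonelli1 _ mge ge0').
apply: ae_ge0_le_integral => //.
- by move=> t _; apply: integral_ge0.
- exact: measurable_fun_fubini_tonelli_F.
- by move=> t _; apply: integral_ge0.
- exact: measurable_fun_fubini_tonelli_F.
have := @ae_Rn_neq0 R n n0; apply: filterS => t t0 _.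
apply: ge0_le_integral => //.
- exact: (measurableT_comp mf' (measurable_pair1 t)).
- exact: (measurableT_comp mge (measurable_pair1 t)).
by move=> y _; rewrite -EFinM -EFinD lee_fin; exact: H.
Qed.

Lemma integral_saddle_remainder n d (be : 'I_d -> R) (K M : R) : 0 <= K ->
  (forall i, be i ^+ 2 < 1) -> \prod_(i < d) (Num.sqrt (1 - be i ^+ 2))^-1 <= M ->
  (\int[(leb n \x leb d)%E]_p (K * (gaussW p.2 * (expR (- (sqnorm p.1 / 2)) * expR (mixtureQ be p.2 / 2))))%:E
   <= (K * (Num.sqrt (2 * pi) ^+ n * M))%:E)%E.
Proof.
move=> K0 b1 bM.
under eq_integral => p _ do rewrite EFinM.
rewrite integralZl_ge0_EFin//; last 2 first.
- by rewrite /mixtureQ; meas.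
- by move=> p; rewrite !mulr_ge0 ?gaussW_ge0 ?expR_ge0.
rewrite EFinM lee_wpmul2l ?lee_fin// fubini_tonelli1//=; last 2 first.
- by rewrite /mixtureQ; meas.
- by move=> p; rewrite lee_fin !mulr_ge0 ?gaussW_ge0 ?expR_ge0.
set P := \prod_(i < d) _ in bM.
have P0 : 0 <= P by apply: prodr_ge0 => i _; rewrite invr_ge0 sqrtr_ge0.
rewrite /fubini_F /= (_ : (\int[leb n]_t _)%E = (\int[leb n]_t (P%:E * (expR (- (1 / 2 * sqnorm t)))%:E))%E); last first.
  apply: eq_integral => t _.
  transitivity ((expR (- (1 / 2 * sqnorm t)))%:E *
      \int[leb d]_y (gaussW y * expR (mixtureQ be y / 2))%:E)%E; last by rewrite integral_gaussW_expQ// muleC.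
  rewrite -integralZl_ge0_EFin ?expR_ge0//; last 2 first.
  - by rewrite /mixtureQ; meas.
  - by move=> y; rewrite mulr_ge0 ?gaussW_ge0 ?expR_ge0.
  apply: eq_integral => y _; rewrite -EFinM; congr EFin; rewrite mulrCA.
  by rewrite (_ : 1 / 2 * sqnorm t = sqnorm t / 2)//; field.
have mE : measurable_fun setT (fun t : n.-tuple T => expR (- (1 / 2 * sqnorm t))) by rewrite /sqnorm; meas.
rewrite integralZl_ge0_EFin//.
rewrite integral_gauss_sqnorm; last lra.
rewrite -EFinM lee_fin mulrC (_ : pi / (1 / 2) = 2 * pi); last by field.
by rewrite ler_wpM2l// exprn_ge0// sqrtr_ge0.
Qed.

(** The constants precede [d], [al] and [be]: they depend on [al] through its norm [a] and on [be]
    through [M] only, so they survive the limit of infinitely many variables. *)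
Lemma saddle_mix_compare n m (a r M : R) : (0 < n)%N -> 0 < r -> 0 <= a -> 0 <= M ->
  exists k0 C b, [/\ 0 < k0 <= 1, 0 < C, 0 < b &
  forall d (al be : 'I_d -> R) k, \sum_(i < d) al i ^+ 2 = a ^+ 2 -> (forall i, be i ^+ 2 < 1) ->
    \prod_(i < d) (Num.sqrt (1 - be i ^+ 2))^-1 <= M -> 0 < k <= k0 ->
    let K1 := (\int[(leb n \x leb d)%E]_p (saddle_mix m al be (k ^+ 16) (k ^+ 8) r p)%:E)%E in
    let K2 := (\int[(leb n \x leb d)%E]_p (saddle_mix0 m al be (a ^+ 2) (k ^+ 16) (k ^+ 8) r p)%:E)%E in
    let B := C * expR (- (b / k ^+ 2)) in
    (K1 <= (expR (C * k ^+ 2))%:E * K2 + B%:E)%E /\ (K2 <= (expR (C * k ^+ 2))%:E * K1 + B%:E)%E].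
Proof.
move=> n0 r0 a0 M0.
have [k0 [C [b [k01 C0 b0 H]]]] := saddle_pointwise m (pi_ge2 R) r0 a0.
(* Bounds the mass of [expR (- (v / 2)) * expR (Q / 2)] under the Gaussian weight; it is finite
   because [be i ^+ 2 < 1]. *)
pose G := Num.sqrt (2 * pi) ^+ n * M : R.
have G0 : 0 <= G by rewrite mulr_ge0// exprn_ge0// sqrtr_ge0.
exists k0, (C * (1 + G)), b; split => //; first by rewrite mulr_gt0//; lra.
move=> d al be k alE b1 bM kk0 K1 K2 B.
have /andP[kp _] := kk0.
pose E0 := C * expR (- (b / k ^+ 2)).
have E00 : 0 <= E0 by rewrite mulr_ge0 ?expR_ge0// ltW.
have EB : E0 * G <= B.
  by rewrite /E0 /B mulrAC; apply: ler_wpM2r; [exact: expR_ge0|rewrite ler_wpM2l ?(ltW C0)//; lra].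
have eC : expR (C * k ^+ 2) <= expR (C * (1 + G) * k ^+ 2).
  by rewrite ler_expR; apply: ler_wpM2r; [exact: sqr_ge0|rewrite ler_peMr ?(ltW C0)//; lra].
have rem := integral_saddle_remainder n E00 b1 bM.
have rem' := le_trans rem (_ : (_ <= B%:E)%E); rewrite lee_fin in rem'.
have {}rem := rem' EB.
pose e (p : n.-tuple T * d.-tuple T) := E0 * (gaussW p.2 * (expR (- (sqnorm p.1 / 2)) * expR (mixtureQ be p.2 / 2))).
have me : measurable_fun setT e.
  by rewrite /e /mixtureQ; meas.
have e0 p : 0 <= e p by apply: mulr_ge0 => //; rewrite !mulr_ge0 ?gaussW_ge0 ?expR_ge0.
have m1 := @measurable_saddle_mix n d m al be (k ^+ 16) (k ^+ 8) r.
have m2 := @measurable_saddle_mix0 n d m al be (a ^+ 2) (k ^+ 16) (k ^+ 8) r.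
have pt p : 0 < sqnorm p.1 ->
  saddle_mix m al be (k ^+ 16) (k ^+ 8) r p <= expR (C * (1 + G) * k ^+ 2) * saddle_mix0 m al be (a ^+ 2) (k ^+ 16) (k ^+ 8) r p + e p /\
  saddle_mix0 m al be (a ^+ 2) (k ^+ 16) (k ^+ 8) r p <= expR (C * (1 + G) * k ^+ 2) * saddle_mix m al be (k ^+ 16) (k ^+ 8) r p + e p.
  move=> v0.
  have Q0 : 0 <= mixtureQ be p.2 by apply: sumr_ge0 => i _; exact: sqr_ge0.
  have LQ := mixtureL_sqr al be p.2; rewrite alE in LQ.
  have [H1 H2] := H _ _ _ _ kk0 v0 Q0 LQ.
  rewrite /saddle_mix /saddle_mix0 mixtureTE alE -exprM.
  have W0 := gaussW_ge0 p.2.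
  split.
    apply: (le_trans (ler_wpM2l W0 H1)); rewrite mulrDr /e [E0 * _]mulrCA lerD2r mulrCA.
    by apply: ler_wpM2r => //; rewrite mulr_ge0 ?saddle_kernel_ge0.
  apply: (le_trans (ler_wpM2l W0 H2)); rewrite mulrDr /e [E0 * _]mulrCA lerD2r mulrCA.
  by apply: ler_wpM2r => //; rewrite mulr_ge0 ?saddle_kernel_ge0.
split.
  apply: (integral_ae_le_affine n0 m1 m2 me) => //.
  - exact: saddle_mix_ge0.
  - exact: saddle_mix0_ge0.
  - by move=> p /pt[].
apply: (integral_ae_le_affine n0 m2 m1 me) => //.
- exact: saddle_mix0_ge0.
- exact: saddle_mix_ge0.
- by move=> p /pt[].
Qed.

End gaussian_mixture.

(** * The Gaussian integral of the linearised kernel *)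

Section saddle_density.
Context (R : realType).
Local Notation mu := (@lebesgue_measure R).
Local Notation T := (measurableTypeR R).
Local Notation leb n := (lebesgue_Rn R n).

(** The integrand of the theorem as a function of [v = |eta|^2], with [x2 = |x|^2], so that [R^2] is
    [x2 + x2]. *)
Definition saddle_density (m : nat) (x2 r h v : R) : R :=
  expR (- ((v - pi / 4 * (2 * r - pi * x2)) ^+ 2 / (v + pi ^+ 2 * (x2 + x2) / 4) / (2 * h))) /
  Num.sqrt ((v / pi ^+ 2 + (x2 + x2) / 8) ^+ (m - 1) * (v / pi ^+ 2 + (x2 + x2) / 4)).

Lemma saddle_density_ge0 m x2 r h v : 0 <= saddle_density m x2 r h v.
Proof. by rewrite mulr_ge0 ?expR_ge0// invr_ge0 sqrtr_ge0. Qed.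

Lemma sqrtr_exprn (x : R) j : 0 <= x -> Num.sqrt (x ^+ j) = Num.sqrt x ^+ j.
Proof.
move=> x0; elim: j => [|j IH]; first by rewrite !expr0 sqrtr1.
by rewrite !exprS sqrtrM// IH.
Qed.

(** With [a = v / pi^2 + R^2 / 8] and [b = v / pi^2 + R^2 / 4] one has [T0 = a / 2] and [D = b / a].
    The y-integral thus turns one of the [m] factors [sqrt a] into [sqrt b], which gives the
    determinant, and the denominator [a] of the exponent into [b]. *)
Lemma saddle_densityE m (x2 r h v : R) : (0 < m)%N -> 0 <= x2 -> 0 < h -> 0 <= v ->
  let T0 := (v + pi ^+ 2 * x2 / 4) / (2 * pi ^+ 2) in
  let ka := (16 * h * T0)^-1 in
  let D := 1 + 2 * ka * (16 * h * (pi ^+ 2 * x2 / 16) / pi ^+ 2) in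
  (Num.sqrt T0)^-1 ^+ m * ((Num.sqrt D)^-1 * expR (- (ka * (r - 4 * pi * T0) ^+ 2 / D))) =
  Num.sqrt 2 ^+ m * saddle_density m x2 r h v.
Proof.
move=> m0 x20 h0 v0 T0 ka D; have p0 := pi_gt0 R.
have p20 : 0 < pi ^+ 2 :> R by rewrite exprn_gt0.
(* Here [v = x2 = 0], and both sides are 0 by the convention for the inverse of 0. *)
have [vx|vx] := eqVneq (v + pi ^+ 2 * x2 / 4) 0.
  have px0 : 0 <= pi ^+ 2 * x2 / 4 by rewrite divr_ge0// mulr_ge0// ltW.
  have v00 : v = 0 by lra.
  have : pi ^+ 2 * x2 = 0 by lra.
  move=> /eqP; rewrite mulf_eq0 (gt_eqF p20)/= => /eqP x00.
  rewrite /T0 vx mul0r sqrtr0 invr0 expr0n gtn_eqF//= mul0r.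
  by rewrite /saddle_density v00 x00 mul0r !addr0 !mul0r addr0 mulr0 sqrtr0 invr0 !mulr0.
pose a := v / pi ^+ 2 + x2 / 4.
have a0 : 0 < a.
  have -> : a = (v + pi ^+ 2 * x2 / 4) / pi ^+ 2 by rewrite /a; move: p20; generalize (@pi R) => p p20; field; rewrite -sqrf_eq0 gt_eqF.
  by rewrite divr_gt0// lt_neqAle eq_sym vx addr_ge0// divr_ge0// mulr_ge0// ltW.
pose b := v / pi ^+ 2 + x2 / 2.
have b0 : 0 < b by rewrite /b; rewrite /a in a0; lra.
have T0E : T0 = a / 2.
  by rewrite /T0 /a; move: p20; generalize (@pi R) => p p20; field; rewrite -sqrf_eq0 gt_eqF.
have DE : D = b / a.
  rewrite /D /ka T0E /b; have : a = v / pi ^+ 2 + x2 / 4 by [].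
  move: (lt0r_neq0 p0) (lt0r_neq0 a0) (lt0r_neq0 h0); generalize (@pi R) a => p c pn cn hn cE.
  have -> : v / p ^+ 2 = c - x2 / 4 by rewrite cE; ring.
  by field; rewrite ?pn ?cn ?hn.
rewrite DE T0E /saddle_density.
have -> : (x2 + x2) / 8 = x2 / 4 by field.
have -> : v / pi ^+ 2 + (x2 + x2) / 4 = b by rewrite /b; congr (_ + _); field.
rewrite -/a.
rewrite mulrA [RHS]mulrA [RHS]mulrAC; congr (_ * expR (- _)).
  rewrite [Num.sqrt (a ^+ _ * _)]sqrtrM ?exprn_ge0 ?(ltW a0)// sqrtr_exprn ?(ltW a0)//.
  rewrite (sqrtrM _ (ltW a0)) (sqrtrM _ (ltW b0)) !sqrtrV//; try lra.
  have sa : Num.sqrt a != 0 by rewrite gt_eqF// sqrtr_gt0.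
  have sb : Num.sqrt b != 0 by rewrite gt_eqF// sqrtr_gt0.
  have s2 : Num.sqrt 2 != 0 :> R by rewrite gt_eqF// sqrtr_gt0.
  case: (m) m0 => // k _; rewrite subSS subn0 exprS [_ ^+ k.+1]exprS.
  rewrite !invfM !invrK exprMn exprVn.
  by field; rewrite ?sa ?sb ?expf_neq0.
rewrite /ka T0E.
have vE : v = pi ^+ 2 * (b - x2 / 2) by rewrite /b; move: p20; generalize (@pi R) => p p20; field; rewrite -sqrf_eq0 gt_eqF.
have aE : a = b - x2 / 4 by rewrite /a /b; lra.
have an := lt0r_neq0 a0.
have dE : v + pi ^+ 2 * (x2 + x2) / 4 = pi ^+ 2 * b by rewrite vE; field.
rewrite dE vE; move: (lt0r_neq0 p0) an (lt0r_neq0 b0) (lt0r_neq0 h0); rewrite aE.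
generalize (@pi R) b => p c pn an cn hn.
field; rewrite ?pn ?hn ?cn ?andbT/=; apply: contra_neq an => E; lra.
Qed.

Lemma measurable_saddle_density m x2 r h : measurable_fun setT (saddle_density m x2 r h).
Proof. by rewrite /saddle_density; meas. Qed.

Lemma integral_saddle_mix0 n d m (al be : 'I_d -> R) (x2 h s r : R) : (0 < m)%N -> 0 <= x2 ->
  0 < h -> s ^+ 2 = h -> \sum_(i < d) (al i * be i) ^+ 2 = pi ^+ 2 * x2 / 16 ->
  (\int[(leb n \x leb d)%E]_p (saddle_mix0 m al be (pi ^+ 2 * x2 / 4) h s r p)%:E =
   \int[leb n]_t (Num.sqrt 2 ^+ m * saddle_density m x2 r h (sqnorm t))%:E)%E.
Proof.
move=> m0 x20 h0 sh ab; have p0 := pi_gt0 R.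
have mm : measurable_fun setT (fun p : n.-tuple T * d.-tuple T => (saddle_mix0 m al be (pi ^+ 2 * x2 / 4) h s r p)%:E).
  by apply/measurable_EFinP; exact: measurable_saddle_mix0.
rewrite fubini_tonelli1//; last by move=> p; rewrite lee_fin saddle_mix0_ge0.
apply: eq_integral => t _; rewrite /fubini_F /saddle_mix0 /saddle_kernel /=.
set A := pi ^+ 2 * x2 / 4; set T0 := (_ + A) / _.
have v0 := sqnorm_ge0 t.
have A0 : 0 <= A by rewrite divr_ge0// mulr_ge0// ltW// exprn_gt0.
have T00 : 0 <= T0 by rewrite divr_ge0 ?addr_ge0 ?mulr_ge0// ltW// exprn_gt0.
have ka0 : 0 <= (16 * h * T0)^-1 by rewrite invr_ge0; apply: mulr_ge0 => //; apply: mulr_ge0 => //; exact: ltW.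
pose g i := 4 * s / pi * (al i * be i).
have := integral_gaussW_line (r - 4 * pi * T0) g ka0.
have -> : \sum_(i < d) g i ^+ 2 = 16 * h * (pi ^+ 2 * x2 / 16) / pi ^+ 2.
  rewrite /g; under eq_bigr => i _ do rewrite exprMn.
  rewrite -mulr_sumr ab -sh expr_div_n exprMn.
  by rewrite -natrX; ring.
move=> H.
have z0 : 0 <= (Num.sqrt T0)^-1 ^+ m by rewrite exprn_ge0// invr_ge0 sqrtr_ge0.
rewrite -saddle_densityE// -/A -/T0 EFinM -H -(integralZl_ge0_EFin (leb d) z0); last 2 first.
- by meas.
- by move=> y; rewrite mulr_ge0 ?gaussW_ge0 ?expR_ge0.
apply: eq_integral => y _; rewrite -EFinM; congr EFin.
rewrite mulrCA; congr (_ * (_ * expR (- _))).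
rewrite mulrC; congr (_ * _ ^+ 2); congr (_ - _).
rewrite /mixtureL mulr_sumr mulr_suml; apply: eq_bigr => i _.
by rewrite /g; ring.
Qed.

(** On a cube of side [h] with a corner on the sphere where the phase vanishes, the numerator of the
    phase is of order [h^2], so the exponent stays bounded. The cube extends outwards, hence
    [v >= q] and the denominators are bounded below through [de = pi * r / 2], even when
    [x2 = 0]. *)
Lemma saddle_density_lower n m (x2 r : R) : (0 < n)%N -> (0 < m)%N -> 0 <= x2 -> 0 < r -> pi * x2 <= 2 * r ->
  exists2 c, 0 < c & forall h, 0 < h <= 1 ->
  ((c * h ^+ n)%:E <= \int[leb n]_t (saddle_density m x2 r h (sqnorm t))%:E)%E.
Proof.
move=> n0 m0 x20 r0 xr; have p0 := pi_gt0 R.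
have p20 : 0 < pi ^+ 2 :> R by rewrite exprn_gt0.
pose q : R := pi / 4 * (2 * r - pi * x2).
have q0 : 0 <= q by rewrite mulr_ge0 ?divr_ge0 ?subr_ge0// ltW.
pose rho := Num.sqrt q.
have rho0 : 0 <= rho by exact: sqrtr_ge0.
have rho2 : rho ^+ 2 = q by rewrite sqr_sqrtr.
(* Bounds [(v - q) / h] on the cube, from [(e + y)^2 - e^2 <= 2 h e + h] for [0 <= y <= h <= 1]. *)
pose M := 2 * rho + n%:R.
have M0 : 0 <= M by rewrite addr_ge0// mulr_ge0.
pose de := pi * r / 2.
have de0 : 0 < de by rewrite divr_gt0// mulr_gt0.
have deE : q + pi ^+ 2 * x2 / 4 = de by rewrite /q /de; field.
have px0 : 0 <= pi ^+ 2 * x2 by rewrite mulr_ge0// ltW.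
pose D (v : R) := (v / pi ^+ 2 + (x2 + x2) / 8) ^+ (m - 1) * (v / pi ^+ 2 + (x2 + x2) / 4).
have Dgt0 v : q <= v -> 0 < D v.
  move=> qv; have a0 : 0 < v / pi ^+ 2 + (x2 + x2) / 8.
    have -> : v / pi ^+ 2 + (x2 + x2) / 8 = (v + pi ^+ 2 * x2 / 4) / pi ^+ 2.
      by move: p20; generalize (@pi R) => p p20; field; rewrite -sqrf_eq0 gt_eqF.
    by rewrite divr_gt0//; lra.
  by rewrite mulr_gt0 ?exprn_gt0//; lra.
have DM v : q <= v -> v <= q + M -> D v <= D (q + M).
  move=> qv vM; have v0 : 0 <= v by lra.
  have H : v / pi ^+ 2 <= (q + M) / pi ^+ 2 by apply: ler_wpM2r; rewrite ?invr_ge0// ltW.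
  have v1 : 0 <= v / pi ^+ 2 by rewrite divr_ge0// ltW.
  have x28 : 0 <= (x2 + x2) / 8 by clear - x20; lra.
  apply: ler_pM; [apply: exprn_ge0; exact: addr_ge0|move: v1 x28; clear; move: (v / _) => z; lra| |by rewrite lerD2r].
  by apply: lerXn2r; rewrite ?nnegrE ?lerD2r// addr_ge0// (le_trans v1).
pose c := expR (- (M ^+ 2 / (2 * de))) / Num.sqrt (D (q + M)).
have c0 : 0 < c by rewrite divr_gt0 ?expR_gt0// sqrtr_gt0 Dgt0// lerDl.
exists c => // h /andP[h0 h1].
pose e (i : 'I_n) : R := if i == Ordinal n0 then rho else 0.
have e0 i : 0 <= e i by rewrite /e; case: ifP.
pose f (i : 'I_n) (y : R) : R := \1_(`[e i, e i + h]%classic : set R) y.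
have mf i : measurable_fun setT (f i) by apply: measurable_indic; exact: measurable_itv.
have f0 i y : 0 <= f i y by rewrite /f indicE.
have intf i : (\int[mu]_x (f i x)%:E = h%:E)%E.
  rewrite /f integral_indic//.
  transitivity (mu `[e i, e i + h]%classic); first by rewrite setIT.
  rewrite lebesgue_measure_itv/= lte_fin ltrDl h0 -EFinB; congr EFin; ring.
have := integral_Rn_prod mf f0 intf.
rewrite prodr_const card_ord EFinM => <-.
rewrite -integralZl_ge0_EFin ?(ltW c0)//; last 2 first.
- by apply: measurable_prod => i _; exact: (measurableT_comp (mf i) (measurable_tnth i)).
- by move=> t; apply: prodr_ge0 => i _.
apply: ge0_le_integral => //.
- by move=> t _; rewrite -EFinM lee_fin mulr_ge0 ?(ltW c0)// prodr_ge0.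
- apply/measurable_EFinP; apply: measurable_funM => //.
  by apply: measurable_prod => i _; exact: (measurableT_comp (mf i) (measurable_tnth i)).
- by apply/measurable_EFinP; apply: (measurableT_comp (@measurable_saddle_density m x2 r h)); exact: measurable_sqnorm.
move=> t _; rewrite -EFinM lee_fin.
have [tin|/negP tnin] := boolP [forall i, (e i <= tnth t i <= e i + h)]; last first.
  have [i Hi] : exists i, ~~ (e i <= tnth t i <= e i + h) by apply/existsP; rewrite -negb_forall; apply/negP.
  have fi : f i (tnth t i) = 0.
    by rewrite /f indicE memNset//= in_itv/=; apply/negP.
  by rewrite (bigD1 i)//= fi mul0r mulr0 saddle_density_ge0.
have ti i : e i <= tnth t i <= e i + h by exact: (forallP tin).
have -> : \prod_(i < n) f i (tnth t i) = 1.
  by apply: big1 => i _; rewrite /f indicE mem_set//= in_itv/=.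
rewrite mulr1.
have se : \sum_(i < n) e i ^+ 2 = q.
  rewrite (bigD1 (Ordinal n0))//= {1}/e eqxx rho2 big1 ?addr0// => i ni.
  by rewrite /e (negbTE ni) expr0n.
have se1 : \sum_(i < n) e i = rho.
  rewrite (bigD1 (Ordinal n0))//= {1}/e eqxx big1 ?addr0// => i ni.
  by rewrite /e (negbTE ni).
have qv : q <= sqnorm t.
  rewrite -se; apply: ler_sum => i _; have /andP[H _] := ti i.
  by rewrite ler_pXn2r// nnegrE ?(le_trans _ H).
have vM : sqnorm t - q <= M * h.
  have -> : M * h = \sum_(i < n) (2 * h * e i + h).
    by rewrite big_split/= -mulr_sumr se1 sumr_const card_ord /M -[h *+ n]mulr_natl; ring.
  rewrite -se -sumrB; apply: ler_sum => i _; have /andP[H1 H2] := ti i.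
  have := e0 i; move: H1 H2; move: (tnth t i) (e i) => y z H1 H2 z0; nra.
have Mh : M * h <= M by rewrite ler_piMr.
rewrite /saddle_density -/q -/(D _).
set v := sqnorm t in qv vM *.
apply: ler_pM.
- exact: expR_ge0.
- by rewrite invr_ge0 sqrtr_ge0.
- rewrite ler_expR lerN2.
  have vde : de <= v + pi ^+ 2 * (x2 + x2) / 4 by rewrite -deE; lra.
  have de1 : 0 < v + pi ^+ 2 * (x2 + x2) / 4 by lra.
  rewrite ler_pdivrMr ?mulr_gt0// ler_pdivrMr//.
  apply: (@le_trans _ _ ((M * h) ^+ 2)).
    by rewrite ler_pXn2r ?nnegrE ?subr_ge0// mulr_ge0// ltW.
  apply: (@le_trans _ _ (M ^+ 2 / (2 * de) * (2 * h) * de)); last first.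
    by apply: ler_wpM2l => //; rewrite !mulr_ge0 ?invr_ge0 ?sqr_ge0 ?mulr_ge0// ltW.
  have -> : M ^+ 2 / (2 * de) * (2 * h) * de = M ^+ 2 * h by field; rewrite gt_eqF.
  by rewrite exprMn; apply: ler_wpM2l; [exact: sqr_ge0|rewrite expr2 ler_piMr// ltW].
- have vv : v <= q + M by lra.
  rewrite lef_pV2 ?posrE ?sqrtr_gt0 ?Dgt0// ?lerDl//.
  by rewrite ler_wsqrtr// DM.
Qed.

End saddle_density.

(** * The series behind the two moments of the mixture *)

Section mixture_constants.
Context (R : realType).

Let q (N : nat) : R := (2 * N%:R + 1)^-1.

(** By partial fractions four times the summand is [1 / (2j - 1)^2 + 1 / (2j + 1)^2 + 2 / (4j^2 -
    1)]: two sums over odd squares and a telescoping sum. The next two lemmas are of the same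
    kind. *)
Lemma sum_even_sqr (N : nat) :
  \sum_(1 <= j < N.+1) ((2 * j%:R) ^+ 2 / ((2 * j%:R) ^+ 2 - 1) ^+ 2 : R) =
  (2 * \sum_(1 <= k < N.+1) ((2 * k%:R + 1) ^- 2) + 2 - q N ^+ 2 - q N) / 4.
Proof.
rewrite /q; elim: N => [|N IH]; first by rewrite !big_geq//; field.
rewrite !(big_nat_recr N.+1)//= IH -[N.+1]addn1 natrD.
have : (0 : R) <= N%:R by exact: ler0n.
move: (N%:R : R) (\sum_(_ <= _ < _) _ : R) => x S x0; field.
by rewrite !gt_eqF//; nra.
Qed.

Lemma sum_even_cub (N : nat) :
  \sum_(1 <= j < N.+1) ((2 * j%:R) ^+ 2 / ((2 * j%:R) ^+ 2 - 1) ^+ 3 : R) =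
  (1 - q N ^+ 3 + \sum_(1 <= k < N.+1) ((2 * k%:R + 1) ^- 2) - q N ^+ 2 / 2 + q N / 2) / 8.
Proof.
rewrite /q; elim: N => [|N IH]; first by rewrite !big_geq//; field.
rewrite !(big_nat_recr N.+1)//= IH -[N.+1]addn1 natrD.
have : (0 : R) <= N%:R by exact: ler0n.
move: (N%:R : R) (\sum_(_ <= _ < _) _ : R) => x S x0; field.
by rewrite !gt_eqF//; nra.
Qed.

Lemma sum_even_inv (N : nat) :
  \sum_(1 <= j < N.+1) (((2 * j%:R) ^+ 2 - 1)^-1 : R) = (1 - q N) / 2.
Proof.
rewrite /q; elim: N => [|N IH]; first by rewrite !big_geq//; field.
rewrite !(big_nat_recr N.+1)//= IH -[N.+1]addn1 natrD.
have : (0 : R) <= N%:R by exact: ler0n.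
move: (N%:R : R) => x x0; field.
by rewrite !gt_eqF//; nra.
Qed.

Lemma cvg_odd_inv : q N @[N --> \oo] --> (0 : R).
Proof.
apply: (@squeeze_cvgr _ _ _ _ (fun=> 0) (fun N : nat => N.+1%:R^-1)).
- near=> N; have p : 0 < 2 * N%:R + 1 :> R by rewrite ltr_wpDl// mulr_ge0.
  rewrite /q invr_ge0 (ltW p)/= lef_pV2 ?posrE//.
  by rewrite -addn1 natrD lerD2r ler_peMl// ler1n.
- exact: cvg_cst.
- exact: cvg_harmonic.
Unshelve. all: by end_near. Qed.

Lemma cvg_sum_even_sqr :
  \sum_(1 <= j < N.+1) ((2 * j%:R) ^+ 2 / ((2 * j%:R) ^+ 2 - 1) ^+ 2 : R) @[N --> \oo] --> pi ^+ 2 / 16.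
Proof.
under eq_fun do rewrite sum_even_sqr.
have Q := cvg_odd_inv; have S := @cvg_sum_odd R.
have -> : pi ^+ 2 / 16 = (2 * (pi ^+ 2 / 8 - 1) + 2 - 0 ^+ 2 - 0) / 4 :> R by lra.
apply: cvgMl; apply: cvgB => //; apply: cvgB; last by rewrite expr2; apply: cvgM.
by apply: cvgD; [apply: cvgMr|exact: cvg_cst].
Qed.

Lemma cvg_sum_even_cub :
  \sum_(1 <= j < N.+1) ((2 * j%:R) ^+ 2 / ((2 * j%:R) ^+ 2 - 1) ^+ 3 : R) @[N --> \oo] --> pi ^+ 2 / 64.
Proof.
under eq_fun do rewrite sum_even_cub.
have Q := cvg_odd_inv; have S := @cvg_sum_odd R.
have -> : pi ^+ 2 / 64 = (1 - 0 ^+ 3 + (pi ^+ 2 / 8 - 1) - 0 ^+ 2 / 2 + 0 / 2) / 8 :> R by lra.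
have Q2 : q N ^+ 2 @[N --> \oo] --> (0 : R) ^+ 2 by apply: cvgM.
have Q3 : q N ^+ 3 @[N --> \oo] --> (0 : R) ^+ 3 by apply: cvgM.
apply: cvgMl; apply: cvgD; last exact: cvgMl.
apply: cvgB; last exact: cvgMl.
by apply: cvgD => //; apply: cvgB => //; exact: cvg_cst.
Qed.

Lemma cvg_sum_even_inv :
  \sum_(1 <= j < N.+1) (((2 * j%:R) ^+ 2 - 1)^-1 : R) @[N --> \oo] --> (2^-1 : R).
Proof.
under eq_fun do rewrite sum_even_inv.
suff : (1 - q N) / 2 @[N --> \oo] --> ((1 - 0) / 2 : R) by rewrite subr0 div1r.
by apply: cvgMl; apply: cvgB; [exact: cvg_cst|exact: cvg_odd_inv].
Qed.

Let a (N : nat) : R := \sum_(1 <= j < N.+1) ((2 * j%:R) ^+ 2 / ((2 * j%:R) ^+ 2 - 1) ^+ 2).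
Let g (N : nat) : R := \sum_(1 <= j < N.+1) ((2 * j%:R) ^+ 2 / ((2 * j%:R) ^+ 2 - 1) ^+ 3).
Let e (N : nat) : R := ((2 * N.+1%:R) ^+ 2 - 1)^-1.

Let e_gt0 N : 0 < (2 * N.+1%:R) ^+ 2 - 1 :> R.
Proof. by have : 1 <= N.+1%:R :> R; [rewrite ler1n|nra]. Qed.

(** A term of [g] is the corresponding term of [a] times a factor that decreases with the index. So
    the quotient of the tails, which will be [be ^+ 2] at the compensating index, is at most [e N]:
    small enough for the exponential moment, and tending to 0. *)
Lemma sum_even_tail (N M : nat) : (N <= M)%N ->
  [/\ a N <= a M, g N <= g M & g M - g N <= e N * (a M - a N)].
Proof.
move=> NM; have [k ->] : exists k, M = (N + k)%N by exists (M - N)%N; rewrite subnKC.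
elim: k {NM} => [|k [IH1 IH2 IH3]]; first by rewrite addn0 !subrr mulr0.
have aS j : a j.+1 = a j + (2 * j.+1%:R) ^+ 2 / ((2 * j.+1%:R) ^+ 2 - 1) ^+ 2 by rewrite /a big_nat_recr.
have gS j : g j.+1 = g j + e j * ((2 * j.+1%:R) ^+ 2 / ((2 * j.+1%:R) ^+ 2 - 1) ^+ 2).
  rewrite /g big_nat_recr//= /e exprS invfM; congr (_ + _); ring.
rewrite addnS aS gS.
have t0 : 0 <= (2 * (N + k).+1%:R) ^+ 2 / ((2 * (N + k).+1%:R) ^+ 2 - 1) ^+ 2 :> R by rewrite divr_ge0 ?sqr_ge0.
have eNk : e (N + k)%N <= e N.
  rewrite lef_pV2 ?posrE// lerD2r ler_pXn2r ?nnegrE ?mulr_ge0// ler_pM2l// ler_nat ltnS.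
  exact: leq_addr.
have e0 : 0 <= e (N + k)%N by rewrite invr_ge0 ltW.
move: t0 eNk e0 IH1 IH2 IH3; move: (_ / _) (e N) (e (N + k)%N) (a N) (g N) (a (N + k)%N) (g (N + k)%N).
move=> t x y a1 g1 a2 g2 t0 xy y0 h1 h2 h3; split; nra.
Qed.

Lemma sum_even_remainder (N : nat) : [/\ a N <= pi ^+ 2 / 16, g N <= pi ^+ 2 / 64 &
  pi ^+ 2 / 64 - g N <= e N * (pi ^+ 2 / 16 - a N)].
Proof.
have ca := cvg_sum_even_sqr; have cg := cvg_sum_even_cub.
split.
- apply: (cvgr_to_ge ca); near=> M; have NM : (N <= M)%N by near: M; exists N.
  by have [] := sum_even_tail NM.
- apply: (cvgr_to_ge cg); near=> M; have NM : (N <= M)%N by near: M; exists N.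
  by have [] := sum_even_tail NM.
rewrite -subr_ge0.
have H : e N * (a M - a N) - (g M - g N) @[M --> \oo] --> e N * (pi ^+ 2 / 16 - a N) - (pi ^+ 2 / 64 - g N).
  apply: cvgB; last by apply: cvgB => //; exact: cvg_cst.
  by apply: cvgMr; apply: cvgB => //; exact: cvg_cst.
apply: (cvgr_to_ge H); near=> M; have NM : (N <= M)%N by near: M; exists N.
by rewrite subr_ge0; have [] := sum_even_tail NM.
Unshelve. all: by end_near. Qed.

End mixture_constants.

(** * The modulus of the integrand as a limit of Gaussian mixtures *)

Section mixture_data.
Context (R : realType) (n' : nat) (x2 : R).
Context (x20 : 0 <= x2).
Local Notation n := n'.+1.
Local Notation I N := (option ('I_(2 * N.+1) * 'I_n)).

Let kk (i : nat) : R := i.+2%:R.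
Let asum (N : nat) : R := \sum_(1 <= j < N.+1) ((2 * j%:R) ^+ 2 / ((2 * j%:R) ^+ 2 - 1) ^+ 2).
Let gsum (N : nat) : R := \sum_(1 <= j < N.+1) ((2 * j%:R) ^+ 2 / ((2 * j%:R) ^+ 2 - 1) ^+ 3).

Definition mode_al (i : nat) : R :=
  if odd i then 0 else 2 * Num.sqrt x2 * kk i / (kk i ^+ 2 - 1).

(* [Some (i, j)] is the j-th copy of the mode [i + 2]; [mode_al] vanishes at odd modes because the
   poles of [coth (s / 2)] are the even multiples of pi times the imaginary unit. The extra index
   [None] compensates the truncation: with it [\sum al ^+ 2] and [\sum (al * be) ^+ 2] are equal to
   their limits for every [N]. *)
Definition mixture_al (N : nat) (p : I N) : R :=
  match p with
  | None => Num.sqrt (4 * x2 * (pi ^+ 2 / 16 - asum N.+1))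
  | Some (i, j) => if j == ord0 then mode_al i else 0
  end.

Definition mixture_be (N : nat) (p : I N) : R :=
  match p with
  | None => Num.sqrt ((pi ^+ 2 / 64 - gsum N.+1) / (pi ^+ 2 / 16 - asum N.+1))
  | Some (i, j) => (Num.sqrt (kk i ^+ 2 - 1))^-1
  end.

Lemma kk_gt0 i : 0 < kk i ^+ 2 - 1.
Proof. by have : 2 <= kk i; [rewrite ler_nat|nra]. Qed.

Lemma mixture_be_Some N i j : @mixture_be N (Some (i, j)) ^+ 2 = (kk i ^+ 2 - 1)^-1.
Proof. by rewrite /= exprVn sqr_sqrtr// ltW// kk_gt0. Qed.

Lemma big_option_pair (N : nat) (T : Type) (idx : T) (op : Monoid.com_law idx) (F : I N -> T) :
  \big[op/idx]_p F p = op (F None) (\big[op/idx]_(i < 2 * N.+1) \big[op/idx]_(j < n) F (Some (i, j))).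
Proof.
rewrite (bigD1 None)//=; congr (op _ _).
rewrite pair_bigA/=.
rewrite (reindex_omap Some id)/=; last by case.
by apply: eq_big => [[i j]|[i j] _]; rewrite ?eqxx.
Qed.

Lemma sum_even_index (F : nat -> R) (N : nat) :
  \sum_(i < 2 * N) (if odd i then 0 else F i.+2) = \sum_(1 <= j < N.+1) F (2 * j)%N.
Proof.
elim: N => [|N IH]; first by rewrite muln0 big_ord0 big_geq.
rewrite mulnS add2n !big_ord_recr/= big_nat_recr//= -IH.
have -> : (if odd (2 * N) then 0 else F (2 * N).+2) = F (2 * N).+2 by rewrite mul2n odd_double.
have -> : ~~ odd (2 * N) by rewrite mul2n odd_double.
by rewrite addr0 mulnS add2n.
Qed.

Lemma mixture_sum_sqr_al N : \sum_p @mixture_al N p ^+ 2 = pi ^+ 2 * x2 / 4.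
Proof.
have [aN _ _] := sum_even_remainder R N.+1.
rewrite big_option_pair /= sqr_sqrtr; last by rewrite mulr_ge0 ?mulr_ge0 ?subr_ge0.
have E (i : 'I_(2 * N.+1)) : \sum_(j < n) (if j == ord0 then mode_al i else 0) ^+ 2 =
   (if odd i then 0 else 4 * x2 * ((i.+2)%:R ^+ 2 / ((i.+2)%:R ^+ 2 - 1) ^+ 2)).
  rewrite (bigD1 ord0)//= big1 => [|j /negbTE ->]; last by rewrite expr0n.
  rewrite addr0 /mode_al; case: ifP => _; first by rewrite expr0n.
  rewrite expr_div_n !exprMn sqr_sqrtr// /kk; ring.
under eq_bigr => i _ do rewrite E.
rewrite (sum_even_index (fun k => 4 * x2 * (k%:R ^+ 2 / (k%:R ^+ 2 - 1) ^+ 2))) -mulr_sumr.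
under eq_bigr => i _ do rewrite natrM.
rewrite -/(asum N.+1); by move: (pi : R) (asum _) => p s; field.
Qed.

(** The largest value is that of the mode 2, namely [1 / (2^2 - 1)]. *)
Lemma mixture_be_sqr_le N p : @mixture_be N p ^+ 2 <= 3^-1.
Proof.
have [aN gN aeN] := sum_even_remainder R N.+1.
case: p => [[i j]|]; last first.
  rewrite /= sqr_sqrtr; last by rewrite divr_ge0 ?subr_ge0.
  have [->|a0] := eqVneq (pi ^+ 2 / 16 - asum N.+1) 0; first by rewrite invr0 mulr0 invr_ge0.
  rewrite ler_pdivrMr; last by rewrite lt_neqAle eq_sym a0 subr_ge0.
  apply: (le_trans aeN); apply: ler_wpM2r; first by rewrite subr_ge0.
  rewrite lef_pV2 ?posrE//; have : 2 <= N.+2%:R :> R by rewrite ler_nat.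
    by nra.
  by nra.
rewrite mixture_be_Some lef_pV2 ?posrE ?kk_gt0//.
have : 2 <= kk i by rewrite ler_nat.
nra.
Qed.

Lemma mixture_be_None_sqr N : @mixture_be N None ^+ 2 <= N.+2%:R^-1.
Proof.
have [aN gN aeN] := sum_even_remainder R N.+1.
rewrite /= sqr_sqrtr; last by rewrite divr_ge0 ?subr_ge0.
have [->|a0] := eqVneq (pi ^+ 2 / 16 - asum N.+1) 0; first by rewrite invr0 mulr0 invr_ge0.
rewrite ler_pdivrMr; last by rewrite lt_neqAle eq_sym a0 subr_ge0.
apply: (le_trans aeN); apply: ler_wpM2r; first by rewrite subr_ge0.
have : 2 <= N.+2%:R :> R by rewrite ler_nat.
move: (N.+2%:R : R) => y y2; rewrite lef_pV2 ?posrE; nra.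
Qed.

Lemma mixture_sum_sqr_albe N : \sum_p (@mixture_al N p * @mixture_be N p) ^+ 2 = pi ^+ 2 * x2 / 16.
Proof.
have [aN gN aeN] := sum_even_remainder R N.+1.
rewrite big_option_pair.
have -> : (@mixture_al N None * @mixture_be N None) ^+ 2 = 4 * x2 * (pi ^+ 2 / 64 - gsum N.+1).
  rewrite exprMn /= !sqr_sqrtr ?mulr_ge0 ?invr_ge0 ?subr_ge0//.
  (* If the first remainder vanished, [sum_even_remainder] would make the second vanish too, so the
     default value of the quotient does no harm. *)
  have [a0|a0] := eqVneq (pi ^+ 2 / 16 - asum N.+1) 0; last by rewrite -[LHS]mulrA [_ * (_ / _)]mulrC divfK.
  have g0 : pi ^+ 2 / 64 - gsum N.+1 = 0.
    apply/eqP; rewrite eq_le subr_ge0 gN andbT (le_trans aeN)//.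
    by rewrite -/(asum N.+1) a0 mulr0.
  by rewrite a0 g0 !(mulr0, mul0r).
have E (i : 'I_(2 * N.+1)) : \sum_(j < n) (@mixture_al N (Some (i, j)) * @mixture_be N (Some (i, j))) ^+ 2 =
   (if odd i then 0 else 4 * x2 * ((i.+2)%:R ^+ 2 / ((i.+2)%:R ^+ 2 - 1) ^+ 3)).
  rewrite (bigD1 ord0)// big1 => [|j /negbTE j0]; last by rewrite /= j0 mul0r expr0n.
  rewrite exprMn mixture_be_Some /= addr0 /mode_al; case: ifP => _; first by rewrite expr0n mul0r.
  rewrite expr_div_n !exprMn sqr_sqrtr//; move: (lt0r_neq0 (kk_gt0 i)); rewrite /kk.
  by move: (i.+2%:R : R) => y yn; field.
under eq_bigr => i _ do rewrite E.
rewrite (sum_even_index (fun k => 4 * x2 * (k%:R ^+ 2 / (k%:R ^+ 2 - 1) ^+ 3))) -mulr_sumr.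
under eq_bigr => i _ do rewrite natrM.
rewrite /= -/(gsum N.+1).
by move: (pi : R) (gsum _) => p s; field.
Qed.

(** The surplus [2 / K.+1%:R] lets the induction close; what is used is the bound [1 / 3], uniform
    in [K]. *)
Lemma prod_sqr_ge (K : nat) : (1 + 2 / K.+1%:R) / 3 <= \prod_(i < K) (1 - (kk i ^+ 2 - 1)^-1).
Proof.
elim: K => [|K IH]; first by rewrite big_ord0; lra.
rewrite big_ord_recr/=.
have f0 : 0 < 1 - (kk K ^+ 2 - 1)^-1.
  rewrite subr_gt0 invf_lt1 ?kk_gt0//; have : 2 <= kk K by rewrite ler_nat.
  by nra.
apply: le_trans (ler_wpM2r (ltW f0) IH).
rewrite /kk -[K.+2]addn2 -[K.+1]addn1 !natrD.
have : (0 : R) <= K%:R by exact: ler0n.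
move: (K%:R : R) => y y0; rewrite -subr_ge0.
have -> : (1 + 2 / (y + 1)) / 3 * (1 - ((y + 2) ^+ 2 - 1)^-1) - (1 + 2 / (y + 2)) / 3 =
   y / (3 * (y + 1) ^+ 2 * (y + 2)).
  by field; rewrite !gt_eqF//; nra.
by rewrite divr_ge0 ?mulr_ge0 ?sqr_ge0//; lra.
Qed.

Lemma prodV_sqrt (I : finType) (F : I -> R) (k : nat) : (forall i, 0 <= F i) ->
  \prod_i (Num.sqrt (F i))^-1 ^+ k = (Num.sqrt (\prod_i F i))^-1 ^+ k.
Proof.
move=> F0; rewrite prodrXl; congr (_ ^+ _).
by elim/big_rec2 : _ => [|i y1 y2 _ ->]; [rewrite sqrtr1 invr1|rewrite sqrtrM// invfM].
Qed.

Lemma mixture_prod_le N : \prod_p (Num.sqrt (1 - @mixture_be N p ^+ 2))^-1 <=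
  (Num.sqrt (2 / 3))^-1 * (Num.sqrt (1 / 3))^-1 ^+ n.
Proof.
rewrite big_option_pair.
have F0 (i : 'I_(2 * N.+1)) : 0 <= 1 - (kk i ^+ 2 - 1)^-1.
  rewrite subr_ge0 invf_le1 ?kk_gt0//; have : 2 <= kk i by rewrite ler_nat.
  by nra.
under eq_bigr => i _ do (under eq_bigr => j _ do rewrite mixture_be_Some); rewrite /=.
under eq_bigr => i _ do rewrite prodr_const card_ord.
rewrite prodV_sqrt//.
have P0 := prod_sqr_ge (2 * N.+1).
have P1 : 1 / 3 <= \prod_(i < 2 * N.+1) (1 - (kk i ^+ 2 - 1)^-1).
  by apply: le_trans P0; rewrite ler_wpM2r// lerDl divr_ge0.
have b3 := @mixture_be_sqr_le N None; rewrite -/(@mixture_be N None).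
apply: ler_pM; rewrite ?exprn_ge0 ?invr_ge0 ?sqrtr_ge0//.
  rewrite lef_pV2 ?posrE ?sqrtr_gt0; try lra.
  by rewrite ler_wsqrtr//; lra.
apply: lerXn2r; rewrite ?nnegrE ?invr_ge0 ?sqrtr_ge0//.
rewrite lef_pV2 ?posrE ?sqrtr_gt0; try lra.
by rewrite ler_wsqrtr.
Qed.

End mixture_data.

(** * Laplace transforms of the mixtures, their limit and a dominating function *)

Section mixture_laplace.
Context (R : realType).
Local Notation mu := (@lebesgue_measure R).
Local Notation T := (measurableTypeR R).
Local Notation leb n := (lebesgue_Rn R n).

(** The coefficient of [|eta|^2] in [(ss + pi^2) T / h], where [ss = |lambda|^2]. *)
Definition laplace_rate (h ss : R) : R := (ss + pi ^+ 2) / (2 * pi ^+ 2 * h).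

Definition laplace_factor (th h a b2 : R) : R :=
  (Num.sqrt (1 + 2 * th * (h * b2)))^-1 * expR (- (th * a ^+ 2 / (1 + 2 * th * (h * b2)))).

Lemma laplace_rate_gt0 (h ss : R) : 0 < h -> 0 <= ss -> 0 < laplace_rate h ss.
Proof.
move=> h0 ss0; have p0 : 0 < pi ^+ 2 :> R by rewrite exprn_gt0// pi_gt0.
by apply: divr_gt0; [exact: ltr_wpDl|apply: mulr_gt0 => //; exact: mulr_gt0].
Qed.

Lemma integral_mixture_laplace n d (al be : 'I_d -> R) (h s ss : R) : 0 < h -> s ^+ 2 = h -> 0 <= ss ->
  (\int[(leb n \x leb d)%E]_p (gaussW p.2 *
      expR (- ((ss + pi ^+ 2) / h * mixtureT al be s (sqnorm p.1) p.2)))%:E =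
   (Num.sqrt (pi / laplace_rate h ss) ^+ n *
      \prod_(i < d) laplace_factor (laplace_rate h ss) h (al i) (be i ^+ 2))%:E)%E.
Proof.
move=> h0 sh ss0; have th0 := laplace_rate_gt0 h0 ss0.
set th := laplace_rate h ss in th0 *.
rewrite fubini_tonelli1//=; last 2 first.
- by rewrite /mixtureT; meas.
- by move=> p; rewrite lee_fin !mulr_ge0 ?gaussW_ge0 ?expR_ge0.
set P := \prod_(i < d) _.
have P0 : 0 <= P by apply: prodr_ge0 => i _; rewrite mulr_ge0 ?expR_ge0// invr_ge0 sqrtr_ge0.
have d0 i : 0 < 1 + 2 * th * (s * be i) ^+ 2.
  apply: ltr_wpDr => //; apply: mulr_ge0 (sqr_ge0 _); apply: mulr_ge0 => //; exact: ltW.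
have PE := integral_gaussW al d0.
have {}PE : (\int[leb d]_y (gaussW y * expR (- \sum_(i < d) (th * (al i + s * be i * tnth y i) ^+ 2)))%:E = P%:E)%E.
  rewrite PE; congr EFin; apply: eq_bigr => i _.
  by rewrite /laplace_factor exprMn sh.
rewrite /fubini_F /= (_ : (\int[leb n]_t _)%E = (\int[leb n]_t (P%:E * (expR (- (th * sqnorm t)))%:E))%E); last first.
  apply: eq_integral => t _.
  transitivity ((expR (- (th * sqnorm t)))%:E *
      \int[leb d]_y (gaussW y * expR (- \sum_(i < d) (th * (al i + s * be i * tnth y i) ^+ 2)))%:E)%E; last by rewrite PE muleC.
  rewrite -integralZl_ge0_EFin ?expR_ge0//; last 2 first.
  - by meas.
  - by move=> y; rewrite mulr_ge0 ?gaussW_ge0 ?expR_ge0.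
  apply: eq_integral => y _; rewrite -EFinM; congr EFin; rewrite [RHS]mulrCA -expRD; congr (_ * expR _).
  rewrite -mulr_sumr /mixtureT /th /laplace_rate.
  move: (lt0r_neq0 (pi_gt0 R)) (lt0r_neq0 h0); generalize (@pi R) => p pn hn.
  by move: (\sum_(i < d) _) (sqnorm t) => S v; field; rewrite pn hn.
have mE : measurable_fun setT (fun t : n.-tuple T => expR (- (th * sqnorm t))) by rewrite /sqnorm; meas.
rewrite integralZl_ge0_EFin//.
by rewrite integral_gauss_sqnorm// -EFinM mulrC.
Qed.

Lemma prod_nat1_shift (F : nat -> R) (K : nat) :
  \prod_(1 <= k < K.+2) F k = F 1%N * \prod_(i < K) F i.+2.
Proof.
elim: K => [|K IH]; first by rewrite big_nat1 big_ord0 mulr1.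
by rewrite big_nat_recr//= IH big_ord_recr/= mulrA.
Qed.

Lemma prod_nat2_shift (F : nat -> R) (K : nat) :
  \prod_(2 <= k < K.+2) F k = \prod_(i < K) F i.+2.
Proof.
elim: K => [|K IH]; first by rewrite big_geq// big_ord0.
by rewrite big_nat_recr//= IH big_ord_recr.
Qed.

End mixture_laplace.

Lemma cvg_oo_add (c : nat) : (N + c)%N @[N --> \oo] --> \oo.
Proof. by move=> A [k _ kA]; exists k => // N /= kN; apply: kA => /=; lia. Qed.

Lemma cvg_oo_affine (c : nat) : (2 * N + c)%N @[N --> \oo] --> \oo.
Proof. by move=> A [k _ kA]; exists k => // N /= kN; apply: kA => /=; lia. Qed.

Section mixture_laplace_limit.
Context (R : realType) (n' : nat) (x2 h : R).
Context (x20 : 0 <= x2) (h0 : 0 < h).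
Local Notation n := n'.+1.
Local Notation al N := (@mixture_al R n' x2 N).
Local Notation be N := (@mixture_be R n' N).

Definition mixture_laplace (N : nat) (ss : R) : R :=
  Num.sqrt (pi / laplace_rate h ss) ^+ n *
  \prod_p laplace_factor (laplace_rate h ss) h (al N p) (be N p ^+ 2).

Definition sinh_prod (ss : R) (K : nat) : R := \prod_(1 <= k < K.+1) (1 + ss / (k%:R ^+ 2 * pi ^+ 2)).

Lemma sinh_prod_gt0 ss K : 0 <= ss -> 0 < sinh_prod ss K.
Proof.
move=> ss0; apply: prodr_gt0 => k _; rewrite ltr_wpDr// divr_ge0// mulr_ge0 ?sqr_ge0//.
Qed.

Lemma mixture_laplaceE N ss : 0 <= ss ->
  mixture_laplace N ss =
  Num.sqrt (2 * pi * h * \prod_(2 <= k < (2 * N.+1).+2) (1 - k%:R ^- 2) / sinh_prod ss (2 * N.+1).+1) ^+ n *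
  (laplace_factor (laplace_rate h ss) h (al N None) (be N None ^+ 2) *
   expR (- (2 * x2 / h * \sum_(1 <= j < N.+2)
      (ss / (ss + 4 * pi ^+ 2 * j%:R ^+ 2) + ((2 * j%:R) ^+ 2 - 1)^-1)))).
Proof.
move=> ss0; have p0 := pi_gt0 R; have p20 : 0 < pi ^+ 2 :> R by rewrite exprn_gt0.
rewrite /mixture_laplace big_option_pair mulrCA [RHS]mulrCA; congr (_ * _).
set th := laplace_rate h ss.
(* Euler's factor divided by its value at the saddle [ss = - pi^2]; [E] below is a pole term of
   [coth] shifted to vanish there. *)
pose W (i : nat) : R := (1 + ss / (i.+2%:R ^+ 2 * pi ^+ 2)) / (1 - i.+2%:R ^- 2).
have k2 i : 1 < i.+2%:R ^+ 2 :> R by have : 2 <= i.+2%:R :> R; [rewrite ler_nat|nra].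
have D0 i : 0 < 1 - i.+2%:R ^- 2 :> R by rewrite subr_gt0 invf_lt1// (lt_trans ltr01).
have N0 i : 0 < 1 + ss / (i.+2%:R ^+ 2 * pi ^+ 2) :> R.
  by rewrite ltr_wpDr// divr_ge0// mulr_ge0 ?ltW// (lt_trans ltr01).
have W0 i : 0 < W i by rewrite divr_gt0.
have WE i : 1 + 2 * th * (h * (i.+2%:R ^+ 2 - 1)^-1) = W i.
  rewrite /W /th /laplace_rate.
  have := k2 i; move: (lt0r_neq0 p0) (lt0r_neq0 h0); generalize (@pi R) => p pn hn.
  move: (i.+2%:R : R) => y y1.
  have yn : y != 0 by apply: contraTneq y1 => ->; rewrite expr0n -leNgt ler01.
  by field; rewrite ?pn ?hn ?yn ?gt_eqF ?subr_gt0.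
pose E (k : nat) : R := 2 * x2 / h * (ss / (ss + pi ^+ 2 * k%:R ^+ 2) + (k%:R ^+ 2 - 1)^-1).
have EE i : th * (2 * Num.sqrt x2 * i.+2%:R / (i.+2%:R ^+ 2 - 1)) ^+ 2 / W i = E i.+2.
  rewrite expr_div_n !exprMn sqr_sqrtr//.
  rewrite /E /W /th /laplace_rate.
  have := k2 i; have : 0 < ss + pi ^+ 2 * i.+2%:R ^+ 2 by rewrite ltr_wpDl// mulr_gt0// exprn_gt0.
  move: (lt0r_neq0 p0) (lt0r_neq0 h0); generalize (@pi R) => p pn hn.
  move: (i.+2%:R : R) => y s1 y1.
  have yn : y != 0 by apply: contraTneq y1 => ->; rewrite expr0n -leNgt ler01.
  have y1' : y ^+ 2 - 1 != 0 by rewrite gt_eqF// subr_gt0.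
  have s1' := lt0r_neq0 s1.
  have -> : 1 + ss / (y ^+ 2 * p ^+ 2) = (ss + p ^+ 2 * y ^+ 2) / (y ^+ 2 * p ^+ 2).
    by field; rewrite pn yn.
  have -> : 1 - y ^- 2 = (y ^+ 2 - 1) / y ^+ 2 by field.
  have s2 : ss + (p * y) ^+ 2 != 0 by rewrite exprMn.
  by field; rewrite ?pn ?hn ?yn ?y1' ?s1' ?s2.
have fac (i : 'I_(2 * N.+1)) :
  \prod_(j < n) laplace_factor th h (al N (Some (i, j))) (be N (Some (i, j)) ^+ 2) =
  (Num.sqrt (W i))^-1 ^+ n * expR (- (if odd i then 0 else E i.+2)).
  transitivity (\prod_(j < n) ((Num.sqrt (W i))^-1 * expR (if j == ord0 then - (if odd i then 0 else E i.+2) else 0))).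
    apply: eq_bigr => j _; rewrite mixture_be_Some /laplace_factor WE /=; congr (_ * expR _).
    case: ifP => _; last by rewrite expr0n mulr0 mul0r oppr0.
    rewrite /mode_al; case: ifP => _; first by rewrite expr0n mulr0 mul0r.
    by rewrite EE.
  rewrite big_split/= prodr_const card_ord; congr (_ * _).
  by rewrite (bigD1 ord0)//= big1 ?mulr1// => j /negbTE ->; rewrite expR0.
transitivity (Num.sqrt (pi / th) ^+ n * \prod_(i < 2 * N.+1)
    ((Num.sqrt (W i))^-1 ^+ n * expR (- (if odd i then 0 else E i.+2)))).
  by congr (_ * _); apply: eq_bigr => i _; exact: fac.
rewrite big_split/= prodV_sqrt => [|i]; last exact: ltW.
rewrite mulrA; congr (_ * _); last first.
  rewrite -expR_sum sumrN (sum_even_index E) mulr_sumr; congr (expR (- _)).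
  by apply: eq_bigr => j _; rewrite /E natrM exprMn; congr (_ * (_ / (_ + _) + _)); rewrite -natrX; ring.
rewrite -exprMn; congr (_ ^+ _).
have PW : 0 < \prod_(i < 2 * N.+1) W i by apply: prodr_gt0.
rewrite -sqrtrV ?(ltW PW)// -sqrtrM; last first.
  by rewrite divr_ge0 ?(ltW p0)// ltW// laplace_rate_gt0.
congr Num.sqrt.
rewrite /sinh_prod prod_nat1_shift (prod_nat2_shift (fun k => 1 - k%:R ^- 2)).
have -> : \prod_(i < 2 * N.+1) W i = (\prod_(i < 2 * N.+1) (1 + ss / (i.+2%:R ^+ 2 * pi ^+ 2))) / \prod_(i < 2 * N.+1) (1 - i.+2%:R ^- 2).
  by rewrite -prodf_div.
have : \prod_(i < 2 * N.+1) (1 + ss / (i.+2%:R ^+ 2 * pi ^+ 2)) != 0 by rewrite gt_eqF// prodr_gt0.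
have : \prod_(i < 2 * N.+1) (1 - i.+2%:R ^- 2) != 0 :> R by rewrite gt_eqF// prodr_gt0.
have : ss + pi ^+ 2 != 0 by rewrite gt_eqF// ltr_wpDl.
rewrite /th /laplace_rate; move: (lt0r_neq0 p0) (lt0r_neq0 h0).
move: (\prod_(i < _) _) (\prod_(i < _) _); generalize (@pi R) => p y z pn hn sn zn yn.
rewrite expr1n mul1r; have -> : 1 + ss / p ^+ 2 = (ss + p ^+ 2) / p ^+ 2 by field.
by field; rewrite ?pn ?hn ?sn ?zn ?yn.
Qed.


Lemma laplace_factor_bounds th a b2 : 0 <= th -> 0 <= b2 -> 0 <= laplace_factor th h a b2 <= 1.
Proof.
move=> th0 b20; have D0 : 0 <= 2 * th * (h * b2) by rewrite !mulr_ge0// ltW.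
rewrite /laplace_factor mulr_ge0 ?invr_ge0 ?sqrtr_ge0 ?expR_ge0//=.
apply: mulr_ile1; rewrite ?invr_ge0 ?sqrtr_ge0 ?expR_ge0//.
  rewrite invf_le1 ?sqrtr_gt0; last lra.
  by rewrite -[leLHS]sqrtr1 ler_wsqrtr// lerDl.
rewrite -[leRHS]expR0 ler_expR oppr_le0; apply: divr_ge0; [apply: mulr_ge0 => //; exact: sqr_ge0|by apply: addr_ge0].
Qed.

Lemma cvg_compensator th : 0 < th ->
  laplace_factor th h (al N None) (be N None ^+ 2) @[N --> \oo] --> (1 : R).
Proof.
move=> th0.
have cb : be N None ^+ 2 @[N --> \oo] --> (0 : R).
  apply: (@squeeze_cvgr _ _ _ _ (fun=> 0) (fun N : nat => N.+1%:R^-1)).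
  - near=> N; rewrite sqr_ge0/= (le_trans (mixture_be_None_sqr _ _ _))//.
    by rewrite lef_pV2 ?posrE// ler_nat.
  - exact: cvg_cst.
  - exact: cvg_harmonic.
have ca : al N None ^+ 2 @[N --> \oo] --> (0 : R).
  have /(cvg_comp _ _ (cvg_oo_add 1)) H := @cvg_sum_even_sqr R.
  have H1 : 4 * x2 * (pi ^+ 2 / 16 - \sum_(1 <= j < (N + 1).+1) ((2 * j%:R) ^+ 2 / ((2 * j%:R) ^+ 2 - 1) ^+ 2)) @[N --> \oo]
     --> 4 * x2 * (pi ^+ 2 / 16 - pi ^+ 2 / 16).
    by apply: cvgMr; apply: cvgB => //; exact: cvg_cst.
  rewrite subrr mulr0 in H1; apply: cvg_trans H1; apply: near_eq_cvg; near=> N => /=; rewrite addn1.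
  rewrite sqr_sqrtr//; have [aN _ _] := sum_even_remainder R N.+1.
  by rewrite mulr_ge0 ?mulr_ge0 ?subr_ge0.
have cD : 1 + 2 * th * (h * be N None ^+ 2) @[N --> \oo] --> 1 + 2 * th * (h * 0).
  by apply: cvgD; [exact: cvg_cst|apply: cvgMr; apply: cvgMr].
rewrite !mulr0 addr0 in cD.
have cS : Num.sqrt (1 + 2 * th * (h * be N None ^+ 2)) @[N --> \oo] --> (Num.sqrt 1 : R).
  by apply: (cvg_comp _ _ cD); exact: sqrt_continuous.
have H : laplace_factor th h (al N None) (be N None ^+ 2) @[N --> \oo] --> (Num.sqrt 1)^-1 * expR (- (th * 0 / 1)).
  rewrite /laplace_factor; apply: cvgM.
    by apply: cvgV => //; rewrite sqrtr1 oner_eq0.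
  have H1 : - (th * al N None ^+ 2 / (1 + 2 * th * (h * be N None ^+ 2))) @[N --> \oo] --> - (th * 0 / 1).
    apply: cvgN; apply: cvgM; first exact: cvgMr.
    by apply: cvgV => //; exact: oner_neq0.
  by apply: (cvg_comp _ _ H1); exact: continuous_expR.
by move: H; rewrite sqrtr1 invr1 mulr0 mul0r oppr0 expR0 mulr1.
Unshelve. all: by end_near. Qed.

Lemma cvg_mixture_laplace (s : R) : 0 < s ->
  mixture_laplace N (s ^+ 2) @[N --> \oo] -->
  Num.sqrt (pi * h * (s / sinh s)) ^+ n * expR (- (x2 / (2 * h) * (s * coth (s / 2)))).
Proof.
move=> s0; have p0 := pi_gt0 R.
have s20 : 0 <= s ^+ 2 by exact: sqr_ge0.
have sh0 : 0 < sinh s / s.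
  by rewrite divr_gt0// /sinh divr_gt0// subr_gt0 ltr_expR; lra.
have cP : sinh_prod (s ^+ 2) (2 * N.+1).+1 @[N --> \oo] --> sinh s / s.
  have := cvg_prod_sinh s0 => H.
  have -> : (fun N => sinh_prod (s ^+ 2) (2 * N.+1).+1) = (fun K => sinh_prod (s ^+ 2) K) \o (fun N => (2 * N + 3)%N).
    by apply/funext => N /=; congr sinh_prod; lia.
  exact: (cvg_comp _ _ (cvg_oo_affine 3) H).
have cD : \prod_(2 <= k < (2 * N.+1).+2) (1 - k%:R ^- 2) @[N --> \oo] --> (2^-1 : R).
  have -> : (fun N => \prod_(2 <= k < (2 * N.+1).+2) (1 - k%:R ^- 2)) =
     (fun K : nat => (K%:R + 2) / (2 * (K%:R + 1)) : R) \o (fun N => (2 * N + 2)%N).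
    by apply/funext => N /=; rewrite prod_one_sub_sqr; congr ((_%:R + _) / (_ * (_%:R + _))); lia.
  exact: (cvg_comp _ _ (cvg_oo_affine 2) (@cvg_half R)).
(* The shifts [1 / ((2j)^2 - 1)] sum to [1 / 2] and cancel the constant [- 2 / 4] of the partial
   fractions. *)
have cE : \sum_(1 <= j < N.+2) (s ^+ 2 / (s ^+ 2 + 4 * pi ^+ 2 * j%:R ^+ 2) + ((2 * j%:R) ^+ 2 - 1)^-1)
    @[N --> \oo] --> s * coth (s / 2) / 4.
  have /(cvg_comp _ _ (cvg_oo_add 1)) H1 := cvg_sum_coth s0.
  have /(cvg_comp _ _ (cvg_oo_add 1)) H2 := @cvg_sum_even_inv R.
  have H3 : 4^-1 * \sum_(1 <= k < (N + 1).+1) (4 * s ^+ 2 / (s ^+ 2 + 4 * pi ^+ 2 * k%:R ^+ 2)) +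
    \sum_(1 <= j < (N + 1).+1) (((2 * j%:R) ^+ 2 - 1)^-1 : R) @[N --> \oo] --> 4^-1 * (s * coth (s / 2) - 2) + 2^-1.
    by apply: cvgD => //; apply: cvgMr.
  have -> : s * coth (s / 2) / 4 = 4^-1 * (s * coth (s / 2) - 2) + 2^-1 by field.
  apply: cvg_trans H3; apply: near_eq_cvg; near=> N => /=; rewrite addn1.
  rewrite mulr_sumr -big_split/=; apply: eq_bigr => j _; congr (_ + _).
  by rewrite mulrA mulrA mulVf ?mul1r// pnatr_eq0.
have th0 : 0 < laplace_rate h (s ^+ 2) by exact: laplace_rate_gt0.
have cC := cvg_compensator th0.
have cQ : 2 * pi * h * \prod_(2 <= k < (2 * N.+1).+2) (1 - k%:R ^- 2) / sinh_prod (s ^+ 2) (2 * N.+1).+1 @[N --> \oo]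
   --> 2 * pi * h * 2^-1 / (sinh s / s).
  by apply: cvgM; [apply: cvgMr|apply: cvgV => //; rewrite gt_eqF].
have cS : Num.sqrt (2 * pi * h * \prod_(2 <= k < (2 * N.+1).+2) (1 - k%:R ^- 2) / sinh_prod (s ^+ 2) (2 * N.+1).+1)  ^+ n @[N --> \oo]
   --> Num.sqrt (2 * pi * h * 2^-1 / (sinh s / s)) ^+ n.
  have cS0 : Num.sqrt (2 * pi * h * \prod_(2 <= k < (2 * N.+1).+2) (1 - k%:R ^- 2) / sinh_prod (s ^+ 2) (2 * N.+1).+1) @[N --> \oo]
     --> Num.sqrt (2 * pi * h * 2^-1 / (sinh s / s)) by apply: (cvg_comp _ _ cQ); exact: sqrt_continuous.
  by apply: (@cvg_comp _ _ _ _ (fun z : R => z ^+ n) _ _ _ cS0); exact: exprn_continuous.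
have cX : expR (- (2 * x2 / h * \sum_(1 <= j < N.+2) (s ^+ 2 / (s ^+ 2 + 4 * pi ^+ 2 * j%:R ^+ 2) + ((2 * j%:R) ^+ 2 - 1)^-1)))
    @[N --> \oo] --> expR (- (2 * x2 / h * (s * coth (s / 2) / 4))).
  have H : - (2 * x2 / h * \sum_(1 <= j < N.+2) (s ^+ 2 / (s ^+ 2 + 4 * pi ^+ 2 * j%:R ^+ 2) + ((2 * j%:R) ^+ 2 - 1)^-1))
    @[N --> \oo] --> - (2 * x2 / h * (s * coth (s / 2) / 4)) by apply: cvgN; apply: cvgMr.
  by apply: (cvg_comp _ _ H); exact: continuous_expR.
have -> : pi * h * (s / sinh s) = 2 * pi * h * 2^-1 / (sinh s / s).
  by rewrite [(sinh s / s)^-1]invf_div; move: (s / sinh s); generalize (@pi R) => p y; field.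
have -> : x2 / (2 * h) * (s * coth (s / 2)) = 2 * x2 / h * (s * coth (s / 2) / 4) by field; rewrite gt_eqF.
rewrite -[expR _]mul1r.
under eq_fun do rewrite mixture_laplaceE//.
by apply: cvgM => //; apply: cvgM.
Unshelve. all: by end_near. Qed.


Lemma laplace_ge0 N ss : 0 <= ss -> 0 <= mixture_laplace N ss.
Proof.
move=> ss0; have th0 := laplace_rate_gt0 h0 ss0.
rewrite mulr_ge0 ?exprn_ge0 ?sqrtr_ge0//; apply: prodr_ge0 => p _.
by have /andP[] := laplace_factor_bounds (al N p) (ltW th0) (sqr_ge0 (be N p)).
Qed.

Lemma prod_one_sub_sqr_le1 K : 0 <= (\prod_(2 <= k < K.+2) (1 - k%:R ^- 2) : R) <= 1.
Proof.
rewrite prod_one_sub_sqr; have : (0 : R) <= K%:R by exact: ler0n.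
move: (K%:R : R) => y y0; rewrite divr_ge0/=; [|lra|lra].
rewrite ler_pdivrMr; lra.
Qed.

(** Each of the first [2 m] factors is at least the last of them, and the remaining factors are at
    least 1. *)
Lemma sinh_prod_ge m ss N (c : R) : (0 < m)%N -> (2 * m <= N)%N -> 0 <= ss -> c = 2 * m%:R * pi ->
  (1 + ss / c ^+ 2) ^+ (2 * m) <= sinh_prod ss N.
Proof.
move=> m0 mN ss0 cE.
have p0 : 0 < pi ^+ 2 :> R by rewrite exprn_gt0// pi_gt0.
rewrite /sinh_prod (@big_cat_nat _ _ _ (2 * m).+1)//=.
have c0 : 0 < c ^+ 2 by rewrite cE exprMn mulr_gt0// exprn_gt0// mulr_gt0// ltr0n.
have y0 : 0 <= 1 + ss / c ^+ 2 by rewrite addr_ge0// divr_ge0// ltW.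
rewrite -[leLHS]mulr1; apply: ler_pM; rewrite ?exprn_ge0//.
  have -> : (1 + ss / c ^+ 2) ^+ (2 * m) = \prod_(1 <= k < (2 * m).+1) (1 + ss / c ^+ 2).
    by rewrite prodr_const_nat subSS subn0.
  rewrite big_nat [leRHS]big_nat; apply: ler_prod => k /andP[k1 k2]; rewrite y0/= lerD2l.
  apply: ler_wpM2l => //; rewrite lef_pV2 ?posrE//; last by rewrite mulr_gt0// exprn_gt0// ltr0n.
  rewrite cE exprMn; apply: ler_wpM2r; first exact: ltW.
  by rewrite ler_pXn2r ?nnegrE ?mulr_ge0// -natrM ler_nat.
rewrite big_nat; apply: (big_ind (fun x : R => 1 <= x)) => //.
- by move=> x y x1 y1; rewrite -[leLHS]mulr1; apply: ler_pM.
move=> k /andP[k1 _]; rewrite lerDl divr_ge0// mulr_ge0 ?sqr_ge0// ltW//.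
Qed.

(** Polynomial decay suffices: one inverse square root of Euler's product, with [2 m] of its
    factors, gives [(1 + ss / c^2)^(- m)], which is at most a constant times a product of [m]
    one-dimensional Cauchy weights, integrable by Tonelli and independent of [N]. *)
Lemma mixture_laplace_dom (m : nat) : (0 < m)%N -> exists2 C : R, 0 <= C &
  forall N (f : 'I_m -> R), (m <= N)%N -> 
  mixture_laplace N (\sum_i f i ^+ 2) <= C * \prod_i (1 + f i ^+ 2)^-1.
Proof.
move=> m0; pose c : R := 2 * m%:R * pi.
have p2 := pi_ge2 R.
have m1 : 1 <= m%:R :> R by rewrite ler1n.
have c1 : 1 <= c by rewrite /c; nra.
have c2 : 1 <= c ^+ 2 by rewrite exprn_ege1.
pose K := Num.sqrt (2 * pi * h) ^+ n.
have K0 : 0 <= K by rewrite exprn_ge0// sqrtr_ge0.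
exists (K * (c ^+ 2) ^+ m); first by rewrite mulr_ge0// exprn_ge0// sqr_ge0.
move=> N f mN; set ss := \sum_i f i ^+ 2.
have ss0 : 0 <= ss by apply: sumr_ge0 => i _; exact: sqr_ge0.
have th0 := laplace_rate_gt0 h0 ss0.
rewrite mixture_laplaceE//.
have /andP[lf0 lf1] := laplace_factor_bounds (al N None) (ltW th0) (sqr_ge0 (be N None)).
set D := \prod_(2 <= k < _) _; set P := sinh_prod _ _; set X := _ * expR _.
have X1 : X <= 1.
  apply: mulr_ile1; rewrite ?expR_ge0// -[leRHS]expR0 ler_expR oppr_le0 mulr_ge0//.
    by rewrite divr_ge0 ?mulr_ge0// ltW.
  rewrite big_nat; apply: sumr_ge0 => j /andP[j1 _]; apply: addr_ge0.
    apply: divr_ge0 => //; apply: addr_ge0 => //.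
    by apply: mulr_ge0 (sqr_ge0 _); apply: mulr_ge0 (sqr_ge0 _).
  have : 1 <= j%:R :> R by rewrite ler1n.
  by rewrite invr_ge0; move: (j%:R : R) => y y1; nra.
have D01 : 0 <= D <= 1 by exact: prod_one_sub_sqr_le1.
have P0 : 0 < P by exact: sinh_prod_gt0.
have PP : ((1 + ss / c ^+ 2) ^+ m) ^+ 2 <= P.
  have mN2 : (2 * m <= (2 * N.+1).+1)%N by clear - mN; lia.
  by rewrite -exprM [(m * 2)%N]mulnC; exact: (sinh_prod_ge m0 mN2 ss0 (erefl c)).
have y0 : 1 <= 1 + ss / c ^+ 2 by rewrite lerDl divr_ge0// sqr_ge0.
have ym : 1 <= (1 + ss / c ^+ 2) ^+ m by rewrite exprn_ege1.
have sP : (1 + ss / c ^+ 2) ^+ m <= Num.sqrt P.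
  by rewrite -[leLHS]ger0_norm ?(le_trans ler01)// -sqrtr_sqr ler_wsqrtr.
have sP1 : 1 <= Num.sqrt P by exact: le_trans sP.
have A1 : Num.sqrt (2 * pi * h * D / P) ^+ n <= K * (Num.sqrt P)^-1.
  have pih : 0 <= 2 * pi * h by rewrite !mulr_ge0// ltW// pi_gt0.
  apply: (@le_trans _ _ (Num.sqrt (2 * pi * h / P) ^+ n)).
    apply: lerXn2r; rewrite ?nnegrE ?sqrtr_ge0// ler_wsqrtr//.
    apply: ler_wpM2r; first by rewrite invr_ge0 ltW.
    by rewrite ler_piMr//; case/andP: D01.
  rewrite sqrtrM// sqrtrV ?(ltW P0)// exprMn; apply: ler_wpM2l => //.
  by rewrite exprS ler_piMr ?invr_ge0 ?sqrtr_ge0// exprn_ile1 ?invr_ge0 ?sqrtr_ge0// invf_le1// (lt_le_trans ltr01).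
apply: (@le_trans _ _ (K * (Num.sqrt P)^-1 * 1)).
  by apply: ler_pM => //; rewrite ?exprn_ge0 ?sqrtr_ge0// mulr_ge0 ?expR_ge0.
rewrite mulr1 -mulrA; apply: ler_wpM2l => //.
have -> : (c ^+ 2) ^+ m * \prod_i (1 + f i ^+ 2)^-1 = (\prod_(i < m) ((1 + f i ^+ 2) / c ^+ 2))^-1.
  by rewrite -prodfV -{1}[m]card_ord -prodr_const -big_split/=; apply: eq_bigr => i _; rewrite invf_div.
have Q0 : 0 < \prod_(i < m) ((1 + f i ^+ 2) / c ^+ 2).
  by apply: prodr_gt0 => i _; rewrite divr_gt0 ?(lt_le_trans ltr01 c2)// ltr_wpDr// sqr_ge0.
rewrite lef_pV2 ?posrE// ?(lt_le_trans ltr01)//; apply: le_trans sP.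
have -> : (1 + ss / c ^+ 2) ^+ m = \prod_(i < m) (1 + ss / c ^+ 2) by rewrite prodr_const card_ord.
apply: ler_prod => i _.
rewrite divr_ge0 ?addr_ge0 ?sqr_ge0//=.
have -> : 1 + ss / c ^+ 2 = (c ^+ 2 + ss) / c ^+ 2 by field; rewrite gt_eqF// (lt_le_trans ltr01).
apply: ler_wpM2r; first by rewrite invr_ge0 sqr_ge0.
rewrite lerD// /ss (bigD1 i)//= lerDl; apply: sumr_ge0 => j _; exact: sqr_ge0.
Qed.

End mixture_laplace_limit.

(** * Fourier transform and asymptotics *)

Section mixture_fourier.
Context (R : realType).
Local Notation mu := (@lebesgue_measure R).
Local Notation T := (measurableTypeR R).
Local Notation leb n := (lebesgue_Rn R n).

Lemma mixtureT_ge0 d (al be : 'I_d -> R) s v (y : d.-tuple T) : 0 <= v -> 0 <= mixtureT al be s v y.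
Proof.
move=> v0; apply: divr_ge0; last by apply: mulr_ge0 => //; exact: sqr_ge0.
by apply: addr_ge0 => //; apply: sumr_ge0 => i _; exact: sqr_ge0.
Qed.

Lemma mixtureT_gt0 d (al be : 'I_d -> R) s v (y : d.-tuple T) : 0 < v -> 0 < mixtureT al be s v y.
Proof.
move=> v0; apply: divr_gt0; last by rewrite mulr_gt0// exprn_gt0// pi_gt0.
by apply: ltr_wpDr => //; apply: sumr_ge0 => i _; exact: sqr_ge0.
Qed.

(** The integral over lambda without the cosine, at fixed eta and y; [mixture_osc] carries the
    cosine with its Gaussian damping. *)
Definition mixture_amp n d (m : nat) (al be : 'I_d -> R) (h s : R) (p : n.-tuple T * d.-tuple T) : R :=
  let T1 := mixtureT al be s (sqnorm p.1) p.2 in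
  gaussW p.2 * (Num.sqrt (pi * h) ^+ m * (Num.sqrt T1)^-1 ^+ m * expR (- (pi ^+ 2 * T1 / h))).

Definition mixture_osc n d (al be : 'I_d -> R) (h s r a : R) (p : n.-tuple T * d.-tuple T) : R :=
  1 + expR (- (r ^+ 2 / (16 * h * mixtureT al be s (sqnorm p.1) p.2))) * cos a.

Lemma norm_expR_cos_le1 (x a : R) : 0 <= x -> `|expR (- x) * cos a| <= 1.
Proof.
move=> x0; rewrite normrM ger0_norm ?expR_ge0//.
apply: mulr_ile1; rewrite ?expR_ge0 ?normr_ge0//.
  by rewrite -[leRHS]expR0 ler_expR oppr_le0.
by rewrite ler_norml cos_geN1 cos_le1.
Qed.

Lemma mixture_amp_ge0 n d m (al be : 'I_d -> R) h s p : 0 <= @mixture_amp n d m al be h s p.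
Proof.
by rewrite !mulr_ge0 ?gaussW_ge0 ?expR_ge0 ?exprn_ge0 ?invr_ge0 ?sqrtr_ge0.
Qed.

Lemma mixture_osc_ge0 n d (al be : 'I_d -> R) h s r a p : 0 < h -> 0 <= @mixture_osc n d al be h s r a p.
Proof.
move=> h0; have : `|expR (- (r ^+ 2 / (16 * h * mixtureT al be s (sqnorm p.1) p.2))) * cos a| <= 1.
  apply: norm_expR_cos_le1; apply: divr_ge0; first exact: sqr_ge0.
  by apply: mulr_ge0; [apply: mulr_ge0 => //; exact: ltW|exact: mixtureT_ge0 (sqnorm_ge0 _)].
by rewrite ler_norml /mixture_osc => /andP[]; lra.
Qed.

Lemma measurable_mixture_amp n d m (al be : 'I_d -> R) h s : measurable_fun setT (@mixture_amp n d m al be h s).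
Proof.
by rewrite /mixture_amp /mixtureT; meas.
Qed.

Lemma measurable_mixture_osc n d (al be : 'I_d -> R) h s r a : measurable_fun setT (@mixture_osc n d al be h s r a).
Proof.
by rewrite /mixture_osc /mixtureT; meas.
Qed.

Definition laplace_prod n d (al be : 'I_d -> R) (h ss : R) : R :=
  Num.sqrt (pi / laplace_rate h ss) ^+ n *
    \prod_(i < d) laplace_factor (laplace_rate h ss) h (al i) (be i ^+ 2).

(* [1 + cos] in place of [cos] keeps the integrands nonnegative, so that Tonelli applies without any
   integrability; [fourier_split] removes the [1] afterwards. Only [leb n] and [leb d] separately are
   sigma-finite instances, hence the two exchanges. The identity holds where [sqnorm t > 0], since
   [mixtureT] may vanish otherwise. *)
Lemma mixture_fourier n m d (al be : 'I_d -> R) (h s r a : R) (w : 'I_m -> R) : (0 < n)%N ->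
  0 < h -> s ^+ 2 = h -> \sum_(i < m) w i ^+ 2 = (r / (2 * h)) ^+ 2 ->
  (\int[leb m]_l (laplace_prod n al be h (sqnorm l) * (1 + cos (a + \sum_(i < m) w i * tnth l i)))%:E =
   \int[(leb n \x leb d)%E]_p (mixture_amp m al be h s p * mixture_osc al be h s r a p)%:E)%E.
Proof.
move=> n0 h0 sh wr.
have c0 (l : m.-tuple T) : 0 <= 1 + cos (a + \sum_(i < m) w i * tnth l i).
  by rewrite -lerBlDl sub0r cos_geN1.
pose f (z : m.-tuple T * (n.-tuple T * d.-tuple T)) : R :=
  (1 + cos (a + \sum_(i < m) w i * tnth z.1 i)) * (gaussW z.2.2 *
      expR (- ((sqnorm z.1 + pi ^+ 2) / h * mixtureT al be s (sqnorm z.2.1) z.2.2))).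
have f0 z : 0 <= f z by rewrite mulr_ge0// mulr_ge0 ?gaussW_ge0 ?expR_ge0.
have mf : measurable_fun setT f by rewrite /f /mixtureT; meas.
transitivity (\int[leb m]_l \int[(leb n \x leb d)%E]_p (f (l, p))%:E)%E.
  apply: eq_integral => l _.
  rewrite mulrC EFinM -(@integral_mixture_laplace _ n d al be h s)//; last exact: sqnorm_ge0.
  rewrite -integralZl_ge0_EFin//.
  - by rewrite /mixtureT; meas.
  - by move=> p; rewrite mulr_ge0 ?gaussW_ge0 ?expR_ge0.
have fl0 l p : (0 <= (f (l, p))%:E)%E by rewrite lee_fin.
have mfl l : measurable_fun setT (fun p => (f (l, p))%:E).
  by apply/measurable_EFinP; apply: (measurableT_comp mf); exact: measurable_pair1.
have mft t : measurable_fun setT (fun z : m.-tuple T * d.-tuple T => (f (z.1, (t, z.2)))%:E).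
  apply/measurable_EFinP; apply: (measurableT_comp mf).
  by apply/measurable_fun_pair => //=; apply/measurable_fun_pair.
pose g (z : m.-tuple T * n.-tuple T) : \bar R := (\int[leb d]_y (f (z.1, (z.2, y)))%:E)%E.
have g0 z : (0 <= g z)%E by apply: integral_ge0.
have mg : measurable_fun setT g.
  apply: (@measurable_fun_fubini_tonelli_F _ _ _ _ _ (leb d) (fun z : (m.-tuple T * n.-tuple T) * d.-tuple T => (f (z.1.1, (z.1.2, z.2)))%:E)) => //.
  apply/measurable_EFinP; apply: (measurableT_comp mf).
  by apply/measurable_fun_pair => /=; [meas|apply/measurable_fun_pair => /=; meas].
transitivity (\int[leb m]_l \int[leb n]_t g (l, t))%E.
  by apply: eq_integral => l _; rewrite fubini_tonelli1.
transitivity (\int[leb n]_t \int[leb m]_l g (l, t))%E.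
  exact: (@fubini_tonelli _ _ _ _ _ (leb m) (leb n) g).
have ao0 (p : n.-tuple T * d.-tuple T) : (0 <= (mixture_amp m al be h s p * mixture_osc al be h s r a p)%:E)%E.
  by rewrite lee_fin mulr_ge0 ?mixture_amp_ge0 ?mixture_osc_ge0.
have mao : measurable_fun setT (fun p : n.-tuple T * d.-tuple T => (mixture_amp m al be h s p * mixture_osc al be h s r a p)%:E).
  by apply/measurable_EFinP; apply: measurable_funM; [exact: measurable_mixture_amp|exact: measurable_mixture_osc].
rewrite (fubini_tonelli1 _ mao ao0).
have i1 (t : n.-tuple T) : setT t -> (0 <= \int[leb m]_l g (l, t))%E by move=> _; apply: integral_ge0.
have mi1 : measurable_fun setT (fun t : n.-tuple T => (\int[leb m]_l g (l, t))%E).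
  exact: (@measurable_fun_fubini_tonelli_G _ _ _ _ _ (leb m) g).
have mi2 := @measurable_fun_fubini_tonelli_F _ _ _ _ _ (leb d) _ mao ao0.
have i2 (t : n.-tuple T) : setT t -> (0 <= fubini_F (leb d) (fun p => (mixture_amp m al be h s p * mixture_osc al be h s r a p)%:E) t)%E.
  by move=> _; apply: integral_ge0.
apply: (ge0_ae_eq_integral _ mi1 mi2 i1 i2) => //.
have := @ae_Rn_neq0 R n n0; apply: filterS => t v0 _.
transitivity (\int[leb d]_y \int[leb m]_l (f (l, (t, y)))%:E)%E.
  exact: (@fubini_tonelli _ _ _ _ _ (leb m) (leb d) (fun z => (f (z.1, (t, z.2)))%:E)).
apply: eq_integral => y _.
rewrite /mixture_amp /mixture_osc /f /=; set T1 := mixtureT _ _ _ _ _.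
have T0 : 0 < T1 by exact: mixtureT_gt0.
have th0 : 0 < T1 / h by rewrite divr_gt0.
have := @integral_Rn_gauss_cos R m (T1 / h) a 1 w th0 (lexx _).
rewrite wr => H.
have cE : 0 <= gaussW y * expR (- (pi ^+ 2 * T1 / h)) by rewrite mulr_ge0 ?gaussW_ge0 ?expR_ge0.
transitivity ((gaussW y * expR (- (pi ^+ 2 * T1 / h)))%:E *
   \int[leb m]_x (expR (- (T1 / h * \sum_(i < m) tnth x i ^+ 2)) * (1 + cos (a + \sum_(i < m) w i * tnth x i)))%:E)%E.
  have mc : measurable_fun setT (fun l : m.-tuple T => 1 + cos (a + \sum_(i < m) w i * tnth l i)) by meas.
  have me : measurable_fun setT (fun l : m.-tuple T => expR (- (T1 / h * \sum_(i < m) tnth l i ^+ 2))) by meas.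
  have mec := measurable_funM me mc.
  have ec0 l : 0 <= expR (- (T1 / h * \sum_(i < m) tnth l i ^+ 2)) * (1 + cos (a + \sum_(i < m) w i * tnth l i)).
    by rewrite mulr_ge0 ?expR_ge0.
  rewrite -integralZl_ge0_EFin//.
  apply: eq_integral => l _; rewrite -EFinM; congr EFin.
  rewrite [RHS]mulrA [RHS]mulrC; congr (_ * _); rewrite -[RHS]mulrA -expRD; congr (_ * expR _).
  by rewrite /sqnorm; ring.
rewrite H -EFinM; congr EFin.
have -> : (r / (2 * h)) ^+ 2 / (4 * (T1 / h)) = r ^+ 2 / (16 * h * T1) by field; rewrite !gt_eqF.
have -> : pi / (T1 / h) = pi * h / T1 by rewrite invf_div mulrA.
rewrite sqrtrM ?mulr_ge0 ?(ltW h0) ?pi_ge0// sqrtrV ?(ltW T0)// exprMn; ring.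
Qed.

(** Completing the square, [pi^2 T + r^2 / (16 T) = pi r / 2 + (r - 4 pi T)^2 / (16 T)]; this splits
    off [exp (- d(g, g')^2 / (4 h))]. Where [T] is 0 both sides vanish because [0 < m]. *)
Lemma mixture_amp_osc n m d (al be : 'I_d -> R) (h s r : R) p : (0 < m)%N -> 0 < h ->
  @mixture_amp n d m al be h s p * expR (- (r ^+ 2 / (16 * h * mixtureT al be s (sqnorm p.1) p.2))) =
  Num.sqrt (pi * h) ^+ m * expR (- (pi * r / (2 * h))) * saddle_mix m al be h s r p.
Proof.
move=> m0 h0; rewrite /mixture_amp /saddle_mix /saddle_kernel; set T1 := mixtureT _ _ _ _ _.
have : 0 <= T1 by exact: mixtureT_ge0 (sqnorm_ge0 _).
rewrite le_eqVlt => /predU1P[<-|T0].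
  by rewrite sqrtr0 invr0 expr0n gtn_eqF//= !(mulr0, mul0r).
transitivity (gaussW p.2 * (Num.sqrt (pi * h) ^+ m * (Num.sqrt T1)^-1 ^+ m *
   (expR (- (pi ^+ 2 * T1 / h)) * expR (- (r ^+ 2 / (16 * h * T1)))))); first by ring.
transitivity (gaussW p.2 * (Num.sqrt (pi * h) ^+ m * (Num.sqrt T1)^-1 ^+ m *
   (expR (- (pi * r / (2 * h))) * expR (- ((r - 4 * pi * T1) ^+ 2 / (16 * h * T1)))))); last by ring.
rewrite -!expRD; congr (_ * (_ * expR _)).
by generalize (@pi R) => p'; field; rewrite !gt_eqF.
Qed.

End mixture_fourier.

Section fourier_split.
Context (R : realType) d1 d2 (S : measurableType d1) (P : measurableType d2).
Context (mu : {measure set S -> \bar R}) (nu : {measure set P -> \bar R}).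
Context (L th : S -> R) (amp rho : P -> R).
Context (mth : measurable_fun setT th) (mamp : measurable_fun setT amp) (mrho : measurable_fun setT rho).
Context (L0 : forall x, 0 <= L x) (amp0 : forall p, 0 <= amp p) (rho01 : forall p, 0 <= rho p <= 1).
Context (intL : mu.-integrable setT (EFin \o L)).
Context (H : forall a, (\int[mu]_x (L x * (1 + cos (a + th x)))%:E =
  \int[nu]_p (amp p * (1 + rho p * cos a))%:E)%E).

Lemma integrable_mul_bounded (g : S -> R) (C : R) : measurable_fun setT g ->
  (forall x, `|g x| <= C) -> mu.-integrable setT (EFin \o (fun x => L x * g x)).
Proof.
move=> mg gC; have mL : measurable_fun setT L by apply/measurable_EFinP; case/integrableP: intL.
apply: (le_integrable measurableT _ _ (integrable_EFinZ measurableT C intL)).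
  by apply/measurable_EFinP; apply: measurable_funM.
move=> x _ /=; rewrite lee_fin normrM (ger0_norm (L0 x)) mulrC.
have C0 : 0 <= C by apply: le_trans (gC x).
by rewrite normrM (ger0_norm (L0 x)) (ger0_norm C0) ler_wpM2r.
Qed.

Let f a p := amp p * (1 + rho p * cos a).
Let g a x := L x * (1 + cos (a + th x)).

Let intg a : mu.-integrable setT (EFin \o g a).
Proof.
apply: (@integrable_mul_bounded _ 2); first by meas.
move=> x; rewrite (le_trans (ler_normD _ _))// normr1.
have : `|cos (a + th x)| <= 1 by rewrite ler_norml cos_geN1 cos_le1.
lra.
Qed.

Let intf a : nu.-integrable setT (EFin \o f a).
Proof.
have f0 p : 0 <= f a p.
  rewrite mulr_ge0//; have /andP[r0 r1] := rho01 p.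
  have := cos_geN1 a; have := cos_le1 a; move: (cos a) (rho p) r0 r1 => c y *; nra.
apply/integrableP; split; first by rewrite /f; meas.
under eq_integral => p _ do rewrite /= ger0_norm//.
rewrite -H; have /integrableP[_] := intg a.
by under eq_integral => x _ do rewrite /= ger0_norm ?mulr_ge0// -?lerBlDl ?sub0r ?cos_geN1//.
Qed.

(** Subtracting the identity at [a + pi] from the one at [a] cancels the 1 and doubles the cosine.
    The pair [0], [pi] also yields the integrability of [amp * rho]. *)
Lemma fourier_split : nu.-integrable setT (EFin \o (fun p => amp p * rho p)) /\
  forall a, (\int[mu]_x (L x * cos (a + th x)) = cos a * \int[nu]_p (amp p * rho p))%R.
Proof.
have intar : nu.-integrable setT (EFin \o (fun p => amp p * rho p)).
  have := integrable_EFinZ measurableT (1 / 2) (integrable_EFinD measurableT (intf 0) (integrable_EFinZ measurableT (-1) (intf pi))).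
  apply: eq_integrable => // p _ /=; congr EFin.
  by rewrite /f cos0 cospi; field.
split=> // a.
transitivity (1 / 2 * (\int[mu]_x (g a x - g (a + pi) x)))%R.
  rewrite -RintegralZl//; last first.
    have := integrable_EFinD measurableT (intg a) (integrable_EFinZ measurableT (-1) (intg (a + pi))).
    by apply: eq_integrable => // x _ /=; rewrite mulN1r.
  by apply: eq_Rintegral => x _; rewrite /g addrAC cosDpi; field.
rewrite RintegralB//; have E b : (\int[mu]_x g b x = \int[nu]_p f b p)%R by rewrite /Rintegral H.
rewrite !E -RintegralB// -!RintegralZl//; last first.
  have := integrable_EFinD measurableT (intf a) (integrable_EFinZ measurableT (-1) (intf (a + pi))).
  by apply: eq_integrable => // x _ /=; rewrite mulN1r.
by apply: eq_Rintegral => p _; rewrite /f cosDpi; field.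
Qed.

End fourier_split.

Lemma cvg_Rintegral (R : realType) d (S : measurableType d) (mu : {measure set S -> \bar R})
    (f_ : nat -> S -> R) (f g : S -> R) :
  (forall N, measurable_fun setT (f_ N)) -> measurable_fun setT f ->
  {ae mu, forall x, f_ N x @[N --> \oo] --> f x} -> mu.-integrable setT (EFin \o g) ->
  (forall x N, `|f_ N x| <= g x) ->
  mu.-integrable setT (EFin \o f) /\
  (\int[mu]_x f_ N x)%R @[N --> \oo] --> (\int[mu]_x f x)%R.
Proof.
move=> mf_ mf ff intg fg.
have mf_' N : measurable_fun setT (EFin \o f_ N) by exact/measurable_EFinP.
have mf' : measurable_fun setT (EFin \o f) by exact/measurable_EFinP.
have ff' : {ae mu, forall x, setT x -> (EFin \o f_ N) x @[N --> \oo] --> (EFin \o f) x}.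
  by move: ff; apply: filterS => x fx _; apply: cvg_EFin => //; exact: nearW.
have fg' : {ae mu, forall x N, setT x -> (`|(EFin \o f_ N) x| <= (EFin \o g) x)%E}.
  by apply: aeW => x N _ /=; rewrite lee_fin.
have [intf _ H] := dominated_convergence measurableT mf_' mf' ff' intg fg'.
split=> //; apply: fine_cvg; rewrite fineK; last exact: integrable_fin_num.
exact: H.
Qed.

Section integrable_cauchy.
Context (R : realType).
Local Notation mu := (@lebesgue_measure R).
Local Notation T := (measurableTypeR R).

Lemma integral_oneDsqrV : (\int[mu]_x ((1 + x ^+ 2)^-1 : R)%:E = (pi : R)%:E)%E.
Proof.
rewrite (@ge0_symfun_integralT _ (fun x : R => (1 + x ^+ 2)^-1)).
- rewrite (_ : [set x : R | 0 <= x] = `[0%R, +oo[%classic); last by rewrite set_itvcy.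
  rewrite (_ : (\int[mu]_(x in `[0%R, +oo[) _)%E = (pi / 2)%:E); last exact: (@integral0y_oneDsqr R).
  by rewrite -EFinM; congr EFin; rewrite mulrCA divff ?mulr1.
- by move=> x; rewrite invr_ge0 addr_ge0 ?sqr_ge0.
- exact: (@continuous_oneDsqrV R).
- by move=> x /=; rewrite sqrrN.
Qed.

Lemma integrable_prod_oneDsqrV m (C : R) :
  (lebesgue_Rn R m).-integrable setT (EFin \o (fun t : m.-tuple T => C * \prod_(i < m) (1 + tnth t i ^+ 2)^-1)).
Proof.
apply: integrable_EFinZ => //; apply/integrableP; split; first by meas.
have p0 (t : m.-tuple T) : 0 <= \prod_(i < m) (1 + tnth t i ^+ 2)^-1.
  by apply: prodr_ge0 => i _; rewrite invr_ge0 addr_ge0 ?sqr_ge0.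
under eq_integral => t _ do rewrite /= ger0_norm//.
rewrite (@integral_Rn_prod _ m (fun _ x => (1 + x ^+ 2)^-1) (fun=> pi)) ?ltry//.
- by move=> i; meas.
- by move=> i x; rewrite invr_ge0 addr_ge0 ?sqr_ge0.
- by move=> i; exact: integral_oneDsqrV.
Qed.

End integrable_cauchy.

(** * From two-sided bounds to a relative error *)

Section ratio_close.
Context (R : realType).

Lemma expR_le1D2 (x : R) : 0 <= x -> x <= 1 / 2 -> expR x <= 1 + 2 * x.
Proof.
move=> x0 x1; have := expR_ge1Dx (- x); have := expR_gt0 (- x); have := expRxMexpNx_1 x.
have := expR_gt0 x.
move: (expR x) (expR (- x)) => y z y0 yz z0 H; nra.
Qed.

Lemma expR_invsqr_le (b k : R) j : 0 < b -> 0 < k ->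
  expR (- (b / k ^+ 2)) <= j`!%:R / b ^+ j * k ^+ (2 * j).
Proof.
move=> b0 k0; have z0 : 0 <= b / k ^+ 2 by rewrite divr_ge0 ?sqr_ge0// ltW.
have := exprn_le_exp j z0; rewrite expr_div_n -exprM.
have e0 := expR_gt0 (b / k ^+ 2); rewrite expRN => H.
have bj : 0 < b ^+ j by exact: exprn_gt0.
have kj : 0 < k ^+ (2 * j) by exact: exprn_gt0.
rewrite -[leLHS]mul1r ler_pdivrMr//.
have -> : j`!%:R / b ^+ j * k ^+ (2 * j) * expR (b / k ^+ 2) = j`!%:R * expR (b / k ^+ 2) * (k ^+ (2 * j) / b ^+ j) by ring.
apply: le_trans (ler_wpM2r _ H); last by rewrite divr_ge0// ltW.
by rewrite mulrA divfK ?divff// gt_eqF.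
Qed.

(** The additive error becomes relative because [kap] is at least of order [k^(16 n) = h^n]: the
    exponential is bounded by a multiple of [k^(2 j)] with [j = 8 n + 1], which leaves [k^2]. *)
Lemma ratio_close n (C B c0 k Y kap : R) (b : R) : 0 < C -> 0 < b -> 0 < c0 -> 0 < k -> k <= 1 -> C * k ^+ 2 <= 1 / 2 ->
  0 <= Y -> c0 * k ^+ (16 * n) <= kap -> B = C * expR (- (b / k ^+ 2)) ->
  Y <= expR (C * k ^+ 2) * kap + B -> kap <= expR (C * k ^+ 2) * Y + B ->
  `|Y / kap - 1| <= (2 * C + C * (((8 * n).+1)`!%:R / b ^+ (8 * n).+1) / c0) * k ^+ 2.
Proof.
move=> C0 b0 c00 k0 k1 Ck Y0 ck BE YB kB.
have kn j : 0 < k ^+ j by exact: exprn_gt0.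
have kap0 : 0 < kap by apply: lt_le_trans ck; rewrite mulr_gt0.
set M := _ / b ^+ _.
have M0 : 0 <= M by rewrite divr_ge0// exprn_ge0// ltW.
have BM : B <= C * M / c0 * k ^+ 2 * kap.
  rewrite BE; apply: (@le_trans _ _ (C * (M * k ^+ (2 * (8 * n).+1)))).
    by apply: ler_wpM2l; [exact: ltW|exact: expR_invsqr_le].
  apply: (@le_trans _ _ (C * M / c0 * k ^+ 2 * (c0 * k ^+ (16 * n)))); last first.
    by apply: ler_wpM2l => //; apply: mulr_ge0; [apply: divr_ge0; [apply: mulr_ge0 => //; exact: ltW|exact: ltW]|exact: ltW].
  rewrite (_ : (2 * (8 * n).+1)%N = (2 + 16 * n)%N); last by clear; lia.
  rewrite exprD le_eqVlt; apply/orP; left; apply/eqP; move: (k ^+ 2) (k ^+ (16 * n)) => u v; field; exact: lt0r_neq0.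
have E1 : expR (C * k ^+ 2) <= 1 + 2 * (C * k ^+ 2).
  by apply: expR_le1D2 => //; apply: mulr_ge0; exact: ltW.
have nE : `|Y / kap - 1| * kap = `|Y - kap|.
  by rewrite -{2}(gtr0_norm kap0) -normrM mulrBl mul1r divfK ?lt0r_neq0.
rewrite -(ler_pM2r kap0) nE.
have e1 : 1 <= expR (C * k ^+ 2) by rewrite -[leLHS]expR0 ler_expR mulr_ge0 ?(ltW C0)// ltW.
have e2 : 1 - C * k ^+ 2 <= (expR (C * k ^+ 2))^-1 by rewrite -expRN; exact: expR_ge1Dx.
have ee : expR (C * k ^+ 2) * (expR (C * k ^+ 2))^-1 = 1 by rewrite divff// gt_eqF// expR_gt0.
have B0 : 0 <= B by rewrite BE mulr_ge0 ?expR_ge0// ltW.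
have Ck0 : 0 <= C * k ^+ 2 by rewrite mulr_ge0 ?(ltW C0)// ltW.
have -> : (2 * C + C * M / c0) * k ^+ 2 * kap = 2 * (C * k ^+ 2) * kap + C * M / c0 * k ^+ 2 * kap by ring.
have zE := invr_ge0 (expR (C * k ^+ 2)); rewrite expR_ge0 in zE.
clear - e1 e2 E1 BM YB kB Y0 B0 Ck0 kap0 Ck ee zE.
move: BM YB kB Ck0 Ck e1 e2 E1 ee zE.
move: (C * k ^+ 2) (C * M / c0 * k ^+ 2 * kap) (expR (C * k ^+ 2)) (expR (C * k ^+ 2))^-1.
move=> x W e z BM YB kB x0 x1 e1 e2 E1 ez z0.
rewrite ler_norml; apply/andP; split; last by nra.
have z1 : z <= 1 by nra.
have H : kap * z <= (e * Y + B) * z by apply: ler_wpM2r.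
have H1 : (e * Y + B) * z = Y + B * z by rewrite mulrDl mulrAC ez mul1r.
have H2 : B * z <= B by rewrite ler_piMr.
have H3 : kap * (1 - x) <= kap * z by apply: ler_wpM2l => //; exact: ltW.
have H4 : 0 <= x * kap by apply: mulr_ge0 => //; exact: ltW.
rewrite H1 in H; clear - H H2 H3 H4 BM; lra.
Qed.

End ratio_close.

(** * Removal of the truncation *)

Section saddle_asymptotic.
Context (R : realType) (n' m : nat) (x2 r : R).
Context (m0 : (0 < m)%N) (x20 : 0 <= x2) (r0 : 0 < r).
Local Notation mu := (@lebesgue_measure R).
Local Notation T := (measurableTypeR R).
Local Notation leb n := (lebesgue_Rn R n).
Local Notation n := n'.+1.
Local Notation idx N := (option ('I_(2 * N.+1) * 'I_n)).

Let ali N (i : 'I_#|{: idx N}|) : R := @mixture_al R n' x2 N (enum_val i).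
Let bei N (i : 'I_#|{: idx N}|) : R := @mixture_be R n' N (enum_val i).

Lemma laplace_prod_mixture N (h ss : R) :
  laplace_prod n (@ali N) (@bei N) h ss = mixture_laplace n' x2 h N ss.
Proof.
rewrite /laplace_prod /mixture_laplace; congr (_ * _).
rewrite -(big_enum_val (fun p => laplace_factor (laplace_rate h ss) h (mixture_al x2 p) (mixture_be R p ^+ 2))).
exact: eq_bigl.
Qed.

(** Scaled by [(pi h)^(n / 2)], so that it is the limit of [mixture_laplace]. *)
Definition heat_modulus (h : R) (l : m.-tuple T) : R :=
  let s := Num.sqrt (sqnorm l) in
  Num.sqrt (pi * h * (s / sinh s)) ^+ n * expR (- (x2 / (2 * h) * (s * coth (s / 2)))).

Lemma measurable_heat_modulus h : measurable_fun setT (heat_modulus h).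
Proof.
by rewrite /heat_modulus /coth /sinh /cosh; meas.
Qed.

(** Dominated convergence in lambda. The truncation index is [N + m] because the domination holds
    from [m] on. The limit [Y] does not depend on the phase [a], so one [Y] serves the real and the
    imaginary part. *)
Lemma heat_modulus_fourier (h s : R) (w : 'I_m -> R) : 0 < h -> s ^+ 2 = h ->
  \sum_(i < m) w i ^+ 2 = (r / (2 * h)) ^+ 2 ->
  exists (K : nat -> R) (Y : R), [/\ K N @[N --> \oo] --> Y,
    forall N, (\int[(leb n \x leb #|{: idx (N + m)}|)%E]_p (saddle_mix m (@ali (N + m)) (@bei (N + m)) h s r p)%:E = (K N)%:E)%E &
    forall a, (leb m).-integrable setT (EFin \o (fun l => heat_modulus h l * cos (a + \sum_(i < m) w i * tnth l i))) /\
      (\int[leb m]_l (heat_modulus h l * cos (a + \sum_(i < m) w i * tnth l i)) =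
      Num.sqrt (pi * h) ^+ m * expR (- (pi * r / (2 * h))) * Y * cos a)%R].
Proof.
move=> h0 sh wr.
pose c : R := Num.sqrt (pi * h) ^+ m * expR (- (pi * r / (2 * h))).
have c0 : 0 < c by rewrite mulr_gt0 ?expR_gt0// exprn_gt0// sqrtr_gt0 mulr_gt0// pi_gt0.
pose L N (l : m.-tuple T) := mixture_laplace n' x2 h (N + m) (sqnorm l).
have L0 N l : 0 <= L N l by apply: laplace_ge0 => //; exact: sqnorm_ge0.
have [C C0 LC] := mixture_laplace_dom n' x20 h0 m0.
have mL N : measurable_fun setT (L N).
  by rewrite /L /mixture_laplace /laplace_factor /laplace_rate; meas.
pose D (l : m.-tuple T) := C * \prod_(i < m) (1 + tnth l i ^+ 2)^-1.
have intD : (leb m).-integrable setT (EFin \o D) by exact: integrable_prod_oneDsqrV.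
have LD N l : L N l <= D l by apply: LC; exact: leq_addl.
have intL N : (leb m).-integrable setT (EFin \o L N).
  apply: (le_integrable measurableT _ _ intD); first exact/measurable_EFinP.
  by move=> l _ /=; rewrite lee_fin ger0_norm// (le_trans (LD N l))// ler_norm.
pose th (l : m.-tuple T) := \sum_(i < m) w i * tnth l i.
have mth : measurable_fun setT th by rewrite /th; meas.
pose al N := @ali (N + m); pose be N := @bei (N + m).
pose amp N := @mixture_amp R n _ m (al N) (be N) h s.
pose rho N (p : n.-tuple T * #|{: idx (N + m)}|.-tuple T) : R :=
  expR (- (r ^+ 2 / (16 * h * mixtureT (al N) (be N) s (sqnorm p.1) p.2))).
have rho01 N p : 0 <= rho N p <= 1.
  rewrite expR_ge0/= -[leRHS]expR0 ler_expR oppr_le0 divr_ge0 ?sqr_ge0//.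
  by apply: mulr_ge0; [apply: mulr_ge0 => //; exact: ltW|exact: mixtureT_ge0 (sqnorm_ge0 _)].
have mrho N : measurable_fun setT (rho N).
  by rewrite /rho /mixtureT; meas.
have H N a : (\int[leb m]_l (L N l * (1 + cos (a + th l)))%:E =
    \int[(leb n \x leb #|{: idx (N + m)}|)%E]_p (amp N p * (1 + rho N p * cos a))%:E)%E.
  rewrite /amp /rho -(@mixture_fourier R n m _ (al N) (be N) h s r a w)//.
  by apply: eq_integral => l _; rewrite laplace_prod_mixture.
have S N := fourier_split mth (@measurable_mixture_amp R n _ m (al N) (be N) h s) (mrho N) (L0 N)
  (@mixture_amp_ge0 R n _ m (al N) (be N) h s) (rho01 N) (intL N) (H N).
have E N p : amp N p * rho N p = c * saddle_mix m (al N) (be N) h s r p.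
  by rewrite /amp /rho mixture_amp_osc.
have intK N : (leb n \x leb #|{: idx (N + m)}|)%E.-integrable setT (EFin \o saddle_mix m (al N) (be N) h s r).
  have [I _] := S N; have := integrable_EFinZ measurableT c^-1 I.
  by apply: eq_integrable => // p _ /=; rewrite E mulKf// gt_eqF.
pose K N := (\int[(leb n \x leb #|{: idx (N + m)}|)%E]_p saddle_mix m (al N) (be N) h s r p)%R.
have SK N a : (\int[leb m]_l (L N l * cos (a + th l)) = cos a * (c * K N))%R.
  have [_ ->] := S N; congr (_ * _); rewrite -RintegralZl//.
  by apply: eq_Rintegral => p _; exact: E.
have cv a : (leb m).-integrable setT (EFin \o (fun l => heat_modulus h l * cos (a + th l))) /\
    (\int[leb m]_l (L N l * cos (a + th l)))%R @[N --> \oo] --> (\int[leb m]_l (heat_modulus h l * cos (a + th l)))%R.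
  apply: (@cvg_Rintegral _ _ _ _ _ _ D) => //.
  - by move=> N; apply: measurable_funM => //; meas.
  - by apply: measurable_funM; [exact: measurable_heat_modulus|meas].
  - have := @ae_Rn_neq0 R m m0; apply: filterS => l l0; apply: cvgM; last exact: cvg_cst.
    have s0 : 0 < Num.sqrt (sqnorm l) by rewrite sqrtr_gt0.
    have := @cvg_mixture_laplace R n' x2 h x20 h0 _ s0; rewrite sqr_sqrtr; last exact: sqnorm_ge0.
    by move=> /(cvg_comp _ _ (cvg_oo_add m)).
  - move=> l N; rewrite normrM (ger0_norm (L0 N l)) (le_trans _ (LD N l))// ler_piMr//.
    by rewrite ler_norml cos_geN1 cos_le1.
pose Y := (\int[leb m]_l (heat_modulus h l * cos (0 + th l)))%R / c.
have KY : K N @[N --> \oo] --> Y.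
  have cv0 : (\int[leb m]_l (L N l * cos (0 + th l)))%R / c @[N --> \oo] --> Y.
    by apply: cvgMl; have [] := cv 0.
  apply: cvg_trans cv0; apply: near_eq_cvg; near=> N => /=.
  by rewrite SK cos0 mul1r mulrAC divff ?mul1r// gt_eqF.
exists K, Y; split => //.
  by move=> N; rewrite fineK//; apply: integrable_fin_num => //; exact: intK.
move=> a; have [inta cva] := cv a; split => //; apply: (cvg_unique (@Rhausdorff R) cva).
rewrite -/c /= [X in X @ _](_ : _ = (fun N => cos a * (c * K N))); last by apply/funext => N; rewrite SK.
by rewrite mulrC; apply: cvgMr; exact: cvgMr.
Unshelve. all: by end_near. Qed.



(** The integral of the linearised kernel is the same for every [N], thanks to the compensating
    index, and the comparison is uniform in [N]; hence both bounds pass to the limit [Y]. *)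
Lemma heat_modulus_asymptotic : pi * x2 <= 2 * r -> exists C k1 : R, [/\ 0 < C, 0 < k1 <= 1 &
  forall k (w : 'I_m -> R), 0 < k <= k1 -> \sum_(i < m) w i ^+ 2 = (r / (2 * k ^+ 16)) ^+ 2 ->
  exists e : R, `|e| <= C * k ^+ 2 /\ forall a,
    (leb m).-integrable setT (EFin \o (fun l => heat_modulus (k ^+ 16) l * cos (a + \sum_(i < m) w i * tnth l i))) /\
    (\int[leb m]_l (heat_modulus (k ^+ 16) l * cos (a + \sum_(i < m) w i * tnth l i)) =
      Num.sqrt (pi * k ^+ 16) ^+ m * expR (- (pi * r / (2 * k ^+ 16))) * (Num.sqrt 2 ^+ m *
      \int[leb n]_t (saddle_density m x2 r (k ^+ 16) (sqnorm t))) * (1 + e) * cos a)%R].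
Proof.
move=> xr; have p0 := pi_gt0 R.
pose A : R := pi / 2 * Num.sqrt x2.
have A0 : 0 <= A by rewrite mulr_ge0 ?sqrtr_ge0// divr_ge0// ltW.
have A2 : A ^+ 2 = pi ^+ 2 * x2 / 4 by rewrite exprMn sqr_sqrtr//; generalize (@pi R) => p; field.
pose M : R := (Num.sqrt (2 / 3))^-1 * (Num.sqrt (1 / 3))^-1 ^+ n.
have M0 : 0 <= M by rewrite mulr_ge0 ?exprn_ge0 ?invr_ge0 ?sqrtr_ge0.
have [k0 [C [b [/andP[k00 k01] C0 b0 cmp]]]] := saddle_mix_compare m (ltn0Sn n') r0 A0 M0.
have [c c0 low] := saddle_density_lower (ltn0Sn n') m0 x20 r0 xr.
pose k1 := Num.min k0 (2 * (C + 1))^-1.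
have C10 : 0 < 2 * (C + 1) by rewrite mulr_gt0// addr_gt0.
have k10 : 0 < k1 by rewrite lt_min k00 invr_gt0.
pose C' := 2 * C + C * (((8 * n).+1)`!%:R / b ^+ (8 * n).+1) / (Num.sqrt 2 ^+ m * c).
have s20 : 0 < Num.sqrt 2 ^+ m :> R by rewrite exprn_gt0// sqrtr_gt0.
have sc0 : 0 < Num.sqrt 2 ^+ m * c by rewrite mulr_gt0.
exists C', k1; split.
- apply: ltr_wpDr; last exact: mulr_gt0.
  apply: divr_ge0; last exact: ltW.
  apply: mulr_ge0; first exact: ltW.
  by apply: divr_ge0 => //; apply: exprn_ge0; exact: ltW.
- by rewrite k10/= ge_min k01.
move=> k w /andP[kp kk1] wr.
have kk0 : 0 < k <= k0 by rewrite kp (le_trans kk1)// ge_min lexx.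
have k_1 : k <= 1 by rewrite (le_trans _ k01)//; case/andP: kk0.
have Ck : C * k ^+ 2 <= 1 / 2.
  have H : k <= (2 * (C + 1))^-1 by rewrite (le_trans kk1)// ge_min lexx orbT.
  have H1 : k * (2 * (C + 1)) <= 1 by rewrite -ler_pdivlMr// div1r.
  have H2 : k ^+ 2 <= k by rewrite expr2 ler_piMr// ltW.
  have H3 : C * k ^+ 2 <= C * k by apply: ler_wpM2l => //; exact: ltW.
  lra.
have h0 : 0 < k ^+ 16 by exact: exprn_gt0.
have h1 : 0 < k ^+ 16 <= 1 by rewrite h0 exprn_ile1// ltW.
have sh : (k ^+ 8) ^+ 2 = k ^+ 16 by rewrite -exprM.
have [K [Y [KY KE fourier]]] := heat_modulus_fourier h0 sh wr.
pose J := (\int[leb n]_t (saddle_density m x2 r (k ^+ 16) (sqnorm t))%:E)%E.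
have mdens : measurable_fun setT (fun t : n.-tuple T => saddle_density m x2 r (k ^+ 16) (sqnorm t)).
  by apply: (measurableT_comp (@measurable_saddle_density R m x2 r (k ^+ 16))); exact: measurable_sqnorm.
have K2 N : (\int[(leb n \x leb #|{: idx (N + m)}|)%E]_p
    (saddle_mix0 m (@ali (N + m)) (@bei (N + m)) (A ^+ 2) (k ^+ 16) (k ^+ 8) r p)%:E = (Num.sqrt 2 ^+ m)%:E * J)%E.
  rewrite A2 integral_saddle_mix0//; last first.
    rewrite -(mixture_sum_sqr_albe n' x20 (N + m)) /ali /bei.
    rewrite -(big_enum_val (fun p => (mixture_al x2 p * mixture_be R p) ^+ 2)).
    exact: eq_bigl.
  rewrite -integralZl_ge0_EFin// ?ltW//.
  by move=> t; exact: saddle_density_ge0.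
have alE N : \sum_i @ali (N + m) i ^+ 2 = A ^+ 2.
  rewrite A2 -(mixture_sum_sqr_al n' x20 (N + m)) /ali.
  rewrite -(big_enum_val (fun p => mixture_al x2 p ^+ 2)).
  exact: eq_bigl.
have be1 N i : @bei (N + m) i ^+ 2 < 1.
  by rewrite (le_lt_trans (mixture_be_sqr_le _ _))// invf_lt1// ltr1n.
have beM N : \prod_i (Num.sqrt (1 - @bei (N + m) i ^+ 2))^-1 <= M.
  rewrite (le_trans _ (mixture_prod_le R n' (N + m)))// /bei.
  rewrite -(big_enum_val (fun p => (Num.sqrt (1 - mixture_be R p ^+ 2))^-1)).
  by rewrite le_eqVlt; apply/orP; left; apply/eqP; apply: eq_bigl.
pose E := expR (C * k ^+ 2); pose B := C * expR (- (b / k ^+ 2)).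
have cmpN N : ((K N)%:E <= E%:E * ((Num.sqrt 2 ^+ m)%:E * J) + B%:E)%E /\
   ((Num.sqrt 2 ^+ m)%:E * J <= E%:E * (K N)%:E + B%:E)%E.
  by have := cmp _ _ _ k (alE N) (be1 N) (beM N) kk0; rewrite /= KE K2.
(* Finiteness of the integral of the theorem comes from the comparison itself, since the integral
   [K 0] is finite. *)
have Jfin : (J \is a fin_num)%E.
  have J0 : (0 <= J)%E by apply: integral_ge0 => t _; rewrite lee_fin saddle_density_ge0.
  rewrite ge0_fin_numE//; have [_ H] := cmpN 0%N.
  rewrite ltNge leye_eq; apply/negP => /eqP Jy; move: H.
  by rewrite Jy gt0_muley ?lte_fin// -EFinM -EFinD leye_eq.
pose j := (\int[leb n]_t (saddle_density m x2 r (k ^+ 16) (sqnorm t)))%R.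
have jE : J = j%:E by rewrite fineK.
pose kap := Num.sqrt 2 ^+ m * j.
have cmpR N : K N <= E * kap + B /\ kap <= E * K N + B.
  by have := cmpN N; rewrite jE -!EFinM -!EFinD !lee_fin.
have YB : Y <= E * kap + B.
  by apply: (cvgr_to_le KY); apply: nearW => N; have [] := cmpR N.
have kB : kap <= E * Y + B.
  have KY' : E * K N + B @[N --> \oo] --> E * Y + B by apply: cvgD; [exact: cvgMr|exact: cvg_cst].
  by apply: (cvgr_to_ge KY'); apply: nearW => N; have [] := cmpR N.
have Y0 : 0 <= Y.
  apply: (cvgr_to_ge KY); apply: nearW => N; rewrite -lee_fin -KE.
  by apply: integral_ge0 => p _; rewrite lee_fin saddle_mix_ge0.
have clow : Num.sqrt 2 ^+ m * c * k ^+ (16 * n) <= kap.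
  rewrite -mulrA; apply: ler_wpM2l; first exact: ltW.
  by have := low _ h1; rewrite -/J jE lee_fin -exprM.
have kap0 : 0 < kap by apply: lt_le_trans clow; rewrite mulr_gt0// exprn_gt0.
exists (Y / kap - 1); split.
  exact: (ratio_close C0 b0 sc0 kp k_1 Ck Y0 clow erefl YB kB).
move=> a; have [inta ->] := fourier a; split => //; congr (_ * _).
rewrite -/j -/kap -[RHS]mulrA; congr (_ * _).
by rewrite addrC subrK mulrC divfK// gt_eqF.
Qed.

End saddle_asymptotic.

(** * Reduction of the heat kernel and its constants *)

Section heat_kernel_reduction.
Context (R : realType).
Local Notation T := (measurableTypeR R).
Local Notation leb n := (lebesgue_Rn R n).

Lemma powR_half (a : R) j : 0 <= a -> a `^ (j%:R / 2) = Num.sqrt a ^+ j.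
Proof. by move=> a0; rewrite mulrC powRrM powR12_sqrt// powR_mulrn ?sqrtr_ge0. Qed.

Lemma enorm_row n (t : n.-tuple T) : enorm (\row_i tnth t i) = Num.sqrt (sqnorm t) :> R.
Proof.
by congr Num.sqrt; apply: eq_bigr => i _; rewrite !mxE expr2.
Qed.

Lemma dotpN n (x y : 'rV[R]_n) : dotp x (- y) = - dotp x y.
Proof. by rewrite /dotp -sumrN; apply: eq_bigr => i _; rewrite mxE mulrN. Qed.

Lemma enormN n (x : 'rV[R]_n) : enorm (- x) = enorm x.
Proof. by congr Num.sqrt; apply: eq_bigr => i _; rewrite mxE mulrNN. Qed.

(** For [x' = - x] the two hyperbolic terms of the phase, each with a pole at [i pi], combine into
    one function that is regular there. *)
Lemma coth_half (s : R) : 0 <= s -> s * coth s + s / sinh s = s * coth (s / 2).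
Proof.
rewrite le_eqVlt => /predU1P[<-|s0]; first by rewrite !mul0r addr0.
rewrite /coth -mulrDr; congr (_ * _).
have e2 : expR s = expR (s / 2) ^+ 2 by rewrite expr2 -expRD; congr expR; field.
rewrite /cosh /sinh !expRN e2.
have : 1 < expR (s / 2) by rewrite expR_gt1 divr_gt0.
move: (expR (s / 2)) => y y1; field.
have y2 : 1 < y * y by nra.
have y3 : 1 < (y * y) ^+ 2 by nra.
by rewrite (gt_eqF (lt_trans ltr01 y1)) !gt_eqF ?subr_gt0.
Qed.

Lemma Re_cexp_mul (a X Y : R) : complex.Re (rC a * cexp (Complex X Y)) = a * (expR X * cos Y).
Proof. by rewrite /cexp /rC /=; ring. Qed.

Lemma Im_cexp_mul (a X Y : R) : complex.Im (rC a * cexp (Complex X Y)) = a * (expR X * sin Y).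
Proof. by rewrite /cexp /rC /=; ring. Qed.

Lemma heat_phase (h X Y Z : R) :
  rC (- (4 * h)^-1) * (rC X - rC Y - 2 * iC R * rC Z) =
  Complex (- ((X - Y) / (4 * h))) (Z / (2 * h)).
Proof.
have [->|h0] := eqVneq h 0.
  rewrite !mulr0 invr0 oppr0 !mulr0 oppr0.
  by rewrite /rC /= -[Complex 0 0]/(0 : R[i]) mul0r.
rewrite /iC /rC; apply/eqP; rewrite eq_complex /=; apply/andP; split; apply/eqP; field; exact: h0.
Qed.

(** The sine is written as a cosine with phase [- (pi / 2)], so that one asymptotic formula,
    proportional to [cos a], covers both parts and gives 0 for the imaginary one. *)
Lemma heat_integrand n' m (x2 h : R) (w : 'rV[R]_m) (l : m.-tuple T) : 0 <= x2 -> 0 < h ->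
  let s := enorm (\row_i tnth l i) in
  let c := Num.sqrt (pi * h) ^- n'.+1 in
  let th := \sum_(i < m) (w 0 i / (2 * h)) * tnth l i in
  rC ((s / sinh s) `^ (n'.+1%:R / 2)) * cexp (rC (- (4 * h)^-1) *
    (rC ((x2 + x2) * (s * coth s)) - rC (2 * (- x2) * (s / sinh s)) - 2 * iC R * rC (dotp w (\row_i tnth l i)))) =
  Complex (c * (heat_modulus n' x2 h l * cos (0 + th))) (c * (heat_modulus n' x2 h l * cos (- (pi / 2) + th))).
Proof.
move=> x20 h0 s c th.
have p0 := pi_gt0 R.
have s0 : 0 <= s by exact: sqrtr_ge0.
have q0 : 0 <= s / sinh s.
  by rewrite divr_ge0// /sinh divr_ge0// subr_ge0 ler_expR; lra.
have thE : dotp w (\row_i tnth l i) / (2 * h) = th.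
  by rewrite /dotp mulr_suml; apply: eq_bigr => i _; rewrite mxE mulrAC.
rewrite heat_phase thE.
have HM : (s / sinh s) `^ (n'.+1%:R / 2) * expR (- (((x2 + x2) * (s * coth s) - 2 * - x2 * (s / sinh s)) / (4 * h))) =
    c * heat_modulus n' x2 h l.
  have pih : 0 <= pi * h by rewrite mulr_ge0// ltW.
  rewrite /heat_modulus -enorm_row -/s powR_half// (sqrtrM _ pih).
  rewrite exprMn -[_ * _ * expR (- (x2 / _ * _))]mulrA mulKf; last by rewrite expf_neq0// gt_eqF// sqrtr_gt0 mulr_gt0.
  congr (_ * expR (- _)); rewrite -coth_half//; move: (s * coth s) (s / sinh s) => y z.
  by field; rewrite gt_eqF.
apply/eqP; rewrite eq_complex; apply/andP; split; apply/eqP.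
  transitivity (c * (heat_modulus n' x2 h l * cos (0 + th))) => //.
  by rewrite (Re_cexp_mul) mulrA HM add0r -mulrA.
transitivity (c * (heat_modulus n' x2 h l * cos (- (pi / 2) + th))) => //.
by rewrite Im_cexp_mul mulrA HM [- (pi / 2) + th]addrC cosBpihalf -mulrA.
Qed.

End heat_kernel_reduction.

Section constants.
Context (R : realType).

Lemma heat_constants n m (h J e r : R) : 0 < h ->
  (4 * pi * h) `^ (- (n%:R / 2) - m%:R) * (Num.sqrt (pi * h) ^- n *
     (Num.sqrt (pi * h) ^+ m * expR (- (pi * r / (2 * h))) * (Num.sqrt 2 ^+ m * J) * (1 + e))) =
  ((2 * pi) `^ (m%:R / 2) / h `^ (m%:R / 2 + n%:R)) * Cnm R n m * 2 `^ (n%:R / 2) *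
     expR (- (2 * pi * r / (4 * h))) * J * (1 + e).
Proof.
move=> h0; have p0 := pi_gt0 R.
have -> : expR (- (2 * pi * r / (4 * h))) = expR (- (pi * r / (2 * h))).
  by congr (expR (- _)); generalize (@pi R) => p; field; rewrite gt_eqF.
have -> : - (n%:R / 2) - m%:R = - (n%:R / 2 + m%:R) :> R by rewrite opprD.
rewrite powRN /Cnm [m%:R + n%:R / 2]addrC.
have p4 : 0 < 4 * pi :> R by rewrite mulr_gt0.
rewrite powRM ?(ltW p4) ?(ltW h0)//.
set K := (4 * pi) `^ _.
have K0 : K != 0 by rewrite gt_eqF// powR_gt0.
have p2 : 0 <= 2 * pi :> R by rewrite mulr_ge0// ltW.
have h00 : h != 0 by rewrite gt_eqF.
rewrite !powRD ?h00 ?implybT// !powR_half ?(ltW h0)// !powR_mulrn ?(ltW h0)//.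
rewrite !sqrtrM ?(ltW p0)// !exprMn.
have s2 : Num.sqrt 2 ^+ n != 0 :> R by rewrite expf_neq0// gt_eqF// sqrtr_gt0.
have sp : Num.sqrt pi ^+ n != 0 :> R by rewrite expf_neq0// gt_eqF// sqrtr_gt0.
have sh : Num.sqrt h ^+ n != 0 :> R by rewrite expf_neq0// gt_eqF// sqrtr_gt0.
have shm : Num.sqrt h ^+ m != 0 :> R by rewrite expf_neq0// gt_eqF// sqrtr_gt0.
have hE j : h ^+ j = Num.sqrt h ^+ j * Num.sqrt h ^+ j by rewrite -exprMn -expr2 sqr_sqrtr// ltW.
rewrite !hE; clear hE.
move: s2 sp sh shm K0; clear.
move: (Num.sqrt 2 ^+ n) (Num.sqrt 2 ^+ m) (Num.sqrt pi ^+ n) (Num.sqrt pi ^+ m) (Num.sqrt h ^+ n) (Num.sqrt h ^+ m) (expR _).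
move=> a b c d f g E s2 sp sh shm K0; field.
by rewrite ?s2 ?sp ?sh ?shm ?K0.
Qed.

End constants.

Theorem proposition6p1 (R : realType) (n m : nat) (hn : (1 <= n)%N)
    (hm : (1 <= m)%N) (x x' : 'rV[R]_n) (u u' : 'rV[R]_m)
    (hx : x = - x') (hr : 0 < enorm (u - u'))
    (hxr : pi * enorm x ^+ 2 <= 2 * enorm (u - u')) :
  let g := (x, u) in
  let g' := (x', u') in
  V2 n (iC R * rC pi) = rC (2 `^ (n%:R / 2)) /\
  exists eps : R -> R,
    eps =O_ (0^'+) (fun h => h `^ (1 / 8)) /\
    \forall h \near 0^'+,
      heat_kernel h g g' =
        rC ((2 * pi) `^ (m%:R / 2) / h `^ (m%:R / 2 + n%:R)) *
        rC (Cnm R n m) * V2 n (iC R * rC pi) *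
        rC (expR (- (ccdist g g' ^+ 2 / (4 * h)))) *
        rC (int_Rn (fun eta : 'rV[R]_n =>
              expR (- (Etilde g g' eta / (2 * h))) /
              Num.sqrt (detA g g' eta))) *
        rC (1 + eps h).
Proof.
case: n hn x x' hx hxr => // n' _ x x' hx hxr.
have x'E : x' = - x by rewrite hx opprK.
subst x'; clear hx => g g'; split; first exact: V2_ipi.
pose r := enorm (u - u'); pose x2 := enorm x ^+ 2.
have x20 : 0 <= x2 by exact: sqr_ge0.
rewrite V2_ipi ccdist_antipodal// -/r.
have [C [k1 [C0 /andP[k10 k11] asym]]] := @heat_modulus_asymptotic R n' m x2 r hm x20 hr hxr.
(* The small parameter of the estimates: [sqrt h] is [k^8] and the error [h^(1/8)] is [k^2]. *)
pose k (h : R) := h `^ (1 / 16).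
have k16 h : 0 <= h -> k h ^+ 16 = h.
  by move=> h0; rewrite /k -powR_mulrn ?powR_ge0// -powRrM mulfVK ?powRr1.
have k2 h : k h ^+ 2 = h `^ (1 / 8).
  by rewrite /k -powR_mulrn ?powR_ge0// -powRrM; congr (_ `^ _); field.
pose w (h : R) (i : 'I_m) := (u - u') 0 i / (2 * h).
have wE h : \sum_(i < m) w h i ^+ 2 = (r / (2 * h)) ^+ 2.
  under eq_bigr => i _ do rewrite /w expr_div_n.
  rewrite -mulr_suml expr_div_n; congr (_ / _).
  by rewrite /r enorm_sqr_dotp; apply: eq_bigr => i _; rewrite expr2.
(* The range of [h] is a premise, so that an error can be chosen for every real [h]; outside the
   range it is 0. *)
pose P h e := 0 < h <= k1 ^+ 16 -> `|e| <= C * h `^ (1 / 8) /\ forall a,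
    (lebesgue_Rn R m).-integrable setT (EFin \o (fun l => heat_modulus n' x2 h l * cos (a + \sum_(i < m) w h i * tnth l i))) /\
    (\int[lebesgue_Rn R m]_l (heat_modulus n' x2 h l * cos (a + \sum_(i < m) w h i * tnth l i)) =
      Num.sqrt (pi * h) ^+ m * expR (- (pi * r / (2 * h))) * (Num.sqrt 2 ^+ m *
      \int[lebesgue_Rn R n'.+1]_t (saddle_density m x2 r h (sqnorm t))) * (1 + e) * cos a)%R.
have [eps epsP] : {eps : R -> R & forall h, P h (eps h)}.
  apply: choice => h; have [/andP[h0 hk]|hn] := boolP (0 < h <= k1 ^+ 16); last by exists 0; rewrite /P (negbTE hn).
  have kk : 0 < k h <= k1.
    rewrite powR_gt0//= -(@ler_pXn2r _ 16) ?nnegrE ?powR_ge0 ?(ltW k10)//.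
    by rewrite k16// ltW.
  have := asym (k h) (w h) kk; rewrite k16 ?ltW// k2 => /(_ (wE h)) [e He].
  by exists e => _.
exists eps; split.
  apply/eqO_exP; exists C => //; near=> h.
  have h0 : 0 < h by near: h; exact: nbhs_right_gt.
  have hk : h <= k1 ^+ 16 by near: h; apply: nbhs_right_le; exact: exprn_gt0.
  have [|H _] := epsP h; first by rewrite h0.
  by rewrite [`|h `^ _|]ger0_norm ?powR_ge0.
near=> h.
have h0 : 0 < h by near: h; exact: nbhs_right_gt.
have hk : h <= k1 ^+ 16 by near: h; apply: nbhs_right_le; exact: exprn_gt0.
have [|_ H] := epsP h; first by rewrite h0.
have JE : int_Rn (fun eta : 'rV[R]_n'.+1 => expR (- (Etilde g g' eta / (2 * h))) / Num.sqrt (detA g g' eta)) =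
   (\int[lebesgue_Rn R n'.+1]_t (saddle_density m x2 r h (sqnorm t)))%R.
  apply: eq_Rintegral => t _; rewrite /saddle_density /Etilde /detA /R2 /g /g' /= enorm_row enormN.
  by rewrite sqr_sqrtr ?sqnorm_ge0.
rewrite JE -!rCM -heat_constants// /heat_kernel rCM; congr (_ * _).
have I (l : m.-tuple (measurableTypeR R)) := @heat_integrand R n' m x2 h (u - u') l x20 h0.
have EA : enorm g.1 ^+ 2 + enorm g'.1 ^+ 2 = x2 + x2 by rewrite /g' /= enormN.
have EB : dotp g.1 g'.1 = - x2 by rewrite /g /g' /= dotpN -enorm_sqr_dotp.
have EC : g.2 - g'.2 = u - u' by [].
rewrite /cint_Rn /int_Rn -[RHS]/(Complex _ 0); congr Complex.
  have [inth E] := H 0; rewrite cos0 mulr1 in E; rewrite -E -RintegralZl//.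
  apply: eq_Rintegral => l _; etransitivity; last exact: (congr1 (@complex.Re R) (I l)).
  by rewrite EA EB EC.
have [inth E] := H (- (pi / 2)).
rewrite cosN cos_pihalf mulr0 in E.
transitivity (Num.sqrt (pi * h) ^- n'.+1 * 0); last by rewrite mulr0.
rewrite -E -RintegralZl//.
apply: eq_Rintegral => l _; etransitivity; last exact: (congr1 (@complex.Im R) (I l)).
by rewrite EA EB EC.
Unshelve. all: by end_near. Qed.
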